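(* (Over $\mathsf{RCA}_0$.) Cousin's lemma for Baire class 2 functions implies $\mathsf{ATR}_0$. That is, $\mathsf{RCA}_0$ proves that if every Baire class 2 gauge $\delta\colon[0,1]\to\mathbb{R}^+$ admits a $\delta$-fine cover of $[0,1]$, then arithmetical transfinite recursion holds.
   Context: $\mathsf{RCA}_0$ is recursive comprehension with $\Sigma^0_1$-induction; $\mathsf{ATR}_0$ is arithmetical transfinite recursion (equivalently over $\mathsf{ACA}_0$: for every well-ordering $\alpha$ and every $x$, the iteration $x^{(\alpha)}$ of the Turing jump along $\alpha$ exists). In second-order arithmetic: a Baire class 1 code is a sequence of codes of continuous functions with $\langle f_n(x)\rangle$ Cauchy for every $x$; a Baire class 2 code is a sequence $\langle f_n\rangle$ of Baire class 1 codes such that for each $x$ and $\epsilon>0$ there is an open ball $B$ of radius $<\epsilon$ with $f_n(x)\in B$ for almost all $n$; $f(x)\in B(y,r)$ means that for some $s<r$, $f_n(x)\in B(y,s)$ for almost all $n$; a gauge is such a function with positive values. A $\delta$-fine cover of $[0,1]$ is a finite $P\subseteq[0,1]$ with $p\mapsto r_p\in\mathbb{R}^+$ such that $[0,1]=\bigcup_{p\in P}(p-r_p,p+r_p)$ and $r_p\le\delta(p)$ for all $p\in P$. *)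

(* Defs.v *)
From Stdlib Require Import List.
Import ListNotations.

(** * The two-sorted language of second-order arithmetic *)

(* Number variables and set variables are two separate families of de Bruijn
   indices.  As usual, equality is primitive for numbers only. *)

Inductive term : Type :=
| tvar (i : nat)
| tzero
| tone
| tadd (s t : term)
| tmul (s t : term).

Inductive form : Type :=
| feq (s t : term)
| flt (s t : term)
| fmem (t : term) (X : nat)
| fbot
| fimp (p q : form)
| fall0 (p : form)
| fall1 (p : form).

Definition fneg p := fimp p fbot.
Definition fand p q := fneg (fimp p (fneg q)).
Definition for_ p q := fimp (fneg p) q.
Definition fiff p q := fand (fimp p q) (fimp q p).
Definition fex0 p := fneg (fall0 (fneg p)).
Definition fex1 p := fneg (fall1 (fneg p)).

Fixpoint tsubst (sg : nat -> term) (t : term) : term :=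
  match t with
  | tvar i => sg i
  | tzero => tzero
  | tone => tone
  | tadd s t => tadd (tsubst sg s) (tsubst sg t)
  | tmul s t => tmul (tsubst sg s) (tsubst sg t)
  end.

Definition tlift : term -> term := tsubst (fun i => tvar (S i)).

Definition scons {A : Type} (a : A) (sg : nat -> A) (i : nat) : A :=
  match i with O => a | S j => sg j end.

Definition up0 (sg : nat -> term) : nat -> term :=
  scons (tvar 0) (fun i => tlift (sg i)).
Definition up1 (ta : nat -> nat) : nat -> nat :=
  scons 0 (fun i => S (ta i)).

Fixpoint fsubst (sg : nat -> term) (ta : nat -> nat) (p : form) : form :=
  match p with
  | feq s t => feq (tsubst sg s) (tsubst sg t)
  | flt s t => flt (tsubst sg s) (tsubst sg t)
  | fmem t X => fmem (tsubst sg t) (ta X)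
  | fbot => fbot
  | fimp p q => fimp (fsubst sg ta p) (fsubst sg ta q)
  | fall0 p => fall0 (fsubst (up0 sg) ta p)
  | fall1 p => fall1 (fsubst sg (up1 ta) p)
  end.

Definition flift0 : form -> form := fsubst (fun i => tvar (S i)) (fun X => X).
Definition flift1 : form -> form := fsubst tvar S.
Definition finst0 (t : term) : form -> form := fsubst (scons t tvar) (fun X => X).
Definition finst1 (X : nat) : form -> form := fsubst tvar (scons X (fun Y => Y)).

(** * Classical two-sorted natural deduction with equality *)

(* [T] is a set of axioms, [G] a finite list of assumptions.  The free variables
   of an axiom may be generalized, those of an assumption may not, so the members
   of [T] act through their universal closures. *)

Inductive prv (T : form -> Prop) : list form -> form -> Prop :=
| prv_ax G p : T p -> prv T G p
| prv_hyp G p : In p G -> prv T G p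
| prv_impI G p q : prv T (p :: G) q -> prv T G (fimp p q)
| prv_impE G p q : prv T G (fimp p q) -> prv T G p -> prv T G q
| prv_raa G p : prv T (fneg p :: G) fbot -> prv T G p
| prv_all0I G p : prv T (map flift0 G) p -> prv T G (fall0 p)
| prv_all0E G p t : prv T G (fall0 p) -> prv T G (finst0 t p)
| prv_all1I G p : prv T (map flift1 G) p -> prv T G (fall1 p)
| prv_all1E G p X : prv T G (fall1 p) -> prv T G (finst1 X p)
| prv_refl G t : prv T G (feq t t)
| prv_eqE G p s t : prv T G (feq s t) -> prv T G (finst0 s p) -> prv T G (finst0 t p).

(** * Formula classes *)

Inductive Delta00 : form -> Prop :=
| D_eq s t : Delta00 (feq s t)
| D_lt s t : Delta00 (flt s t)
| D_mem t X : Delta00 (fmem t X)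
| D_bot : Delta00 fbot
| D_imp p q : Delta00 p -> Delta00 q -> Delta00 (fimp p q)
| D_ball t p : Delta00 p -> Delta00 (fall0 (fimp (flt (tvar 0) (tlift t)) p)).

Inductive Sigma01 : form -> Prop :=
| Sigma01_intro p : Delta00 p -> Sigma01 (fex0 p).

Inductive Pi01 : form -> Prop :=
| Pi01_intro p : Delta00 p -> Pi01 (fall0 p).

Inductive arithmetical : form -> Prop :=
| A_eq s t : arithmetical (feq s t)
| A_lt s t : arithmetical (flt s t)
| A_mem t X : arithmetical (fmem t X)
| A_bot : arithmetical fbot
| A_imp p q : arithmetical p -> arithmetical q -> arithmetical (fimp p q)
| A_all p : arithmetical p -> arithmetical (fall0 p).

(** * Writing formulas with named binders *)

(* An [fm] is a formula waiting for the numbers [d], [e] of enclosing number and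
   set binders; a variable bound when there were [d] number binders has index
   [d' - d - 1] under [d'] of them.  [close] returns the de Bruijn formula.
   A [cls] is a definable class, given by its membership formula. *)

Definition tm := nat -> term.
Definition sv := nat -> nat.
Definition fm := nat -> nat -> form.
Definition cls := tm -> fm.

Declare Scope tm_scope.
Declare Scope fm_scope.
Delimit Scope tm_scope with tm.
Delimit Scope fm_scope with fm.
Bind Scope tm_scope with tm.
Bind Scope fm_scope with fm.

Definition close (p : fm) : form := p 0 0.

Definition zero : tm := fun _ => tzero.
Definition one : tm := fun _ => tone.
Definition add (s t : tm) : tm := fun d => tadd (s d) (t d).
Definition mul (s t : tm) : tm := fun d => tmul (s d) (t d).

Definition eqn (s t : tm) : fm := fun d _ => feq (s d) (t d).
Definition ltn (s t : tm) : fm := fun d _ => flt (s d) (t d).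
Definition bot : fm := fun _ _ => fbot.
Definition imp (p q : fm) : fm := fun d e => fimp (p d e) (q d e).
Definition neg (p : fm) : fm := fun d e => fneg (p d e).
Definition and_ (p q : fm) : fm := fun d e => fand (p d e) (q d e).
Definition or_ (p q : fm) : fm := fun d e => for_ (p d e) (q d e).
Definition iff_ (p q : fm) : fm := fun d e => fiff (p d e) (q d e).

Definition bound0 (d : nat) : tm := fun d' => tvar (d' - d - 1).
Definition bound1 (e : nat) : sv := fun e' => e' - e - 1.

Definition all0 (p : tm -> fm) : fm := fun d e => fall0 (p (bound0 d) (S d) e).
Definition ex0 (p : tm -> fm) : fm := fun d e => fex0 (p (bound0 d) (S d) e).
Definition all1 (p : sv -> fm) : fm := fun d e => fall1 (p (bound1 e) d (S e)).
Definition ex1 (p : sv -> fm) : fm := fun d e => fex1 (p (bound1 e) d (S e)).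

Definition cl (X : sv) : cls := fun t d e => fmem (t d) (X e).

Notation "s + t" := (add s t) : tm_scope.
Notation "s * t" := (mul s t) : tm_scope.
Notation "s ≐ t" := (eqn s%tm t%tm) (at level 70, no associativity) : fm_scope.
Notation "s ≺ t" := (ltn s%tm t%tm) (at level 70, no associativity) : fm_scope.
Notation "¬ p" := (neg p) (at level 75, right associativity) : fm_scope.
Notation "p ∧ q" := (and_ p q) (at level 80, right associativity) : fm_scope.
Notation "p ∨ q" := (or_ p q) (at level 85, right associativity) : fm_scope.
Notation "p ⇒ q" := (imp p q) (at level 90, right associativity) : fm_scope.
Notation "p ⇔ q" := (iff_ p q) (at level 95, no associativity) : fm_scope.
Notation "'∀N' x .. y , p" := (all0 (fun x => .. (all0 (fun y => p%fm)) ..))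
  (at level 200, x binder, y binder, right associativity) : fm_scope.
Notation "'∃N' x .. y , p" := (ex0 (fun x => .. (ex0 (fun y => p%fm)) ..))
  (at level 200, x binder, y binder, right associativity) : fm_scope.
Notation "'∀S' x .. y , p" := (all1 (fun x => .. (all1 (fun y => p%fm)) ..))
  (at level 200, x binder, y binder, right associativity) : fm_scope.
Notation "'∃S' x .. y , p" := (ex1 (fun x => .. (ex1 (fun y => p%fm)) ..))
  (at level 200, x binder, y binder, right associativity) : fm_scope.

Local Open Scope fm_scope.

(* Inserting a schematic formula [p]: number variable 0 (and, for [schema01], set
   variable 0) is the displayed argument, the remaining free variables are
   parameters and escape all enclosing binders. *)
Definition schema0 (p : form) (n : tm) : fm := fun d e =>
  fsubst (scons (n d) (fun i => tvar (i + d))) (fun X => X + e) p.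
Definition schema01 (p : form) (n : tm) (Z : sv) : fm := fun d e =>
  fsubst (scons (n d) (fun i => tvar (i + d))) (scons (Z e) (fun X => X + e)) p.

(** * Pairs, sequences of sets, functions, powers of two *)

Definition pair (i j : tm) : tm := ((i + j) * (i + j) + i)%tm.

Notation "⟨ x , y , .. , z ⟩" := (pair .. (pair x%tm y%tm) .. z%tm)
  (at level 0, x, y, z at level 60) : tm_scope.

(* The [i]-th member of the sequence of sets coded by [C]. *)
Definition slice (C : cls) (i : tm) : cls := fun m => C ⟨m, i⟩%tm.

Definition isRel (C : cls) : fm :=
  ∀N n, C n ⇒ ∃N i j, n ≐ ⟨i, j⟩.

Definition isFun (C : cls) : fm :=
  isRel C ∧ (∀N i, ∃N m, C ⟨i, m⟩%tm) ∧
  (∀N i m m', C ⟨i, m⟩%tm ⇒ C ⟨i, m'⟩%tm ⇒ m ≐ m').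

(* Gödel's function: [u] is the remainder of [c] modulo [1 + (i + 1) d]. *)
Definition beta (c d i u : tm) : fm :=
  u ≺ one + (i + one) * d ∧ ∃N q, c ≐ q * (one + (i + one) * d) + u.

(* [m = 2 ^ k] *)
Definition pow2 (k m : tm) : fm :=
  ∃N c d, beta c d zero one ∧ beta c d k m ∧
    ∀N i u v, i ≺ k ⇒ beta c d i u ⇒ beta c d (i + one)%tm v ⇒ v ≐ u + u.

(** * The axiom systems *)

Inductive basic : form -> Prop :=
| B_succ_neq0 : basic (close (∀N n, ¬ n + one ≐ zero))
| B_succ_inj : basic (close (∀N m n, m + one ≐ n + one ⇒ m ≐ n))
| B_add0 : basic (close (∀N m, m + zero ≐ m))
| B_addS : basic (close (∀N m n, m + (n + one) ≐ (m + n) + one))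
| B_mul0 : basic (close (∀N m, m * zero ≐ zero))
| B_mulS : basic (close (∀N m n, m * (n + one) ≐ m * n + m))
| B_lt0 : basic (close (∀N m, ¬ m ≺ zero))
| B_ltS : basic (close (∀N m n, m ≺ n + one ⇔ m ≺ n ∨ m ≐ n)).

Definition induction (P : tm -> fm) : fm :=
  P zero ∧ (∀N n, P n ⇒ P (n + one)%tm) ⇒ ∀N n, P n.

Definition comprehension (P : tm -> fm) : fm :=
  ∃S X, ∀N n, cl X n ⇔ P n.

Inductive RCA0 : form -> Prop :=
| RCA0_basic p : basic p -> RCA0 p
| RCA0_induction p : Sigma01 p -> RCA0 (close (induction (schema0 p)))
| RCA0_comprehension p q : Sigma01 p -> Pi01 q ->
    RCA0 (close ((∀N n, schema0 p n ⇔ schema0 q n) ⇒ comprehension (schema0 p))).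

Inductive ACA0 : form -> Prop :=
| ACA0_basic p : basic p -> ACA0 p
| ACA0_induction : ACA0 (close (∀S X, induction (cl X)))
| ACA0_comprehension p : arithmetical p -> ACA0 (close (comprehension (schema0 p))).

(* A linear order is coded by the set of pairs [⟨i, j⟩] with [i] below or equal to
   [j]; its domain is the field of that relation. *)

Definition field (X : cls) (i : tm) : fm := ∃N j, X ⟨i, j⟩%tm ∨ X ⟨j, i⟩%tm.
Definition below (X : cls) (i j : tm) : fm := X ⟨i, j⟩%tm ∧ ¬ X ⟨j, i⟩%tm.

Definition isLO (X : cls) : fm :=
  isRel X ∧
  (∀N i, field X i ⇒ X ⟨i, i⟩%tm) ∧
  (∀N i j k, X ⟨i, j⟩%tm ⇒ X ⟨j, k⟩%tm ⇒ X ⟨i, k⟩%tm) ∧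
  (∀N i j, X ⟨i, j⟩%tm ⇒ X ⟨j, i⟩%tm ⇒ i ≐ j) ∧
  (∀N i j, field X i ⇒ field X j ⇒ X ⟨i, j⟩%tm ∨ X ⟨j, i⟩%tm).

Definition isWO (X : cls) : fm :=
  isLO X ∧
  ¬ ∃S F, isFun (cl F) ∧
      ∀N n u v, cl F ⟨n, u⟩%tm ⇒ cl F ⟨n + one, v⟩%tm ⇒ below X v u.

(* [Y = {⟨n, j⟩ | j in field X, theta (n, Y^j)}], where
   [Y^j = {⟨m, i⟩ in Y | i below j}]. *)
Definition hierarchy (theta : form) (X Y : cls) : fm :=
  ∀N k, Y k ⇔ ∃N n j, k ≐ ⟨n, j⟩ ∧ field X j ∧
    ∃S Z, (∀N l, cl Z l ⇔ ∃N m i, l ≐ ⟨m, i⟩ ∧ below X i j ∧ Y l) ∧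
          schema01 theta n Z.

Inductive ATR0 : form -> Prop :=
| ATR0_ACA0 p : ACA0 p -> ATR0 p
| ATR0_recursion theta : arithmetical theta ->
    ATR0 (close (∀S X, isWO (cl X) ⇒ ∃S Y, hierarchy theta (cl X) (cl Y))).

(** * Rational numbers *)

(* [Rat p n d] is the rational [(p - n) / (d + 1)]; its code as a natural number
   is [⟨p, n, d⟩], so that a rational has many codes. *)
Record rat : Type := Rat { rpos : tm; rneg : tm; rden : tm }.

Declare Scope rat_scope.
Delimit Scope rat_scope with rat.
Bind Scope rat_scope with rat.

Definition code (a : rat) : tm := ⟨rpos a, rneg a, rden a⟩%tm.

Definition den (a : rat) : tm := (rden a + one)%tm.

Definition rzero : rat := Rat zero zero zero.
Definition rone : rat := Rat one zero zero.
(* [1 / (m + 1)] *)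
Definition rinv (m : tm) : rat := Rat one zero m.

Definition radd (a b : rat) : rat :=
  Rat (rpos a * den b + rpos b * den a)
      (rneg a * den b + rneg b * den a)
      (rden a * rden b + rden a + rden b).
Definition ropp (a : rat) : rat := Rat (rneg a) (rpos a) (rden a).
Definition rsub (a b : rat) : rat := radd a (ropp b).

Notation "a + b" := (radd a b) : rat_scope.
Notation "a - b" := (rsub a b) : rat_scope.

Definition rlt (a b : rat) : fm :=
  rpos a * den b + rneg b * den a ≺ rpos b * den a + rneg a * den b.
Definition rle (a b : rat) : fm := ¬ rlt b a.

Notation "a ≺q b" := (rlt a%rat b%rat) (at level 70, no associativity) : fm_scope.
Notation "a ≼q b" := (rle a%rat b%rat) (at level 70, no associativity) : fm_scope.

Definition rall (P : rat -> fm) : fm := ∀N p n d, P (Rat p n d).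
Definition rex (P : rat -> fm) : fm := ∃N p n d, P (Rat p n d).

Notation "'∀Q' x .. y , p" := (rall (fun x => .. (rall (fun y => p%fm)) ..))
  (at level 200, x binder, y binder, right associativity) : fm_scope.
Notation "'∃Q' x .. y , p" := (rex (fun x => .. (rex (fun y => p%fm)) ..))
  (at level 200, x binder, y binder, right associativity) : fm_scope.

(* [|a - b| <= c] *)
Definition rdist_le (a b c : rat) : fm := a ≼q b + c ∧ b ≼q a + c.

(* The ball with centre [a'] and radius [r'] is formally inside the one with
   centre [a] and radius [r]: [|a - a'| + r' < r]. *)
Definition rball_in (a' r' a r : rat) : fm :=
  a + r' ≺q a' + r ∧ a' + r' ≺q a + r.

(** * Real numbers *)

(* Sequences of rationals with [|q_k - q_(k+i)| <= 2 ^ -k]. *)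
Definition isReal (X : cls) : fm :=
  isFun X ∧
  (∀N k m, X ⟨k, m⟩%tm ⇒ ∃Q q, m ≐ code q) ∧
  (∀N k i m, ∀Q p q, X ⟨k, code p⟩%tm ⇒ X ⟨k + i, code q⟩%tm ⇒
     pow2 k (m + one)%tm ⇒ rdist_le p q (rinv m)).

(* Strict comparison of a real with a rational, read off a term of the
   representing sequence: [q_k + 2 ^ -k < a], resp. [a + 2 ^ -k < q_k]. *)
Definition lt_RQ (X : cls) (a : rat) : fm :=
  ∃N k m, ∃Q q, X ⟨k, code q⟩%tm ∧ pow2 k (m + one)%tm ∧ q + rinv m ≺q a.
Definition lt_QR (a : rat) (X : cls) : fm :=
  ∃N k m, ∃Q q, X ⟨k, code q⟩%tm ∧ pow2 k (m + one)%tm ∧ a + rinv m ≺q q.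

Definition lt_RR (X Y : cls) : fm := ∃Q a, lt_RQ X a ∧ lt_QR a Y.
Definition eq_RR (X Y : cls) : fm := ¬ lt_RR X Y ∧ ¬ lt_RR Y X.

Definition inUnit (X : cls) : fm :=
  isReal X ∧ ¬ lt_RQ X rzero ∧ ¬ lt_QR rone X.

(* [|X - a| < r] and [|X - a| <= r] *)
Definition dist_RQ_lt (X : cls) (a r : rat) : fm :=
  lt_QR (a - r) X ∧ lt_RQ X (a + r).
Definition dist_RQ_le (X : cls) (a r : rat) : fm :=
  ¬ lt_RQ X (a - r) ∧ ¬ lt_QR (a + r) X.

(* [X < Y + r] *)
Definition lt_shift (X Y : cls) (r : rat) : fm := ∃Q a, lt_QR a Y ∧ lt_RQ X (a + r).
(* [|X - Y| < r] for rational, resp. real, [r] *)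
Definition dist_RR_ltQ (X Y : cls) (r : rat) : fm := lt_shift X Y r ∧ lt_shift Y X r.
Definition dist_RR_ltR (X Y R : cls) : fm := ∃Q r, lt_QR r R ∧ dist_RR_ltQ X Y r.

(** * Continuous functions from [0,1] to the reals *)

(* The usual codes in second-order arithmetic: sets of quintuples
   [⟨n, a, r, b, s⟩], where [maps F a r b s] (some such quintuple is in [F])
   records that the ball [B(a, r)] of [0,1] is mapped into the closure of
   [B(b, s)]. *)
Definition maps (F : cls) (a r b s : rat) : fm :=
  ∃N n, F ⟨n, code a, code r, code b, code s⟩%tm.

Definition isUnitBall (a r : rat) : fm := rzero ≼q a ∧ a ≼q rone ∧ rzero ≺q r.

Definition isContCode (F : cls) : fm :=
  (∀N k, F k ⇒ ∃N n, ∃Q a r b s,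
     k ≐ ⟨n, code a, code r, code b, code s⟩ ∧ isUnitBall a r ∧ rzero ≺q s) ∧
  (∀Q a r b s b' s', maps F a r b s ⇒ maps F a r b' s' ⇒ rdist_le b b' (s + s')) ∧
  (∀Q a r b s a' r', maps F a r b s ⇒ isUnitBall a' r' ⇒ rball_in a' r' a r ⇒
     maps F a' r' b s) ∧
  (∀Q a r b s b' s', maps F a r b s ⇒ rball_in b s b' s' ⇒ maps F a r b' s').

(* [Y] is a real representing the value at [X] of the function coded by [F]. *)
Definition isValue (F X Y : cls) : fm :=
  isReal Y ∧
  ∀Q a r b s, maps F a r b s ⇒ dist_RQ_lt X a r ⇒ dist_RQ_le Y b s.

Definition isContinuous (F : cls) : fm :=
  isContCode F ∧
  ∀S X, inUnit (cl X) ⇒ ∀Q eps, rzero ≺q eps ⇒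
    ∃Q a r b s, maps F a r b s ∧ dist_RQ_lt (cl X) a r ∧ s ≺q eps.

(** * Baire classes 1 and 2 on [0,1] *)

Definition eventually (P : tm -> fm) : fm := ∃N n0, ∀N n, ¬ n ≺ n0 ⇒ P n.

Definition isBaire1 (F : cls) : fm :=
  (∀N n, isContinuous (slice F n)) ∧
  ∀S X, inUnit (cl X) ⇒ ∀Q eps, rzero ≺q eps ⇒
    ∃N n0, ∀N m n, ¬ m ≺ n0 ⇒ ¬ n ≺ n0 ⇒
      ∀S Y Z, isValue (slice F m) (cl X) (cl Y) ⇒ isValue (slice F n) (cl X) (cl Z) ⇒
        dist_RR_ltQ (cl Y) (cl Z) eps.

(* The value at [X] lies in the ball [B(y, r)] with rational centre and radius,
   for a continuous, Baire class 1 and Baire class 2 code [F] respectively.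
   In the last two cases the value need not exist as a real. *)
Definition inBall0 (F X : cls) (y r : rat) : fm :=
  ∃S Y, isValue F X (cl Y) ∧ dist_RQ_lt (cl Y) y r.
Definition inBall1 (F X : cls) (y r : rat) : fm :=
  ∃Q s, s ≺q r ∧ eventually (fun n => inBall0 (slice F n) X y s).
Definition inBall2 (F X : cls) (y r : rat) : fm :=
  ∃Q s, s ≺q r ∧ eventually (fun n => inBall1 (slice F n) X y s).

Definition isBaire2 (F : cls) : fm :=
  (∀N n, isBaire1 (slice F n)) ∧
  ∀S X, inUnit (cl X) ⇒ ∀Q eps, rzero ≺q eps ⇒
    ∃Q y r, rzero ≺q r ∧ r ≺q eps ∧
      eventually (fun n => inBall1 (slice F n) (cl X) y r).

(** * Cousin's lemma for Baire class 2 functions *)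

(* The value at [X] is positive: it lies in a ball contained in the positive
   half-line. *)
Definition isGauge (F : cls) : fm :=
  isBaire2 F ∧
  ∀S X, inUnit (cl X) ⇒ ∃Q y r, r ≼q y ∧ inBall2 F (cl X) y r.

(* The real [R] is at most the value at [X]: it is below the right endpoint of
   every ball containing that value. *)
Definition le_value2 (R F X : cls) : fm :=
  ∀Q y r, inBall2 F X y r ⇒ lt_RQ R (y + r).

(* The finite set of points is enumerated as [P_i], [i < l], and the radius of
   [P_i] is [R_i]; intervals are taken relative to [0,1]. *)
Definition isFineCover (F : cls) (l : tm) (P R : cls) : fm :=
  (∀N i, i ≺ l ⇒ inUnit (slice P i) ∧ isReal (slice R i) ∧ lt_QR rzero (slice R i)) ∧
  (∀N i j, i ≺ l ⇒ j ≺ l ⇒ eq_RR (slice P i) (slice P j) ⇒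
     eq_RR (slice R i) (slice R j)) ∧
  (∀S X, inUnit (cl X) ⇒ ∃N i, i ≺ l ∧ dist_RR_ltR (cl X) (slice P i) (slice R i)) ∧
  (∀N i, i ≺ l ⇒ le_value2 (slice R i) F (slice P i)).

Definition CousinBaire2 : form := close
  (∀S F, isGauge (cl F) ⇒ ∃N l, ∃S P R, isFineCover (cl F) l (cl P) (cl R)).

(* Main.v *)
From HB Require Import structures.
From mathcomp Require Import all_boot all_order all_algebra.
From mathcomp Require Import boolp.
From mathcomp Require Import zify ring lra.
Require Import Defs.

Set Implicit Arguments.
Unset Strict Implicit.
Unset Printing Implicit Defensive.

Import Order.TTheory GRing.Theory Num.Theory.

(* By Gödel completeness it suffices to work in a Henkin model of RCA0 with all its
   elements and sets named.  Let [c n s y] be a computable function whose limit, first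
   in the length [s] of the initial segment [y] of a set [X] and then in [n], exists for
   every [X]; call it d(X).  Embed Cantor space in [0,1] by base-4 expansions.  There is
   a Baire class 2 gauge which off the Cantor set is the distance to it, and
   at the point of [X] is about 4^-d(X) / 64.  A fine cover gives finitely many sets
   X_i such that every set Y agrees with some X_i up to d(X_i) ([master]).

   Taking for d(X) the least place where X fails to be the range of a given function
   yields arithmetical comprehension.  Next, let T be an operator on sets such that T(X)(q)
   depends only on X below q in a well-order, through clauses "if a then b"; take for d(X)
   the order-least q where X(q) and T(X)(q) differ.  Were there no fixed point of T, among the X_i
   of a cover one would fail last in the order, and correcting it at that place would give a
   set that agrees with no X_i up to d(X_i).  So T has a fixed point ([kernel]).  For
   transfinite recursion along X, apply this to the operator that evaluates all
   subformulas of theta at all stages j of X, ordered by (j, subformula). *)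

(** * Substitution and derivability *)

(** The two applications of the covering argument come in a forced order: that every set has an
    order-least failure presupposes arithmetical comprehension, because equality of [X(q)] and
    [T(X)(q)] quantifies over all clauses of [q]. For the fixed point the limits are genuinely
    nested: the limit in the length [s] settles which of the places [q < n] fail, and the limit in
    [n] then reaches the order-least one. This is where Baire class 2 enters.

    The cover yields agreement in the order of numbers, whereas the recursion runs along another
    order. What reconciles them is that numerical agreement is used only at the place of failure
    itself; below it in the well-order both sets obey the recursion and therefore coincide.

    Digits 0 and 1 in base 4 keep different strings apart by a fixed fraction of their scale, so a
    real in the Cantor set determines its string computably. The radii of a cover are finitely many
    and positive, hence bounded below; this bounds all the relevant [d(X_i)] at once, which the step
    to comprehension relies on. *)

Arguments prv_ax {T G p}.
Arguments prv_hyp {T G p}.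
Arguments prv_impI {T G p q}.
Arguments prv_impE {T G p q}.
Arguments prv_raa {T G p}.
Arguments prv_all0I {T G p}.
Arguments prv_all1I {T G p}.
Arguments prv_eqE {T G p s t}.

Lemma tsubst_comp sg sg' t :
  tsubst sg' (tsubst sg t) = tsubst (fun i => tsubst sg' (sg i)) t.
Proof. by elim: t => //= s -> t ->. Qed.

Lemma tsubst_tvar t : tsubst tvar t = t.
Proof. by elim: t => //= s -> t ->. Qed.

Lemma up0_comp sg sg' :
  (fun i => tsubst (up0 sg') (up0 sg i)) = up0 (fun i => tsubst sg' (sg i)).
Proof. by apply: funext => -[//|i]; rewrite /up0 /= /tlift !tsubst_comp. Qed.

Lemma up1_comp (ta ta' : nat -> nat) :
  (fun i => up1 ta' (up1 ta i)) = up1 (fun i => ta' (ta i)).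
Proof. by apply: funext => -[]. Qed.

Lemma fsubst_comp sg sg' ta ta' p :
  fsubst sg' ta' (fsubst sg ta p) =
  fsubst (fun i => tsubst sg' (sg i)) (fun X => ta' (ta X)) p.
Proof.
elim: p sg sg' ta ta' => [s t|s t|t X||p IHp q IHq|p IHp|p IHp] sg sg' ta ta' //=.
- by rewrite !tsubst_comp.
- by rewrite !tsubst_comp.
- by rewrite !tsubst_comp.
- by rewrite IHp IHq.
- by rewrite IHp up0_comp.
- by rewrite IHp up1_comp.
Qed.

Lemma up0_tvar : up0 tvar = tvar.
Proof. by apply: funext => -[]. Qed.

Lemma up1_id : up1 (fun X => X) = fun X => X.
Proof. by apply: funext => -[]. Qed.

Lemma fsubst_id p : fsubst tvar (fun X => X) p = p.
Proof.
elim: p => [s t|s t|t X||p IHp q IHq|p IHp|p IHp] //=; rewrite ?tsubst_tvar //.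
- by rewrite IHp IHq.
- by rewrite up0_tvar IHp.
- by rewrite up1_id IHp.
Qed.

Lemma finst0_subst sg ta t p :
  fsubst sg ta (finst0 t p) = finst0 (tsubst sg t) (fsubst (up0 sg) ta p).
Proof.
rewrite /finst0 !fsubst_comp; congr fsubst.
by apply: funext => -[//|i] /=; rewrite /tlift tsubst_comp /= tsubst_tvar.
Qed.

Lemma finst1_subst sg ta X p :
  fsubst sg ta (finst1 X p) = finst1 (ta X) (fsubst sg (up1 ta) p).
Proof.
rewrite /finst1 !fsubst_comp; congr fsubst.
- by apply: funext => i /=; rewrite tsubst_tvar.
- by apply: funext => -[].
Qed.

Lemma flift0_subst sg ta p :
  fsubst (up0 sg) ta (flift0 p) = flift0 (fsubst sg ta p).
Proof. by rewrite /flift0 !fsubst_comp. Qed.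

Lemma flift1_subst sg ta p :
  fsubst sg (up1 ta) (flift1 p) = flift1 (fsubst sg ta p).
Proof.
rewrite /flift1 !fsubst_comp; congr fsubst.
by apply: funext => i /=; rewrite tsubst_tvar.
Qed.

(** * Bounds on free variables, and weakening *)

Fixpoint tb (t : term) : nat :=
  match t with
  | tvar i => i.+1
  | tzero | tone => 0
  | tadd s t | tmul s t => maxn (tb s) (tb t)
  end.

Fixpoint fb0 (p : form) : nat :=
  match p with
  | feq s t | flt s t => maxn (tb s) (tb t)
  | fmem t _ => tb t
  | fbot => 0
  | fimp p q => maxn (fb0 p) (fb0 q)
  | fall0 p => (fb0 p).-1
  | fall1 p => fb0 p
  end.

Fixpoint fb1 (p : form) : nat :=
  match p with
  | feq _ _ | flt _ _ | fbot => 0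
  | fmem _ X => X.+1
  | fimp p q => maxn (fb1 p) (fb1 q)
  | fall0 p => fb1 p
  | fall1 p => (fb1 p).-1
  end.

Lemma tsubst_agree t sg sg' :
  (forall i, i < tb t -> sg i = sg' i) -> tsubst sg t = tsubst sg' t.
Proof.
elim: t => [i|||s IHs t IHt|s IHs t IHt] //= H; first exact: H.
- by rewrite IHs ?IHt // => i Hi; apply: H; lia.
- by rewrite IHs ?IHt // => i Hi; apply: H; lia.
Qed.

Lemma fsubst_agree p sg sg' ta ta' :
  (forall i, i < fb0 p -> sg i = sg' i) -> (forall X, X < fb1 p -> ta X = ta' X) ->
  fsubst sg ta p = fsubst sg' ta' p.
Proof.
elim: p sg sg' ta ta' => [s t|s t|t X||p IHp q IHq|p IHp|p IHp] sg sg' ta ta' //= H0 H1.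
- by rewrite !(@tsubst_agree _ sg sg') // => i Hi; apply: H0; lia.
- by rewrite !(@tsubst_agree _ sg sg') // => i Hi; apply: H0; lia.
- by rewrite (@tsubst_agree _ sg sg') ?H1.
- by rewrite (IHp sg sg' ta ta') ?(IHq sg sg' ta ta') // => i Hi;
    (apply: H0 || apply: H1); lia.
- rewrite (IHp (up0 sg) (up0 sg') ta ta') // => -[//|i] Hi.
  by rewrite /up0 /= H0 //; lia.
- rewrite (IHp sg sg' (up1 ta) (up1 ta')) // => -[//|i] Hi.
  by rewrite /up1 /= H1 //; lia.
Qed.

Lemma prv_weak T G p :
  prv T G p -> forall G', (forall q, List.In q G -> List.In q G') -> prv T G' p.
Proof.
elim=> {G p}.
- by move=> *; apply: prv_ax.
- by move=> G p H G' HG; apply: prv_hyp; exact: HG.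
- move=> G p q _ IH G' HG; apply: prv_impI; apply: IH => r /= [->|/HG]; tauto.
- by move=> G p q _ IH1 _ IH2 G' HG; apply: prv_impE (IH1 _ HG) (IH2 _ HG).
- move=> G p _ IH G' HG; apply: prv_raa; apply: IH => r /= [->|/HG]; tauto.
- move=> G p _ IH G' HG; apply: prv_all0I; apply: IH => r /List.in_map_iff [s [<- /HG Hs]].
  exact: List.in_map.
- by move=> G p t _ IH G' HG; apply: prv_all0E; exact: IH.
- move=> G p _ IH G' HG; apply: prv_all1I; apply: IH => r /List.in_map_iff [s [<- /HG Hs]].
  exact: List.in_map.
- by move=> G p t _ IH G' HG; apply: prv_all1E; exact: IH.
- by move=> *; apply: prv_refl.
- by move=> G p s t _ IH1 _ IH2 G' HG; apply: prv_eqE (IH1 _ HG) (IH2 _ HG).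
Qed.

Lemma map_ext_eq (A B : Type) (f g : A -> B) l : f =1 g -> List.map f l = List.map g l.
Proof. by move=> fg; apply: List.map_ext. Qed.

(** * Structures for second-order arithmetic *)

Record structure : Type := Structure {
  dom :> Type;
  dzero : dom;
  done_ : dom;
  dadd : dom -> dom -> dom;
  dmul : dom -> dom -> dom;
  dlt : dom -> dom -> Prop;
  dset : (dom -> Prop) -> Prop }.
Arguments dset : clear implicits.

Fixpoint eval (M : structure) (rho : nat -> M) (t : term) : M :=
  match t with
  | tvar i => rho i
  | tzero => dzero M
  | tone => done_ M
  | tadd s t => dadd (eval rho s) (eval rho t)
  | tmul s t => dmul (eval rho s) (eval rho t)
  end.
Arguments eval : clear implicits.

Fixpoint sat (M : structure) (rho : nat -> M) (tau : nat -> M -> Prop) (p : form) : Prop :=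
  match p with
  | feq s t => eval M rho s = eval M rho t
  | flt s t => dlt (eval M rho s) (eval M rho t)
  | fmem t X => tau X (eval M rho t)
  | fbot => False
  | fimp p q => sat rho tau p -> sat rho tau q
  | fall0 p => forall a, sat (scons a rho) tau p
  | fall1 p => forall A, dset M A -> sat rho (scons A tau) p
  end.
Arguments sat : clear implicits.

Section Completeness.

Variable T : form -> Prop.
Hypothesis T_subst : forall p sg ta, T p -> T (fsubst sg ta p).

Lemma prv_subst G p : prv T G p -> forall sg ta,
  prv T (List.map (fsubst sg ta) G) (fsubst sg ta p).
Proof.
elim=> {G p}.
- by move=> G p H sg ta; apply: prv_ax; exact: T_subst.
- by move=> G p H sg ta; apply: prv_hyp; exact: List.in_map.
- by move=> G p q _ IH sg ta; apply: prv_impI; exact: IH.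
- by move=> G p q _ IH1 _ IH2 sg ta; apply: prv_impE (IH1 sg ta) (IH2 sg ta).
- by move=> G p _ IH sg ta; apply: prv_raa; exact: IH.
- move=> G p _ IH sg ta; apply: prv_all0I.
  have := IH (up0 sg) ta; rewrite !List.map_map.
  by rewrite (map_ext_eq _ (fun q => flift0_subst sg ta q)).
- by move=> G p t _ IH sg ta; rewrite finst0_subst; apply: prv_all0E; exact: IH.
- move=> G p _ IH sg ta; apply: prv_all1I.
  have := IH sg (up1 ta); rewrite !List.map_map.
  by rewrite (map_ext_eq _ (fun q => flift1_subst sg ta q)).
- by move=> G p t _ IH sg ta; rewrite finst1_subst; apply: prv_all1E; exact: IH.
- by move=> *; apply: prv_refl.
- move=> G p s t _ IH1 _ IH2 sg ta; rewrite finst0_subst.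
  by apply: prv_eqE (IH1 sg ta) _; rewrite -finst0_subst.
Qed.

(** Renaming [b] to 0 and shifting every other variable turns the derivation of the instance into
    one over the lifted context, because [b] is free neither in [G] nor in [fall0 p]. *)
Lemma prv_fresh0 G p b : (forall q, List.In q G -> fb0 q <= b) -> fb0 p <= b.+1 ->
  prv T G (finst0 (tvar b) p) -> prv T G (fall0 p).
Proof.
move=> HG Hp /prv_subst.
move=> /(_ (fun i => if i == b then tvar 0 else tvar i.+1) (fun X => X)) H.
apply: prv_all0I; move: H.
rewrite (List.map_ext_in _ flift0); last first.
  move=> q /HG Hq; apply: fsubst_agree => // i Hi.
  by rewrite (_ : (i == b) = false) //; lia.
rewrite /finst0 fsubst_comp (_ : fsubst _ _ p = p) //.
rewrite -[RHS]fsubst_id; apply: fsubst_agree => // -[|i] Hi /=; first by rewrite eqxx.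
by rewrite (_ : (i == b) = false) //; lia.
Qed.

Lemma prv_fresh1 G p b : (forall q, List.In q G -> fb1 q <= b) -> fb1 p <= b.+1 ->
  prv T G (finst1 b p) -> prv T G (fall1 p).
Proof.
move=> HG Hp /prv_subst.
move=> /(_ tvar (fun X => if X == b then 0 else X.+1)) H.
apply: prv_all1I; move: H.
rewrite (List.map_ext_in _ flift1); last first.
  move=> q /HG Hq; apply: fsubst_agree => // i Hi.
  by rewrite (_ : (i == b) = false) //; lia.
rewrite /finst1 fsubst_comp (_ : fsubst _ _ p = p) //.
rewrite -[RHS]fsubst_id; apply: fsubst_agree => // -[|i] Hi /=; first by rewrite eqxx.
by rewrite (_ : (i == b) = false) //; lia.
Qed.

Lemma prv_efq G p : prv T G fbot -> prv T G p.
Proof. by move=> H; apply: prv_raa; apply: (prv_weak H) => q; right. Qed.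

(** * The Henkin model *)

Fixpoint tenc (t : term) : nat :=
  match t with
  | tvar i => pickle (0, i)
  | tzero => pickle (1, 0)
  | tone => pickle (2, 0)
  | tadd s t => pickle (3, pickle (tenc s, tenc t))
  | tmul s t => pickle (4, pickle (tenc s, tenc t))
  end.

Fixpoint fenc (p : form) : nat :=
  match p with
  | feq s t => pickle (0, pickle (tenc s, tenc t))
  | flt s t => pickle (1, pickle (tenc s, tenc t))
  | fmem t X => pickle (2, pickle (tenc t, X))
  | fbot => pickle (3, 0)
  | fimp p q => pickle (4, pickle (fenc p, fenc q))
  | fall0 p => pickle (5, fenc p)
  | fall1 p => pickle (6, fenc p)
  end.

Lemma pickle_nn_inj : injective (pickle : (nat * nat)%type -> nat).
Proof. exact: pcan_inj pickleK. Qed.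

Lemma tenc_inj : injective tenc.
Proof.
elim=> [i|||s IHs t IHt|s IHs t IHt] [j|||s' t'|s' t'] /pickle_nn_inj; try by []; case.
- by move=> ->.
- by move=> /pickle_nn_inj [] /IHs -> /IHt ->.
- by move=> /pickle_nn_inj [] /IHs -> /IHt ->.
Qed.

Lemma fenc_inj : injective fenc.
Proof.
elim=> [s t|s t|t X||p IHp q IHq|p IHp|p IHp]
  [s' t'|s' t'|t' X'||p' q'|p'|p'] /pickle_nn_inj; try by []; case.
- by move=> /pickle_nn_inj [] /tenc_inj -> /tenc_inj ->.
- by move=> /pickle_nn_inj [] /tenc_inj -> /tenc_inj ->.
- by move=> /pickle_nn_inj [] /tenc_inj -> ->.
- by move=> /pickle_nn_inj [] /IHp -> /IHq ->.
- by move=> /IHp ->.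
- by move=> /IHp ->.
Qed.

Definition fdec (n : nat) : form :=
  match pselect (exists p, fenc p = n) with
  | left H => projT1 (cid H)
  | right _ => fbot
  end.

Lemma fencK p : fdec (fenc p) = p.
Proof.
rewrite /fdec; case: pselect => [H|[]]; last by exists p.
by apply: fenc_inj; case: (cid H).
Qed.

(** A rejected universal formula comes with a counterexample at a variable beyond all those of the
    finite stage. Fresh variables never run out, so the language needs no Henkin constants. *)
Definition witness (G : list form) (p : form) : list form :=
  match p with
  | fall0 q => fneg (finst0 (tvar (foldr maxn (fb0 q) (List.map fb0 G))) q) :: fneg p :: G
  | fall1 q => fneg (finst1 (foldr maxn (fb1 q) (List.map fb1 G)) q) :: fneg p :: G
  | _ => fneg p :: G
  end.

Definition henkin_step (G : list form) (p : form) : list form :=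
  if pselect (prv T (p :: G) fbot) then witness G p else p :: G.

Lemma foldr_maxn_ge b (f : form -> nat) G :
  b <= foldr maxn b (List.map f G) /\
  forall q, List.In q G -> f q <= foldr maxn b (List.map f G).
Proof.
elim: G => [|p G [IH1 IH2]] /=; first by split.
by split; [lia | move=> q [->|/IH2]; lia].
Qed.

(** If [p] is refutable then [fneg p] may be added. The counterexample stays consistent too:
    refuting it would prove the instance at a fresh variable, hence the universal formula just
    denied. *)
Lemma henkin_step_consistent G p : ~ prv T G fbot -> ~ prv T (henkin_step G p) fbot.
Proof.
rewrite /henkin_step; case: pselect => // Hp HG.
have Hn : ~ prv T (fneg p :: G) fbot.
  by move=> H; apply: HG; apply: prv_impE (prv_impI Hp) (prv_raa H).
case: p Hp Hn => [s t|s t|t X||p q|p|p] Hp Hn //= H.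
- case: (foldr_maxn_ge (fb0 p) fb0 G) => H1 H2.
  apply: Hn; apply: prv_impE (prv_hyp _) _; first by left.
  apply: prv_fresh0 (prv_raa H) => [q [<-|/H2 //]|] /=; lia.
- case: (foldr_maxn_ge (fb1 p) fb1 G) => H1 H2.
  apply: Hn; apply: prv_impE (prv_hyp _) _; first by left.
  apply: prv_fresh1 (prv_raa H) => [q [<-|/H2 //]|] /=; lia.
Qed.

Lemma henkin_step_incl G p q : List.In q G -> List.In q (henkin_step G p).
Proof.
rewrite /henkin_step; case: pselect => /= [_ H|_ H]; last by right.
by case: p; intros; simpl; tauto.
Qed.

Section Henkin.

Variable phi : form.
Hypothesis unprovable : ~ prv T nil phi.

Fixpoint stage (n : nat) : list form :=
  if n is m.+1 then henkin_step (stage m) (fdec m) else [:: fneg phi].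

Lemma stage_consistent n : ~ prv T (stage n) fbot.
Proof.
elim: n => [|n IH] /=; last exact: henkin_step_consistent.
by move=> /prv_raa.
Qed.

Lemma stage_mono m n p : m <= n -> List.In p (stage m) -> List.In p (stage n).
Proof.
elim: n => [|n IH]; first by case: m.
rewrite leq_eqVlt => /orP [/eqP -> //|Hm] H.
by apply: henkin_step_incl; exact: IH.
Qed.

Definition Delta (p : form) : Prop := exists n, List.In p (stage n).

Lemma Delta_list G : (forall q, List.In q G -> Delta q) ->
  exists n, forall q, List.In q G -> List.In q (stage n).
Proof.
elim: G => [|p G IH] H; first by exists 0.
have [m Hm] := IH (fun q Hq => H q (or_intror Hq)).
have [n Hn] := H p (or_introl erefl).
exists (maxn m n) => q [<-|/Hm Hq].
- by apply: stage_mono Hn; lia.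
- by apply: stage_mono Hq; lia.
Qed.

Lemma Delta_consistent G : (forall q, List.In q G -> Delta q) -> ~ prv T G fbot.
Proof.
by move=> /Delta_list [n Hn] H; apply: (@stage_consistent n); apply: (prv_weak H).
Qed.

Lemma Delta_step p :
  Delta p \/ exists n, prv T (p :: stage n) fbot /\
    forall q, List.In q (witness (stage n) p) -> Delta q.
Proof.
have : stage (fenc p).+1 = henkin_step (stage (fenc p)) p by rewrite /= fencK.
rewrite /henkin_step; case: pselect => H E.
- by right; exists (fenc p); split=> // q Hq; exists (fenc p).+1; rewrite E.
- by left; exists (fenc p).+1; rewrite E; left.
Qed.

Lemma Delta_complete p : Delta p \/ Delta (fneg p).
Proof.
case: (Delta_step p) => [|[n [_ H]]]; first by left.
by right; apply: H; case: p; intros; simpl; tauto.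
Qed.

Lemma Delta_closed G p : (forall q, List.In q G -> Delta q) -> prv T G p -> Delta p.
Proof.
move=> HG Hp; case: (Delta_complete p) => // Hn.
case: (@Delta_consistent (fneg p :: G)); first by move=> q [<-|/HG].
apply: prv_impE (prv_hyp _) _; first by left.
by apply: (prv_weak Hp) => q; right.
Qed.

Lemma Delta_imp p q : Delta (fimp p q) <-> (Delta p -> Delta q).
Proof.
split=> [Hpq Hp|H].
- apply: (@Delta_closed [:: fimp p q; p]) => [r [<-|[<-|]]//|].
  by apply: prv_impE; apply: prv_hyp; [left|right; left].
- case: (Delta_complete p) => Hp.
  + apply: (@Delta_closed [:: q]) => [r [<-|[]]|]; first exact: H.
    by apply: prv_impI; apply: prv_hyp; right; left.
  + apply: (@Delta_closed [:: fneg p]) => [r [<-|[]]//|].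
    apply: prv_impI; apply: prv_efq; apply: prv_impE; apply: prv_hyp; last by left.
    by right; left.
Qed.

Lemma Delta_bot : ~ Delta fbot.
Proof.
move=> H; apply: (@Delta_consistent [:: fbot]) => [r [<-|[]]//|].
by apply: prv_hyp; left.
Qed.

Lemma Delta_neg p : Delta (fneg p) <-> ~ Delta p.
Proof. by rewrite Delta_imp; split=> H /H // /Delta_bot. Qed.

Lemma Delta_all0 p : Delta (fall0 p) <-> forall t, Delta (finst0 t p).
Proof.
split=> [H t|H].
- apply: (@Delta_closed [:: fall0 p]) => [r [<-|[]]//|].
  by apply: prv_all0E; apply: prv_hyp; left.
- case: (Delta_step (fall0 p)) => // -[n [_ /= /(_ _ (or_introl erefl))]].
  by move=> /Delta_neg [].
Qed.

Lemma Delta_all1 p : Delta (fall1 p) <-> forall X, Delta (finst1 X p).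
Proof.
split=> [H t|H].
- apply: (@Delta_closed [:: fall1 p]) => [r [<-|[]]//|].
  by apply: prv_all1E; apply: prv_hyp; left.
- case: (Delta_step (fall1 p)) => // -[n [_ /= /(_ _ (or_introl erefl))]].
  by move=> /Delta_neg [].
Qed.

Lemma Delta_refl t : Delta (feq t t).
Proof. by apply: (@Delta_closed nil) => //; exact: prv_refl. Qed.

Lemma Delta_eqE p s t : Delta (feq s t) -> Delta (finst0 s p) -> Delta (finst0 t p).
Proof.
move=> H1 H2; apply: (@Delta_closed [:: feq s t; finst0 s p]) => [r [<-|[<-|[]]]//|].
by apply: (@prv_eqE _ _ p s t); apply: prv_hyp; [left|right; left].
Qed.

Lemma tlift_inst s t : tsubst (scons s tvar) (tlift t) = t.
Proof. by rewrite /tlift tsubst_comp /= tsubst_tvar. Qed.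

Lemma Delta_sym s t : Delta (feq s t) -> Delta (feq t s).
Proof.
move=> H; have := @Delta_eqE (feq (tvar 0) (tlift s)) s t H.
by rewrite /finst0 /= !tlift_inst; apply; exact: Delta_refl.
Qed.

Lemma Delta_trans s t u : Delta (feq s t) -> Delta (feq t u) -> Delta (feq s u).
Proof.
move=> H1 H2; have := @Delta_eqE (feq (tlift s) (tvar 0)) t u H2.
by rewrite /finst0 /= !tlift_inst; apply.
Qed.

Lemma Delta_cong2 (f : term -> term -> term) :
  (forall sg s t, tsubst sg (f s t) = f (tsubst sg s) (tsubst sg t)) ->
  forall s s' t t', Delta (feq s s') -> Delta (feq t t') -> Delta (feq (f s t) (f s' t')).
Proof.
move=> Hf s s' t t' Hs Ht; apply: (@Delta_trans _ (f s' t)).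
- have := @Delta_eqE (feq (tlift (f s t)) (f (tvar 0) (tlift t))) s s' Hs.
  by rewrite /finst0 /= !Hf /= !tlift_inst; apply; exact: Delta_refl.
- have := @Delta_eqE (feq (tlift (f s' t)) (f (tlift s') (tvar 0))) t t' Ht.
  by rewrite /finst0 /= !Hf /= !tlift_inst; apply; exact: Delta_refl.
Qed.

Definition pick_term (P : term -> Prop) : term :=
  match pselect (exists s, P s) with
  | left H => projT1 (cid H)
  | right _ => tzero
  end.

(** The choice depends only on the predicate, so by extensionality provably equal terms get the same
    representative, and the domain needs no quotient. *)
Definition canon (t : term) : term := pick_term (fun s => Delta (feq s t)).

Lemma canonP t : Delta (feq (canon t) t).
Proof.
rewrite /canon /pick_term; case: pselect => [H|[]]; last by exists t; exact: Delta_refl.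
by case: (cid H).
Qed.

Lemma canon_eq s t : Delta (feq s t) <-> canon s = canon t.
Proof.
split=> [H|E].
- rewrite /canon; congr pick_term; apply: funext => r; apply: propext; split=> Hr.
  + exact: Delta_trans Hr H.
  + exact: Delta_trans Hr (Delta_sym H).
- apply: (Delta_trans (Delta_sym (canonP s))); rewrite E; exact: canonP.
Qed.

Lemma canonK t : canon (canon t) = canon t.
Proof. by apply/canon_eq; exact: canonP. Qed.

Definition hdom := {t | canon t = t}.
Definition hcls (t : term) : hdom := exist _ (canon t) (canonK t).
Definition hrep (x : hdom) : term := sval x.

Lemma hcls_eq s t : hcls s = hcls t <-> Delta (feq s t).
Proof.
rewrite canon_eq; split=> [[] //|E]; exact: eq_exist.
Qed.

Lemma hrepK x : hcls (hrep x) = x.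
Proof. by case: x => t Ht; exact: eq_exist. Qed.

Lemma hclsK t : Delta (feq (hrep (hcls t)) t).
Proof. exact: canonP. Qed.

Definition hset (X : nat) (x : hdom) : Prop := Delta (fmem (hrep x) X).

Definition hmodel : structure := Structure
  (hcls tzero) (hcls tone)
  (fun x y => hcls (tadd (hrep x) (hrep y)))
  (fun x y => hcls (tmul (hrep x) (hrep y)))
  (fun x y => Delta (flt (hrep x) (hrep y)))
  (fun A => exists X, A = hset X).

Lemma heval (rho : nat -> hdom) t :
  eval hmodel rho t = hcls (tsubst (fun i => hrep (rho i)) t).
Proof.
elim: t => [i|||s IHs t IHt|s IHs t IHt] //=; first by rewrite hrepK.
- by rewrite IHs IHt; apply/hcls_eq; apply: Delta_cong2 => //; exact: hclsK.
- by rewrite IHs IHt; apply/hcls_eq; apply: Delta_cong2 => //; exact: hclsK.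
Qed.

Lemma Delta_lt s s' t t' : Delta (feq s s') -> Delta (feq t t') ->
  Delta (flt s t) -> Delta (flt s' t').
Proof.
move=> Hs Ht H.
have := @Delta_eqE (flt (tvar 0) (tlift t)) s s' Hs.
rewrite /finst0 /= !tlift_inst => /(_ H) H'.
have := @Delta_eqE (flt (tlift s') (tvar 0)) t t' Ht.
by rewrite /finst0 /= !tlift_inst; apply.
Qed.

Lemma Delta_mem s s' X : Delta (feq s s') -> Delta (fmem s X) -> Delta (fmem s' X).
Proof. by move=> /(@Delta_eqE (fmem (tvar 0) X)). Qed.

Lemma hsat p (rho : nat -> hdom) (ta : nat -> nat) :
  sat hmodel rho (fun X => hset (ta X)) p <-> Delta (fsubst (fun i => hrep (rho i)) ta p).
Proof.
elim: p rho ta => [s t|s t|t X||p IHp q IHq|p IHp|p IHp] rho ta /=.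
- by rewrite !heval hcls_eq.
- rewrite !heval; split; apply: Delta_lt; try exact: hclsK;
    by apply: Delta_sym; exact: hclsK.
- rewrite heval /hset; split; apply: Delta_mem; first exact: hclsK.
  by apply: Delta_sym; exact: hclsK.
- by split=> // /Delta_bot.
- by rewrite IHp IHq Delta_imp.
- have E t : finst0 t (fsubst (up0 (fun i => hrep (rho i))) ta p) =
      fsubst (scons t (fun i => hrep (rho i))) ta p.
    rewrite /finst0 fsubst_comp; congr fsubst.
    by apply: funext => -[//|i] /=; rewrite tlift_inst.
  have E' x : (fun i => hrep (scons x rho i)) = scons (hrep x) (fun i => hrep (rho i)).
    by apply: funext => -[].
  rewrite Delta_all0; split=> H.
  + move=> t; apply: (Delta_eqE (hclsK t)); rewrite E -E'.
    by apply/IHp; exact: H.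
  + by move=> x; apply/IHp; rewrite E' -E.
- have E X : finst1 X (fsubst (fun i => hrep (rho i)) (up1 ta) p) =
      fsubst (fun i => hrep (rho i)) (scons X ta) p.
    rewrite /finst1 fsubst_comp; congr fsubst.
      by apply: funext => i; rewrite tsubst_tvar.
    by apply: funext => -[].
  have E' X : scons (hset X) (fun Y => hset (ta Y)) = fun Y => hset (scons X ta Y).
    by apply: funext => -[].
  rewrite Delta_all1; split=> H.
  + by move=> X; rewrite E; apply/IHp; rewrite -E'; apply: H; exists X.
  + by move=> A [X ->]; rewrite E'; apply/IHp; rewrite -E.
Qed.

Lemma hsat_axioms p rho tau : T p -> (forall X, dset hmodel (tau X)) -> sat hmodel rho tau p.
Proof.
move=> Hp /choice [ta Hta].
rewrite (_ : tau = fun X => hset (ta X)); last by apply: funext.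
apply/hsat; apply: (@Delta_closed nil) => //; apply: prv_ax; exact: T_subst.
Qed.

(** The assignment sends variable [i] to the representative of its class, a term provably equal to
    [tvar i] but perhaps different from it. The representatives are therefore exchanged for the
    variables one at a time. *)
Lemma hsat_phi : ~ sat hmodel (fun i => hcls (tvar i)) hset phi.
Proof.
have Hn : Delta (fneg phi) by exists 0; left.
rewrite (hsat phi _ id) => H.
suff : forall p b, fb0 p <= b -> forall sg, (forall i, Delta (feq (sg i) (tvar i))) ->
    Delta (fsubst sg id p) -> Delta p.
  move=> /(_ phi _ (leqnn _) _ (fun i => hclsK (tvar i)) H).
  by move/Delta_neg: Hn.
move=> {H Hn} p b Hb sg Hsg.
suff H k : k <= b -> Delta (fsubst (fun i => if i < k then tvar i else sg i) id p) <->
    Delta (fsubst sg id p).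
  move=> /(H b (leqnn b)); rewrite (@fsubst_agree _ _ tvar _ (fun X => X)) ?fsubst_id // => i Hi.
  by rewrite (leq_trans Hi Hb).
elim: k => [_|k IH Hk]; first by rewrite (_ : (fun i => _) = sg).
rewrite -IH; last exact: ltnW.
(* [p] with a hole at variable [k]: the variables below [k] are already restored, those above still
   carry their substitutes. *)
pose f r := fsubst (scons r tvar) id (fsubst
  (fun i => if i < k then tvar i.+1 else if i == k then tvar 0 else tlift (sg i)) id p).
have Ef r : f r = fsubst (fun i => if i < k then tvar i else if i == k then r else sg i) id p.
  rewrite /f fsubst_comp; congr fsubst; apply: funext => i.
  by case: ifP => // _; case: ifP => // _; rewrite tlift_inst.
have E1 : f (tvar k) = fsubst (fun i => if i < k.+1 then tvar i else sg i) id p.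
  rewrite Ef; congr fsubst; apply: funext => i.
  by rewrite ltnS; case: (ltngtP i k) => // H; rewrite ?H.
have E2 : f (sg k) = fsubst (fun i => if i < k then tvar i else sg i) id p.
  rewrite Ef; congr fsubst; apply: funext => i.
  by case: (ltngtP i k) => // H; rewrite ?H.
rewrite -E1 -E2; split; apply: Delta_eqE; last exact: Hsg.
by apply: Delta_sym.
Qed.

End Henkin.

(** In the countermodel each element is named by a term and each set by a variable. This is handed
    on as extra hypotheses, since it lets all parameters be read off one fixed assignment later. *)
Theorem completeness phi :
  (forall M : structure,
     (forall p rho tau, T p -> (forall X, dset M (tau X)) -> sat M rho tau p) ->
     forall rho0 tau0, (forall X, dset M (tau0 X)) ->
       (forall A, dset M A -> exists X, A = tau0 X) ->
       (forall a, exists t, a = eval M rho0 t) -> sat M rho0 tau0 phi) ->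
  prv T nil phi.
Proof.
move=> H; apply: contrapT => Hn; apply: (@hsat_phi _ Hn).
apply: (H (hmodel Hn)).
- by move=> p rho tau; exact: hsat_axioms.
- by move=> X; exists X.
- by move=> A [X ->]; exists X.
- move=> a; exists (hrep a); rewrite (heval Hn) -[LHS]hrepK.
  apply/(hcls_eq Hn).
  suff : forall t, Delta phi (feq t (tsubst (fun i => hrep (hcls Hn (tvar i))) t)) by [].
  elim=> [i|||s IHs t IHt|s IHs t IHt] /=; try exact: Delta_refl.
  + by apply: Delta_sym => //; exact: hclsK.
  + exact: (Delta_cong2 Hn (f := tadd)).
  + exact: (Delta_cong2 Hn (f := tmul)).
Qed.

End Completeness.

(** * Closure of the axioms of [RCA0] under substitution *)

Lemma Delta00_subst p : Delta00 p -> forall sg ta, Delta00 (fsubst sg ta p).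
Proof.
elim=> {p} [s t|s t|t X||p q _ IHp _ IHq|t p _ IH] sg ta /=; try by constructor.
rewrite (_ : tsubst (up0 sg) (tlift t) = tlift (tsubst sg t)).
  exact: D_ball.
by rewrite /tlift !tsubst_comp.
Qed.

Lemma Sigma01_subst p sg ta : Sigma01 p -> Sigma01 (fsubst sg ta p).
Proof. by case=> q Hq; apply: Sigma01_intro; exact: Delta00_subst. Qed.

Lemma Pi01_subst p sg ta : Pi01 p -> Pi01 (fsubst sg ta p).
Proof. by case=> q Hq; apply: Pi01_intro; exact: Delta00_subst. Qed.

(* A closed axiom instance at binder depth [d], [e] only sees its parameters
   through [tvar (i + d)] and [X + e]. *)
Definition subst_at d (sg : nat -> term) : nat -> term := iter d up0 sg.
Definition rename_at e (ta : nat -> nat) : nat -> nat := iter e up1 ta.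

Lemma subst_at_ge d sg i :
  subst_at d sg (i + d) = tsubst (fun j => tvar (j + d)) (sg i).
Proof.
elim: d => [|d IH]; rewrite ?addn0 ?addnS /=.
  by rewrite (_ : (fun j => tvar (j + 0)) = tvar) ?tsubst_tvar //; apply: funext => j; rewrite addn0.
rewrite /up0 /= IH /tlift tsubst_comp; congr tsubst; apply: funext => j /=.
by rewrite addnS.
Qed.

Lemma rename_at_ge e ta X : rename_at e ta (X + e) = ta X + e.
Proof. by elim: e => [|e IH]; rewrite ?addn0 ?addnS //= /up1 /= IH. Qed.

Lemma schema0_subst p n d e sg ta t :
  tsubst (subst_at d sg) (n d) = t ->
  fsubst (subst_at d sg) (rename_at e ta) (schema0 p n d e) =
  schema0 (fsubst (up0 sg) ta p) (fun _ => t) d e.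
Proof.
move=> Ht; rewrite /schema0 !fsubst_comp; congr fsubst.
- apply: funext => -[|i] /=; first exact: Ht.
  rewrite subst_at_ge /tlift tsubst_comp; congr tsubst; exact: funext.
- by apply: funext => X; rewrite rename_at_ge.
Qed.

Lemma RCA0_subst p sg ta : RCA0 p -> RCA0 (fsubst sg ta p).
Proof.
case=> {p}.
- by move=> p [] /=; apply: RCA0_basic; constructor.
- move=> p Hp.
  have H := @RCA0_induction _ (Sigma01_subst (up0 sg) ta Hp).
  move: H; congr RCA0.
  rewrite /close /induction /imp /and_ /all0 /fand /fneg /=.
  have E0 := @schema0_subst p zero 0 0 sg ta tzero erefl.
  have E1 := @schema0_subst p (bound0 0) 1 0 sg ta (tvar 0) erefl.
  have E2 := @schema0_subst p (bound0 0 + one)%tm 1 0 sg ta (tadd (tvar 0) tone) erefl.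
  by rewrite /= in E0 E1 E2; rewrite E0 E1 E2.
- move=> p q Hp Hq.
  have H := @RCA0_comprehension _ _ (Sigma01_subst (up0 sg) ta Hp) (Pi01_subst (up0 sg) ta Hq).
  move: H; congr RCA0.
  rewrite /close /comprehension /imp /iff_ /all0 /ex1 /fiff /fex1 /fand /fneg /=.
  have E1 := @schema0_subst p (bound0 0) 1 0 sg ta (tvar 0) erefl.
  have E2 := @schema0_subst q (bound0 0) 1 0 sg ta (tvar 0) erefl.
  have E3 := @schema0_subst p (bound0 0) 1 1 sg ta (tvar 0) erefl.
  by rewrite /= in E1 E2 E3; rewrite E1 E2 E3.
Qed.

(** * Satisfaction under substitution and for the derived connectives *)

Section Satisfaction.
Variable M : structure.
Implicit Types (rho : nat -> M) (tau : nat -> M -> Prop).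

Lemma eval_subst rho sg t :
  eval M rho (tsubst sg t) = eval M (fun i => eval M rho (sg i)) t.
Proof. by elim: t => //= s -> t ->. Qed.

Lemma eval_tlift a rho t : eval M (scons a rho) (tlift t) = eval M rho t.
Proof. by rewrite /tlift eval_subst. Qed.

Lemma sat_subst p rho tau sg ta :
  sat M rho tau (fsubst sg ta p) <->
  sat M (fun i => eval M rho (sg i)) (fun X => tau (ta X)) p.
Proof.
elim: p rho tau sg ta => [s t|s t|t X||p IHp q IHq|p IHp|p IHp] rho tau sg ta /=;
  rewrite ?eval_subst //.
- by rewrite IHp IHq.
- split=> H a; have := H a; rewrite IHp.
    by congr sat; apply: funext => -[//|i] /=; rewrite eval_tlift.
  by congr sat; apply: funext => -[//|i] /=; rewrite eval_tlift.
- split=> H A HA; have := H A HA; rewrite IHp.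
    by congr sat; apply: funext => -[].
  by congr sat; apply: funext => -[].
Qed.

Lemma sat_schema0 p n d e rho tau :
  sat M rho tau (schema0 p n d e) <->
  sat M (scons (eval M rho (n d)) (fun i => rho (i + d))) (fun X => tau (X + e)) p.
Proof.
rewrite /schema0 sat_subst (_ : (fun i => eval M rho _) =
  scons (eval M rho (n d)) (fun i => rho (i + d))) //.
by apply: funext => -[].
Qed.

Lemma sat_schema01 p n Z d e rho tau :
  sat M rho tau (schema01 p n Z d e) <->
  sat M (scons (eval M rho (n d)) (fun i => rho (i + d)))
        (scons (tau (Z e)) (fun X => tau (X + e))) p.
Proof.
rewrite /schema01 sat_subst (_ : (fun i => eval M rho _) =
  scons (eval M rho (n d)) (fun i => rho (i + d))); last by apply: funext => -[].
by rewrite (_ : (fun X => tau _) = scons (tau (Z e)) (fun X => tau (X + e))) //;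
  apply: funext => -[].
Qed.

Lemma sat_and rho tau p q :
  sat M rho tau (fand p q) <-> sat M rho tau p /\ sat M rho tau q.
Proof. by split=> [/= H|[Hp Hq] /= H]; [split; apply: contrapT; tauto | exact: H]. Qed.

Lemma sat_or rho tau p q :
  sat M rho tau (for_ p q) <-> sat M rho tau p \/ sat M rho tau q.
Proof.
split=> [/= H|/= [Hp|Hq]]; [|by move=> []|by []].
by case: (pselect (sat M rho tau p)); tauto.
Qed.

Lemma sat_iff rho tau p q :
  sat M rho tau (fiff p q) <-> (sat M rho tau p <-> sat M rho tau q).
Proof. by rewrite /fiff sat_and /=; tauto. Qed.

Lemma sat_ex0 rho tau p :
  sat M rho tau (fex0 p) <-> exists a, sat M (scons a rho) tau p.
Proof.
split=> [/= H|[a Ha] /= H]; last exact: (H a).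
by apply: contrapT => Hn; apply: H => a Ha; apply: Hn; exists a.
Qed.

Lemma sat_ex1 rho tau p :
  sat M rho tau (fex1 p) <-> exists A, dset M A /\ sat M rho (scons A tau) p.
Proof.
split=> [/= H|[a [Ha Ha']] /= H]; last exact: (H a).
by apply: contrapT => Hn; apply: H => a Ha Ha'; apply: Hn; exists a.
Qed.

End Satisfaction.

(** * Semantic counterparts of the definitions *)

Record mrat (M : structure) : Type := MRat { mpos : M; mneg : M; mden : M }.

Section Semantics.
Variable M : structure.
Implicit Types (A B C X Y Z F P R : M -> Prop) (i j k l m n u v : M) (a b r s : mrat M).

Local Notation "0" := (dzero M).
Local Notation "1" := (done_ M).
Local Notation "x + y" := (dadd x y).
Local Notation "x * y" := (dmul x y).
Local Notation "x < y" := (dlt x y).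
Local Notation set := (M -> Prop).

Definition pairM i j : M := (i + j) * (i + j) + i.
Definition sliceM C i : set := fun m => C (pairM m i).
Definition isRelM C := forall n, C n -> exists i j, n = pairM i j.
Definition isFunM C :=
  isRelM C /\ (forall i, exists m, C (pairM i m)) /\
  (forall i m m', C (pairM i m) -> C (pairM i m') -> m = m').
Definition betaM c d i u := u < 1 + (i + 1) * d /\ exists q, c = q * (1 + (i + 1) * d) + u.
Definition pow2M k m :=
  exists c d, betaM c d 0 1 /\ betaM c d k m /\
    forall i u v, i < k -> betaM c d i u -> betaM c d (i + 1) v -> v = u + u.

Definition fieldM X i := exists j, X (pairM i j) \/ X (pairM j i).
Definition belowM X i j := X (pairM i j) /\ ~ X (pairM j i).
Definition isLOM X :=
  isRelM X /\
  (forall i, fieldM X i -> X (pairM i i)) /\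
  (forall i j k, X (pairM i j) -> X (pairM j k) -> X (pairM i k)) /\
  (forall i j, X (pairM i j) -> X (pairM j i) -> i = j) /\
  (forall i j, fieldM X i -> fieldM X j -> X (pairM i j) \/ X (pairM j i)).
Definition isWOM X :=
  isLOM X /\
  ~ exists F, dset M F /\ (isFunM F /\
      forall n u v, F (pairM n u) -> F (pairM (n + 1) v) -> belowM X v u).
Definition hierarchyM (theta : M -> set -> Prop) X Y :=
  forall k, Y k <-> exists n j, k = pairM n j /\ fieldM X j /\
    exists Z, dset M Z /\
      ((forall l, Z l <-> exists m i, l = pairM m i /\ belowM X i j /\ Y l) /\ theta n Z).

Definition codeM a : M := pairM (pairM (mpos a) (mneg a)) (mden a).
Definition denM a : M := mden a + 1.
Definition rzeroM : mrat M := MRat 0 0 0.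
Definition roneM : mrat M := MRat 1 0 0.
Definition rinvM m : mrat M := MRat 1 0 m.
Definition raddM a b : mrat M :=
  MRat (mpos a * denM b + mpos b * denM a)
       (mneg a * denM b + mneg b * denM a)
       (mden a * mden b + mden a + mden b).
Definition roppM a : mrat M := MRat (mneg a) (mpos a) (mden a).
Definition rsubM a b : mrat M := raddM a (roppM b).
Definition rltM a b :=
  mpos a * denM b + mneg b * denM a < mpos b * denM a + mneg a * denM b.
Definition rleM a b := ~ rltM b a.
Definition rdist_leM a b c := rleM a (raddM b c) /\ rleM b (raddM a c).
Definition rball_inM a' r' a r :=
  rltM (raddM a r') (raddM a' r) /\ rltM (raddM a' r') (raddM a r).

Definition isRealM X :=
  isFunM X /\
  (forall k m, X (pairM k m) -> exists q, m = codeM q) /\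
  (forall k i m p q, X (pairM k (codeM p)) -> X (pairM (k + i) (codeM q)) ->
     pow2M k (m + 1) -> rdist_leM p q (rinvM m)).
Definition lt_RQM X a :=
  exists k m q, X (pairM k (codeM q)) /\ pow2M k (m + 1) /\ rltM (raddM q (rinvM m)) a.
Definition lt_QRM a X :=
  exists k m q, X (pairM k (codeM q)) /\ pow2M k (m + 1) /\ rltM (raddM a (rinvM m)) q.
Definition lt_RRM X Y := exists a, lt_RQM X a /\ lt_QRM a Y.
Definition eq_RRM X Y := ~ lt_RRM X Y /\ ~ lt_RRM Y X.
Definition inUnitM X := isRealM X /\ ~ lt_RQM X rzeroM /\ ~ lt_QRM roneM X.
Definition dist_RQ_ltM X a r := lt_QRM (rsubM a r) X /\ lt_RQM X (raddM a r).
Definition dist_RQ_leM X a r := ~ lt_RQM X (rsubM a r) /\ ~ lt_QRM (raddM a r) X.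
Definition lt_shiftM X Y r := exists a, lt_QRM a Y /\ lt_RQM X (raddM a r).
Definition dist_RR_ltQM X Y r := lt_shiftM X Y r /\ lt_shiftM Y X r.
Definition dist_RR_ltRM X Y R := exists r, lt_QRM r R /\ dist_RR_ltQM X Y r.

Definition quintM n a r b s : M :=
  pairM (pairM (pairM (pairM n (codeM a)) (codeM r)) (codeM b)) (codeM s).
Definition mapsM F a r b s := exists n, F (quintM n a r b s).
Definition isUnitBallM a r := rleM rzeroM a /\ rleM a roneM /\ rltM rzeroM r.
Definition isContCodeM F :=
  (forall k, F k -> exists n a r b s,
     k = quintM n a r b s /\ isUnitBallM a r /\ rltM rzeroM s) /\
  (forall a r b s b' s', mapsM F a r b s -> mapsM F a r b' s' -> rdist_leM b b' (raddM s s')) /\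
  (forall a r b s a' r', mapsM F a r b s -> isUnitBallM a' r' -> rball_inM a' r' a r ->
     mapsM F a' r' b s) /\
  (forall a r b s b' s', mapsM F a r b s -> rball_inM b s b' s' -> mapsM F a r b' s').
Definition isValueM F X Y :=
  isRealM Y /\ forall a r b s, mapsM F a r b s -> dist_RQ_ltM X a r -> dist_RQ_leM Y b s.
Definition isContinuousM F :=
  isContCodeM F /\
  forall X, dset M X -> inUnitM X -> forall eps, rltM rzeroM eps ->
    exists a r b s, mapsM F a r b s /\ dist_RQ_ltM X a r /\ rltM s eps.

Definition isBaire1M F :=
  (forall n, isContinuousM (sliceM F n)) /\
  forall X, dset M X -> inUnitM X -> forall eps, rltM rzeroM eps ->
    exists n0, forall m n, ~ m < n0 -> ~ n < n0 ->
      forall Y, dset M Y -> forall Z, dset M Z ->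
        isValueM (sliceM F m) X Y -> isValueM (sliceM F n) X Z -> dist_RR_ltQM Y Z eps.
Definition inBall0M F X y r :=
  exists Y, dset M Y /\ (isValueM F X Y /\ dist_RQ_ltM Y y r).
Definition inBall1M F X y r :=
  exists s, rltM s r /\ exists n0, forall n, ~ n < n0 -> inBall0M (sliceM F n) X y s.
Definition inBall2M F X y r :=
  exists s, rltM s r /\ exists n0, forall n, ~ n < n0 -> inBall1M (sliceM F n) X y s.
Definition isBaire2M F :=
  (forall n, isBaire1M (sliceM F n)) /\
  forall X, dset M X -> inUnitM X -> forall eps, rltM rzeroM eps ->
    exists y r, rltM rzeroM r /\ rltM r eps /\
      exists n0, forall n, ~ n < n0 -> inBall1M (sliceM F n) X y r.
Definition isGaugeM F :=
  isBaire2M F /\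
  forall X, dset M X -> inUnitM X -> exists y r, rleM r y /\ inBall2M F X y r.
Definition le_value2M R F X := forall y r, inBall2M F X y r -> lt_RQM R (raddM y r).
Definition isFineCoverM F l P R :=
  (forall i, i < l ->
     inUnitM (sliceM P i) /\ isRealM (sliceM R i) /\ lt_QRM rzeroM (sliceM R i)) /\
  (forall i j, i < l -> j < l -> eq_RRM (sliceM P i) (sliceM P j) ->
     eq_RRM (sliceM R i) (sliceM R j)) /\
  (forall X, dset M X -> inUnitM X ->
     exists i, i < l /\ dist_RR_ltRM X (sliceM P i) (sliceM R i)) /\
  (forall i, i < l -> le_value2M (sliceM R i) F (sliceM P i)).
Definition cousinM :=
  forall F, dset M F -> isGaugeM F ->
    exists l P, dset M P /\ exists R, dset M R /\ isFineCoverM F l P R.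

End Semantics.

(* A named-binder formula at depth [d], [e] is compared with its meaning in the
   environment [rho], [tau]; the meaning of a [tm] must be stable under further
   binders. *)

Section Meaning.
Variable M : structure.

Local Notation "0" := (dzero M).
Local Notation "1" := (done_ M).
Local Notation "x + y" := (dadd x y).
Local Notation "x * y" := (dmul x y).
Local Notation "x < y" := (dlt x y).
Local Notation set := (M -> Prop).

Definition eapp (U : Type) (w : seq U) (rho : nat -> U) : nat -> U := foldr (@scons U) rho w.

Definition tR (d : nat) (rho : nat -> M) (t : tm) (x : M) :=
  forall w, eval M (eapp w rho) (t (addn (size w) d)) = x.
Definition sR (e : nat) (tau : nat -> set) (X : sv) (A : set) :=
  forall w, eapp w tau (X (addn (size w) e)) = A.
Definition cR (d e : nat) rho tau (C : cls) (A : set) :=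
  forall w w' t x, tR (addn (size w) d) (eapp w rho) t x ->
    (sat M (eapp w rho) (eapp w' tau) (C t (addn (size w) d) (addn (size w') e)) <-> A x).
Definition fR (d e : nat) rho tau (p : fm) (P : Prop) := sat M rho tau (p d e) <-> P.
Definition qR d rho (a : rat) (q : mrat M) :=
  [/\ tR d rho (rpos a) (mpos q), tR d rho (rneg a) (mneg q) & tR d rho (rden a) (mden q)].

Lemma eapp_rcons (U : Type) w (x : U) rho : eapp (rcons w x) rho = eapp w (scons x rho).
Proof. by elim: w => //= y w ->. Qed.

Lemma eapp_cat (U : Type) w w' (rho : nat -> U) : eapp (w ++ w') rho = eapp w (eapp w' rho).
Proof. exact: foldr_cat. Qed.

Lemma eapp_nth (U : Type) w (x : U) rho : eapp w (scons x rho) (size w) = x.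
Proof. by elim: w. Qed.

Lemma tR_up d rho t x y : tR d rho t x -> tR d.+1 (scons y rho) t x.
Proof. by move=> H w; have := H (rcons w y); rewrite eapp_rcons size_rcons addnS. Qed.

Lemma sR_up e tau X A B : sR e tau X A -> sR e.+1 (scons B tau) X A.
Proof. by move=> H w; have := H (rcons w B); rewrite eapp_rcons size_rcons addnS. Qed.

Lemma cR_up0 d e rho tau C A y : cR d e rho tau C A -> cR d.+1 e (scons y rho) tau C A.
Proof.
move=> H w w' t x; have := H (rcons w y) w' t x.
by rewrite eapp_rcons size_rcons addnS.
Qed.

Lemma cR_up1 d e rho tau C A B : cR d e rho tau C A -> cR d e.+1 rho (scons B tau) C A.
Proof.
move=> H w w' t x; have := H w (rcons w' B) t x.
by rewrite eapp_rcons size_rcons addnS.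
Qed.

Lemma qR_up d rho a q y : qR d rho a q -> qR d.+1 (scons y rho) a q.
Proof. by case=> *; split; exact: tR_up. Qed.

Lemma tR_bound d rho x : tR d.+1 (scons x rho) (bound0 d) x.
Proof.
move=> w; rewrite /bound0 /= (_ : Nat.sub _ _ = size w) ?eapp_nth //.
by rewrite -[Nat.sub _ _]/(subn (subn _ _) _); lia.
Qed.

Lemma sR_bound e tau A : sR e.+1 (scons A tau) (bound1 e) A.
Proof.
move=> w; rewrite /bound1 /= (_ : Nat.sub _ _ = size w) ?eapp_nth //.
by rewrite -[Nat.sub _ _]/(subn (subn _ _) _); lia.
Qed.

Lemma tR_zero d rho : tR d rho zero 0. Proof. by []. Qed.
Lemma tR_one d rho : tR d rho one 1. Proof. by []. Qed.
Lemma tR_add d rho s t x y : tR d rho s x -> tR d rho t y -> tR d rho (add s t) (x + y).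
Proof. by move=> Hs Ht w /=; rewrite Hs Ht. Qed.
Lemma tR_mul d rho s t x y : tR d rho s x -> tR d rho t y -> tR d rho (mul s t) (x * y).
Proof. by move=> Hs Ht w /=; rewrite Hs Ht. Qed.

Lemma tR_eval d rho t x : tR d rho t x -> eval M rho (t d) = x.
Proof. by move=> /(_ nil). Qed.

Lemma fR_eq d e rho tau s t x y :
  tR d rho s x -> tR d rho t y -> fR d e rho tau (eqn s t) (x = y).
Proof. by move=> /tR_eval Hs /tR_eval Ht; rewrite /fR /= Hs Ht. Qed.
Lemma fR_lt d e rho tau s t x y :
  tR d rho s x -> tR d rho t y -> fR d e rho tau (ltn s t) (x < y).
Proof. by move=> /tR_eval Hs /tR_eval Ht; rewrite /fR /= Hs Ht. Qed.
Lemma fR_cls d e rho tau C A t x :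
  cR d e rho tau C A -> tR d rho t x -> fR d e rho tau (C t) (A x).
Proof. by move=> H /(H nil nil). Qed.
Lemma fR_imp d e rho tau p q P Q :
  fR d e rho tau p P -> fR d e rho tau q Q -> fR d e rho tau (imp p q) (P -> Q).
Proof. by rewrite /fR /= => -> ->. Qed.
Lemma fR_neg d e rho tau p P : fR d e rho tau p P -> fR d e rho tau (neg p) (~ P).
Proof. by rewrite /fR /= => ->. Qed.
Lemma fR_and d e rho tau p q P Q :
  fR d e rho tau p P -> fR d e rho tau q Q -> fR d e rho tau (and_ p q) (P /\ Q).
Proof. by rewrite /fR sat_and => -> ->. Qed.
Lemma fR_or d e rho tau p q P Q :
  fR d e rho tau p P -> fR d e rho tau q Q -> fR d e rho tau (or_ p q) (P \/ Q).
Proof. by rewrite /fR sat_or => -> ->. Qed.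
Lemma fR_iff d e rho tau p q P Q :
  fR d e rho tau p P -> fR d e rho tau q Q -> fR d e rho tau (iff_ p q) (P <-> Q).
Proof. by rewrite /fR sat_iff => -> ->. Qed.
Lemma fR_all0 d e rho tau p (P : M -> Prop) :
  (forall x, fR d.+1 e (scons x rho) tau (p (bound0 d)) (P x)) ->
  fR d e rho tau (all0 p) (forall x, P x).
Proof. by move=> H; split=> H' x; apply/H; exact: H'. Qed.
Lemma fR_ex0 d e rho tau p (P : M -> Prop) :
  (forall x, fR d.+1 e (scons x rho) tau (p (bound0 d)) (P x)) ->
  fR d e rho tau (ex0 p) (exists x, P x).
Proof. by move=> H; rewrite /fR sat_ex0; split=> -[x Hx]; exists x; apply/H. Qed.
Lemma fR_all1 d e rho tau p (P : set -> Prop) :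
  (forall A, dset M A -> fR d e.+1 rho (scons A tau) (p (bound1 e)) (P A)) ->
  fR d e rho tau (all1 p) (forall A, dset M A -> P A).
Proof. by move=> H; split=> H' A HA; apply/(H A HA); exact: H'. Qed.
Lemma fR_ex1 d e rho tau p (P : set -> Prop) :
  (forall A, dset M A -> fR d e.+1 rho (scons A tau) (p (bound1 e)) (P A)) ->
  fR d e rho tau (ex1 p) (exists A, dset M A /\ P A).
Proof.
by move=> H; rewrite /fR sat_ex1; split=> -[A [HA H']]; exists A; split=> //; apply/(H A HA).
Qed.
Lemma fR_rall d e rho tau p (P : mrat M -> Prop) :
  (forall x y z, fR d.+3 e (scons z (scons y (scons x rho))) tau
     (p (Rat (bound0 d) (bound0 d.+1) (bound0 d.+2))) (P (MRat x y z))) ->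
  fR d e rho tau (rall p) (forall q, P q).
Proof. by move=> H; split=> [H' [x y z]|H' x y z]; apply/H; exact: H'. Qed.
Lemma fR_rex d e rho tau p (P : mrat M -> Prop) :
  (forall x y z, fR d.+3 e (scons z (scons y (scons x rho))) tau
     (p (Rat (bound0 d) (bound0 d.+1) (bound0 d.+2))) (P (MRat x y z))) ->
  fR d e rho tau (rex p) (exists q, P q).
Proof.
move=> H; rewrite /fR /rex sat_ex0; split.
- move=> [x]; rewrite sat_ex0 => -[y]; rewrite sat_ex0 => -[z Hz].
  by exists (MRat x y z); apply/H.
- move=> [[x y z] Hz]; exists x; rewrite sat_ex0; exists y; rewrite sat_ex0; exists z.
  exact/H.
Qed.

Lemma cR_cl d e rho tau X A : sR e tau X A -> cR d e rho tau (cl X) A.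
Proof. by move=> H w w' t x Ht /=; rewrite H (tR_eval Ht). Qed.

Lemma tR_pair d rho s t x y :
  tR d rho s x -> tR d rho t y -> tR d rho (pair s t) (pairM x y).
Proof. by move=> Hs Ht; do !(apply: tR_add || apply: tR_mul). Qed.

Lemma tR_app d rho t x w : tR d rho t x -> tR (addn (size w) d) (eapp w rho) t x.
Proof. by move=> H w'; have := H (w' ++ w); rewrite size_cat addnA eapp_cat. Qed.

Lemma cR_slice d e rho tau C A t i :
  cR d e rho tau C A -> tR d rho t i -> cR d e rho tau (slice C t) (sliceM A i).
Proof. by move=> HC Ht w w' s x Hs; apply: HC; apply: tR_pair => //; exact: tR_app. Qed.

Lemma qR_add d rho a b q r : qR d rho a q -> qR d rho b r -> qR d rho (radd a b) (raddM q r).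
Proof.
by move=> [? ? ?] [? ? ?]; split; do !(apply: tR_add || apply: tR_mul || apply: tR_one).
Qed.
Lemma qR_opp d rho a q : qR d rho a q -> qR d rho (ropp a) (roppM q).
Proof. by case. Qed.
Lemma qR_sub d rho a b q r : qR d rho a q -> qR d rho b r -> qR d rho (rsub a b) (rsubM q r).
Proof. by move=> Ha Hb; apply: qR_add => //; exact: qR_opp. Qed.
Lemma qR_zero d rho : qR d rho rzero (rzeroM M). Proof. by []. Qed.
Lemma qR_one d rho : qR d rho rone (roneM M). Proof. by []. Qed.
Lemma qR_inv d rho t x : tR d rho t x -> qR d rho (rinv t) (rinvM x).
Proof. by []. Qed.
Lemma tR_code d rho a q : qR d rho a q -> tR d rho (code a) (codeM q).
Proof. by case=> ? ? ?; do !apply: tR_pair. Qed.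
Lemma fR_rlt d e rho tau a b q r :
  qR d rho a q -> qR d rho b r -> fR d e rho tau (rlt a b) (rltM q r).
Proof.
move=> [? ? ?] [? ? ?]; apply: fR_lt; do !(apply: tR_add || apply: tR_mul || apply: tR_one || by []).
Qed.

Create HintDb sem_notion.

Ltac sem_var :=
  first [ assumption | apply: tR_bound | apply: sR_bound
        | apply: tR_up; sem_var | apply: sR_up; sem_var | apply: qR_up; sem_var
        | apply: cR_up0; sem_var | apply: cR_up1; sem_var ].

(** Syntax-directed: it descends through the connectives and, at a defined notion, appeals to the
    lemma registered for it. *)
Ltac sem :=
  cbv beta;
  lazymatch goal with
  | |- fR _ _ _ _ (all0 _) _ => apply: fR_all0 => ?; sem
  | |- fR _ _ _ _ (ex0 _) _ => apply: fR_ex0 => ?; sem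
  | |- fR _ _ _ _ (all1 _) _ => apply: fR_all1 => ? ?; sem
  | |- fR _ _ _ _ (ex1 _) _ => apply: fR_ex1 => ? ?; sem
  | |- fR _ _ _ _ (rall _) _ => apply: fR_rall => ? ? ?; sem
  | |- fR _ _ _ _ (rex _) _ => apply: fR_rex => ? ? ?; sem
  | |- fR _ _ _ _ (imp _ _) _ => apply: fR_imp; sem
  | |- fR _ _ _ _ (neg _) _ => apply: fR_neg; sem
  | |- fR _ _ _ _ (and_ _ _) _ => apply: fR_and; sem
  | |- fR _ _ _ _ (or_ _ _) _ => apply: fR_or; sem
  | |- fR _ _ _ _ (iff_ _ _) _ => apply: fR_iff; sem
  | |- fR _ _ _ _ (eqn _ _) _ => apply: fR_eq; sem
  | |- fR _ _ _ _ (ltn _ _) _ => apply: fR_lt; sem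
  | |- fR _ _ _ _ (rlt _ _) _ => apply: fR_rlt; sem
  | |- fR _ _ _ _ (rle _ _) _ => apply: fR_neg; apply: fR_rlt; sem
  | |- fR _ _ _ _ (cl _ _) _ => apply: fR_cls; sem
  | |- tR _ _ (add _ _) _ => apply: tR_add; sem
  | |- tR _ _ (mul _ _) _ => apply: tR_mul; sem
  | |- tR _ _ (pair _ _) _ => apply: tR_pair; sem
  | |- tR _ _ (code _) _ => apply: tR_code; sem
  | |- tR _ _ zero _ => apply: tR_zero
  | |- tR _ _ one _ => apply: tR_one
  | |- qR _ _ (radd _ _) _ => apply: qR_add; sem
  | |- qR _ _ (rsub _ _) _ => apply: qR_sub; sem
  | |- qR _ _ rzero _ => apply: qR_zero
  | |- qR _ _ rone _ => apply: qR_one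
  | |- qR _ _ (rinv _) _ => apply: qR_inv; sem
  | |- qR _ _ (Rat _ _ _) _ => split; sem_var
  | |- cR _ _ _ _ (slice _ _) _ => apply: cR_slice; sem
  | |- cR _ _ _ _ (cl _) _ => first [assumption | apply: cR_cl; sem_var]
  | |- fR _ _ _ _ (?C _) _ => first [ is_var C; apply: fR_cls; sem | solve [auto 1 with sem_notion nocore] ]
  | |- _ => sem_var
  end.

Lemma fR_isRel d e rho tau C0 A0 :
  cR d e rho tau C0 A0 ->
  fR d e rho tau (isRel C0) (isRelM A0).
Proof. by intros; rewrite /isRel /isRelM; sem. Qed.
#[local] Hint Extern 1 (fR _ _ _ _ (isRel _) _) => apply: fR_isRel; sem : sem_notion.

Lemma fR_isFun d e rho tau C0 A0 :
  cR d e rho tau C0 A0 ->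
  fR d e rho tau (isFun C0) (isFunM A0).
Proof. by intros; rewrite /isFun /isFunM; sem. Qed.
#[local] Hint Extern 1 (fR _ _ _ _ (isFun _) _) => apply: fR_isFun; sem : sem_notion.

Lemma fR_beta d e rho tau t0 x0 t1 x1 t2 x2 t3 x3 :
  tR d rho t0 x0 -> tR d rho t1 x1 -> tR d rho t2 x2 -> tR d rho t3 x3 ->
  fR d e rho tau (beta t0 t1 t2 t3) (betaM x0 x1 x2 x3).
Proof. by intros; rewrite /beta /betaM; sem. Qed.
#[local] Hint Extern 1 (fR _ _ _ _ (beta _ _ _ _) _) => apply: fR_beta; sem : sem_notion.

Lemma fR_pow2 d e rho tau t0 x0 t1 x1 :
  tR d rho t0 x0 -> tR d rho t1 x1 ->
  fR d e rho tau (pow2 t0 t1) (pow2M x0 x1).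
Proof. by intros; rewrite /pow2 /pow2M; sem. Qed.
#[local] Hint Extern 1 (fR _ _ _ _ (pow2 _ _) _) => apply: fR_pow2; sem : sem_notion.

Lemma fR_field d e rho tau C0 A0 t1 x1 :
  cR d e rho tau C0 A0 -> tR d rho t1 x1 ->
  fR d e rho tau (field C0 t1) (fieldM A0 x1).
Proof. by intros; rewrite /field /fieldM; sem. Qed.
#[local] Hint Extern 1 (fR _ _ _ _ (field _ _) _) => apply: fR_field; sem : sem_notion.

Lemma fR_below d e rho tau C0 A0 t1 x1 t2 x2 :
  cR d e rho tau C0 A0 -> tR d rho t1 x1 -> tR d rho t2 x2 ->
  fR d e rho tau (below C0 t1 t2) (belowM A0 x1 x2).
Proof. by intros; rewrite /below /belowM; sem. Qed.
#[local] Hint Extern 1 (fR _ _ _ _ (below _ _ _) _) => apply: fR_below; sem : sem_notion.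

Lemma fR_isLO d e rho tau C0 A0 :
  cR d e rho tau C0 A0 ->
  fR d e rho tau (isLO C0) (isLOM A0).
Proof. by intros; rewrite /isLO /isLOM; sem. Qed.
#[local] Hint Extern 1 (fR _ _ _ _ (isLO _) _) => apply: fR_isLO; sem : sem_notion.

Lemma fR_isWO d e rho tau C0 A0 :
  cR d e rho tau C0 A0 ->
  fR d e rho tau (isWO C0) (isWOM A0).
Proof. by intros; rewrite /isWO /isWOM; sem. Qed.
#[local] Hint Extern 1 (fR _ _ _ _ (isWO _) _) => apply: fR_isWO; sem : sem_notion.

Lemma fR_rdist_le d e rho tau a0 q0 a1 q1 a2 q2 :
  qR d rho a0 q0 -> qR d rho a1 q1 -> qR d rho a2 q2 ->
  fR d e rho tau (rdist_le a0 a1 a2) (rdist_leM q0 q1 q2).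
Proof. by intros; rewrite /rdist_le /rdist_leM; sem. Qed.
#[local] Hint Extern 1 (fR _ _ _ _ (rdist_le _ _ _) _) => apply: fR_rdist_le; sem : sem_notion.

Lemma fR_rball_in d e rho tau a0 q0 a1 q1 a2 q2 a3 q3 :
  qR d rho a0 q0 -> qR d rho a1 q1 -> qR d rho a2 q2 -> qR d rho a3 q3 ->
  fR d e rho tau (rball_in a0 a1 a2 a3) (rball_inM q0 q1 q2 q3).
Proof. by intros; rewrite /rball_in /rball_inM; sem. Qed.
#[local] Hint Extern 1 (fR _ _ _ _ (rball_in _ _ _ _) _) => apply: fR_rball_in; sem : sem_notion.

Lemma fR_isReal d e rho tau C0 A0 :
  cR d e rho tau C0 A0 ->
  fR d e rho tau (isReal C0) (isRealM A0).
Proof. by intros; rewrite /isReal /isRealM; sem. Qed.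
#[local] Hint Extern 1 (fR _ _ _ _ (isReal _) _) => apply: fR_isReal; sem : sem_notion.

Lemma fR_lt_RQ d e rho tau C0 A0 a1 q1 :
  cR d e rho tau C0 A0 -> qR d rho a1 q1 ->
  fR d e rho tau (lt_RQ C0 a1) (lt_RQM A0 q1).
Proof. by intros; rewrite /lt_RQ /lt_RQM; sem. Qed.
#[local] Hint Extern 1 (fR _ _ _ _ (lt_RQ _ _) _) => apply: fR_lt_RQ; sem : sem_notion.

Lemma fR_lt_QR d e rho tau a0 q0 C1 A1 :
  qR d rho a0 q0 -> cR d e rho tau C1 A1 ->
  fR d e rho tau (lt_QR a0 C1) (lt_QRM q0 A1).
Proof. by intros; rewrite /lt_QR /lt_QRM; sem. Qed.
#[local] Hint Extern 1 (fR _ _ _ _ (lt_QR _ _) _) => apply: fR_lt_QR; sem : sem_notion.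

Lemma fR_lt_RR d e rho tau C0 A0 C1 A1 :
  cR d e rho tau C0 A0 -> cR d e rho tau C1 A1 ->
  fR d e rho tau (lt_RR C0 C1) (lt_RRM A0 A1).
Proof. by intros; rewrite /lt_RR /lt_RRM; sem. Qed.
#[local] Hint Extern 1 (fR _ _ _ _ (lt_RR _ _) _) => apply: fR_lt_RR; sem : sem_notion.

Lemma fR_eq_RR d e rho tau C0 A0 C1 A1 :
  cR d e rho tau C0 A0 -> cR d e rho tau C1 A1 ->
  fR d e rho tau (eq_RR C0 C1) (eq_RRM A0 A1).
Proof. by intros; rewrite /eq_RR /eq_RRM; sem. Qed.
#[local] Hint Extern 1 (fR _ _ _ _ (eq_RR _ _) _) => apply: fR_eq_RR; sem : sem_notion.

Lemma fR_inUnit d e rho tau C0 A0 :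
  cR d e rho tau C0 A0 ->
  fR d e rho tau (inUnit C0) (inUnitM A0).
Proof. by intros; rewrite /inUnit /inUnitM; sem. Qed.
#[local] Hint Extern 1 (fR _ _ _ _ (inUnit _) _) => apply: fR_inUnit; sem : sem_notion.

Lemma fR_dist_RQ_lt d e rho tau C0 A0 a1 q1 a2 q2 :
  cR d e rho tau C0 A0 -> qR d rho a1 q1 -> qR d rho a2 q2 ->
  fR d e rho tau (dist_RQ_lt C0 a1 a2) (dist_RQ_ltM A0 q1 q2).
Proof. by intros; rewrite /dist_RQ_lt /dist_RQ_ltM; sem. Qed.
#[local] Hint Extern 1 (fR _ _ _ _ (dist_RQ_lt _ _ _) _) => apply: fR_dist_RQ_lt; sem : sem_notion.

Lemma fR_dist_RQ_le d e rho tau C0 A0 a1 q1 a2 q2 :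
  cR d e rho tau C0 A0 -> qR d rho a1 q1 -> qR d rho a2 q2 ->
  fR d e rho tau (dist_RQ_le C0 a1 a2) (dist_RQ_leM A0 q1 q2).
Proof. by intros; rewrite /dist_RQ_le /dist_RQ_leM; sem. Qed.
#[local] Hint Extern 1 (fR _ _ _ _ (dist_RQ_le _ _ _) _) => apply: fR_dist_RQ_le; sem : sem_notion.

Lemma fR_lt_shift d e rho tau C0 A0 C1 A1 a2 q2 :
  cR d e rho tau C0 A0 -> cR d e rho tau C1 A1 -> qR d rho a2 q2 ->
  fR d e rho tau (lt_shift C0 C1 a2) (lt_shiftM A0 A1 q2).
Proof. by intros; rewrite /lt_shift /lt_shiftM; sem. Qed.
#[local] Hint Extern 1 (fR _ _ _ _ (lt_shift _ _ _) _) => apply: fR_lt_shift; sem : sem_notion.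

Lemma fR_dist_RR_ltQ d e rho tau C0 A0 C1 A1 a2 q2 :
  cR d e rho tau C0 A0 -> cR d e rho tau C1 A1 -> qR d rho a2 q2 ->
  fR d e rho tau (dist_RR_ltQ C0 C1 a2) (dist_RR_ltQM A0 A1 q2).
Proof. by intros; rewrite /dist_RR_ltQ /dist_RR_ltQM; sem. Qed.
#[local] Hint Extern 1 (fR _ _ _ _ (dist_RR_ltQ _ _ _) _) => apply: fR_dist_RR_ltQ; sem : sem_notion.

Lemma fR_dist_RR_ltR d e rho tau C0 A0 C1 A1 C2 A2 :
  cR d e rho tau C0 A0 -> cR d e rho tau C1 A1 -> cR d e rho tau C2 A2 ->
  fR d e rho tau (dist_RR_ltR C0 C1 C2) (dist_RR_ltRM A0 A1 A2).
Proof. by intros; rewrite /dist_RR_ltR /dist_RR_ltRM; sem. Qed.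
#[local] Hint Extern 1 (fR _ _ _ _ (dist_RR_ltR _ _ _) _) => apply: fR_dist_RR_ltR; sem : sem_notion.

Lemma fR_maps d e rho tau C0 A0 a1 q1 a2 q2 a3 q3 a4 q4 :
  cR d e rho tau C0 A0 -> qR d rho a1 q1 -> qR d rho a2 q2 -> qR d rho a3 q3 -> qR d rho a4 q4 ->
  fR d e rho tau (maps C0 a1 a2 a3 a4) (mapsM A0 q1 q2 q3 q4).
Proof. by intros; rewrite /maps /mapsM; sem. Qed.
#[local] Hint Extern 1 (fR _ _ _ _ (maps _ _ _ _ _) _) => apply: fR_maps; sem : sem_notion.

Lemma fR_isUnitBall d e rho tau a0 q0 a1 q1 :
  qR d rho a0 q0 -> qR d rho a1 q1 ->
  fR d e rho tau (isUnitBall a0 a1) (isUnitBallM q0 q1).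
Proof. by intros; rewrite /isUnitBall /isUnitBallM; sem. Qed.
#[local] Hint Extern 1 (fR _ _ _ _ (isUnitBall _ _) _) => apply: fR_isUnitBall; sem : sem_notion.

Lemma fR_isContCode d e rho tau C0 A0 :
  cR d e rho tau C0 A0 ->
  fR d e rho tau (isContCode C0) (isContCodeM A0).
Proof. by intros; rewrite /isContCode /isContCodeM; sem. Qed.
#[local] Hint Extern 1 (fR _ _ _ _ (isContCode _) _) => apply: fR_isContCode; sem : sem_notion.

Lemma fR_isValue d e rho tau C0 A0 C1 A1 C2 A2 :
  cR d e rho tau C0 A0 -> cR d e rho tau C1 A1 -> cR d e rho tau C2 A2 ->
  fR d e rho tau (isValue C0 C1 C2) (isValueM A0 A1 A2).
Proof. by intros; rewrite /isValue /isValueM; sem. Qed.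
#[local] Hint Extern 1 (fR _ _ _ _ (isValue _ _ _) _) => apply: fR_isValue; sem : sem_notion.

Lemma fR_isContinuous d e rho tau C0 A0 :
  cR d e rho tau C0 A0 ->
  fR d e rho tau (isContinuous C0) (isContinuousM A0).
Proof. by intros; rewrite /isContinuous /isContinuousM; sem. Qed.
#[local] Hint Extern 1 (fR _ _ _ _ (isContinuous _) _) => apply: fR_isContinuous; sem : sem_notion.

Lemma fR_isBaire1 d e rho tau C0 A0 :
  cR d e rho tau C0 A0 ->
  fR d e rho tau (isBaire1 C0) (isBaire1M A0).
Proof. by intros; rewrite /isBaire1 /isBaire1M; sem. Qed.
#[local] Hint Extern 1 (fR _ _ _ _ (isBaire1 _) _) => apply: fR_isBaire1; sem : sem_notion.

Lemma fR_inBall0 d e rho tau C0 A0 C1 A1 a2 q2 a3 q3 :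
  cR d e rho tau C0 A0 -> cR d e rho tau C1 A1 -> qR d rho a2 q2 -> qR d rho a3 q3 ->
  fR d e rho tau (inBall0 C0 C1 a2 a3) (inBall0M A0 A1 q2 q3).
Proof. by intros; rewrite /inBall0 /inBall0M; sem. Qed.
#[local] Hint Extern 1 (fR _ _ _ _ (inBall0 _ _ _ _) _) => apply: fR_inBall0; sem : sem_notion.

Lemma fR_inBall1 d e rho tau C0 A0 C1 A1 a2 q2 a3 q3 :
  cR d e rho tau C0 A0 -> cR d e rho tau C1 A1 -> qR d rho a2 q2 -> qR d rho a3 q3 ->
  fR d e rho tau (inBall1 C0 C1 a2 a3) (inBall1M A0 A1 q2 q3).
Proof. by intros; rewrite /inBall1 /inBall1M /eventually; sem. Qed.
#[local] Hint Extern 1 (fR _ _ _ _ (inBall1 _ _ _ _) _) => apply: fR_inBall1; sem : sem_notion.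

Lemma fR_inBall2 d e rho tau C0 A0 C1 A1 a2 q2 a3 q3 :
  cR d e rho tau C0 A0 -> cR d e rho tau C1 A1 -> qR d rho a2 q2 -> qR d rho a3 q3 ->
  fR d e rho tau (inBall2 C0 C1 a2 a3) (inBall2M A0 A1 q2 q3).
Proof. by intros; rewrite /inBall2 /inBall2M /eventually; sem. Qed.
#[local] Hint Extern 1 (fR _ _ _ _ (inBall2 _ _ _ _) _) => apply: fR_inBall2; sem : sem_notion.

Lemma fR_isBaire2 d e rho tau C0 A0 :
  cR d e rho tau C0 A0 ->
  fR d e rho tau (isBaire2 C0) (isBaire2M A0).
Proof. by intros; rewrite /isBaire2 /isBaire2M /eventually; sem. Qed.
#[local] Hint Extern 1 (fR _ _ _ _ (isBaire2 _) _) => apply: fR_isBaire2; sem : sem_notion.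

Lemma fR_isGauge d e rho tau C0 A0 :
  cR d e rho tau C0 A0 ->
  fR d e rho tau (isGauge C0) (isGaugeM A0).
Proof. by intros; rewrite /isGauge /isGaugeM; sem. Qed.
#[local] Hint Extern 1 (fR _ _ _ _ (isGauge _) _) => apply: fR_isGauge; sem : sem_notion.

Lemma fR_le_value2 d e rho tau C0 A0 C1 A1 C2 A2 :
  cR d e rho tau C0 A0 -> cR d e rho tau C1 A1 -> cR d e rho tau C2 A2 ->
  fR d e rho tau (le_value2 C0 C1 C2) (le_value2M A0 A1 A2).
Proof. by intros; rewrite /le_value2 /le_value2M; sem. Qed.
#[local] Hint Extern 1 (fR _ _ _ _ (le_value2 _ _ _) _) => apply: fR_le_value2; sem : sem_notion.

Lemma fR_isFineCover d e rho tau C0 A0 t1 x1 C2 A2 C3 A3 :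
  cR d e rho tau C0 A0 -> tR d rho t1 x1 -> cR d e rho tau C2 A2 -> cR d e rho tau C3 A3 ->
  fR d e rho tau (isFineCover C0 t1 C2 C3) (isFineCoverM A0 x1 A2 A3).
Proof. by intros; rewrite /isFineCover /isFineCoverM; sem. Qed.
#[local] Hint Extern 1 (fR _ _ _ _ (isFineCover _ _ _ _) _) => apply: fR_isFineCover; sem : sem_notion.

(** Beyond the reach of [sem], as [theta] is an arbitrary formula: its parameters have to be traced
    past the three number binders and the set binder that enclose it. *)
Lemma fR_hierarchy theta d e rho tau C0 A0 C1 A1 :
  cR d e rho tau C0 A0 -> cR d e rho tau C1 A1 ->
  fR d e rho tau (hierarchy theta C0 C1)
    (hierarchyM (fun n Z => sat M (scons n (fun i => rho (addn i d)))
                                  (scons Z (fun X => tau (addn X e))) theta) A0 A1).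
Proof.
move=> H0 H1; rewrite /hierarchy /hierarchyM.
apply: fR_all0 => k; apply: fR_iff; first by sem.
apply: fR_ex0 => n; apply: fR_ex0 => j; apply: fR_and; first by sem.
apply: fR_and; first by sem.
apply: fR_ex1 => Z HZ; apply: fR_and; first by sem.
have En : tR d.+3 (scons j (scons n (scons k rho))) (bound0 d.+1) n by sem_var.
have EZ : sR e.+1 (scons Z tau) (bound1 e) Z by exact: sR_bound.
rewrite /fR sat_schema01 (tR_eval En) (EZ nil : scons Z tau (bound1 e e.+1) = Z).
rewrite (_ : (fun i => _) = fun i => rho (addn i d)); last first.
  by apply: funext => i; rewrite !addnS.
by rewrite (_ : (fun X => scons Z tau _) = fun X => tau (addn X e)) //;
  apply: funext => X; rewrite addnS.
Qed.

Lemma sat_cousin rho tau : sat M rho tau CousinBaire2 <-> cousinM M.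
Proof.
suff H : fR 0 0 rho tau (all1 (fun F => imp (isGauge (cl F))
    (ex0 (fun l => ex1 (fun P => ex1 (fun R => isFineCover (cl F) l (cl P) (cl R))))))) (cousinM M).
  exact: H.
by rewrite /cousinM; sem.
Qed.

End Meaning.
(** * Models of RCA0 and definability with parameters *)

(* All elements and sets are named, so that parameters can be read off the
   fixed environments [renv0] and [rset0]. *)
Record rcaModel : Type := RcaModel {
  rstr :> structure;
  rax : forall p rho tau, RCA0 p -> (forall X, dset rstr (tau X)) -> sat rstr rho tau p;
  renv0 : nat -> rstr;
  rset0 : nat -> rstr -> Prop;
  rset0P : forall X, dset rstr (rset0 X);
  rset0_surj : forall A, dset rstr A -> exists X, A = rset0 X;
  renv0_surj : forall a, exists t, a = eval rstr renv0 t }.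

Arguments renv0 : clear implicits.
Arguments rset0 : clear implicits.
Arguments rset0P : clear implicits.

Declare Scope M_scope.
Delimit Scope M_scope with M.
Notation "0" := (dzero _) : M_scope.
Notation "1" := (done_ _) : M_scope.
Notation "x + y" := (dadd x y) : M_scope.
Notation "x * y" := (dmul x y) : M_scope.
Notation "x < y" := (dlt x y) : M_scope.
Definition dle (M : structure) (x y : M) := ~ dlt y x.
Notation "x <= y" := (dle x y) : M_scope.
Bind Scope M_scope with dom.

Notation tl v := (fun i => v (S i)).

Section Definability.
Variable M : rcaModel.
Local Notation N := (dom M).
Local Open Scope M_scope.

(** The first [k] variables are arguments, taken from [v]; all others are parameters with the fixed
    values [renv0]. *)
Definition mix (k : nat) (v : nat -> N) (i : nat) : N :=
  if (i < k)%N then v i else renv0 M (i - k)%N.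

Lemma mix_scons k a v : scons a (mix k v) = mix k.+1 (scons a v).
Proof. by apply: funext => -[]. Qed.

Lemma mix0 v : mix 0 v = renv0 M.
Proof. by apply: funext => i; rewrite /mix /= subn0. Qed.

Definition T0 k (f : (nat -> N) -> N) := exists t, forall v, f v = eval M (mix k v) t.
Definition D0 k (P : (nat -> N) -> Prop) :=
  exists p, Delta00 p /\ forall v, P v <-> sat M (mix k v) (rset0 M) p.

Lemma T0_var k i : (i < k)%N -> T0 k (fun v => v i).
Proof. by move=> H; exists (tvar i) => v /=; rewrite /mix H. Qed.

Lemma T0_const k c : T0 k (fun _ => c).
Proof.
have [t ->] := renv0_surj c; exists (tsubst (fun i => tvar (i + k)) t) => v.
rewrite eval_subst; congr eval; apply: funext => i /=.
by rewrite /mix ltnNge leq_addl addnK.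
Qed.

Lemma T0_add k f g : T0 k f -> T0 k g -> T0 k (fun v => f v + g v).
Proof. by move=> [s Hs] [t Ht]; exists (tadd s t) => v /=; rewrite Hs Ht. Qed.

Lemma T0_mul k f g : T0 k f -> T0 k g -> T0 k (fun v => f v * g v).
Proof. by move=> [s Hs] [t Ht]; exists (tmul s t) => v /=; rewrite Hs Ht. Qed.

Lemma D0_ext k P Q : D0 k P -> (forall v, P v <-> Q v) -> D0 k Q.
Proof. by move=> [p [Hp H]] E; exists p; split=> // v; rewrite -E. Qed.

Lemma D0_eq k f g : T0 k f -> T0 k g -> D0 k (fun v => f v = g v).
Proof.
move=> [s Hs] [t Ht]; exists (feq s t); split=> [|v]; first by constructor.
by rewrite /= Hs Ht.
Qed.

Lemma D0_lt k f g : T0 k f -> T0 k g -> D0 k (fun v => f v < g v).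
Proof.
move=> [s Hs] [t Ht]; exists (flt s t); split=> [|v]; first by constructor.
by rewrite /= Hs Ht.
Qed.

Lemma D0_mem k f A : dset M A -> T0 k f -> D0 k (fun v => A (f v)).
Proof.
move=> /rset0_surj [X ->] [t Ht]; exists (fmem t X); split=> [|v]; first by constructor.
by rewrite /= Ht.
Qed.

Lemma D0_bot k : D0 k (fun _ => False).
Proof. by exists fbot; split=> //; constructor. Qed.

Lemma D0_imp k P Q : D0 k P -> D0 k Q -> D0 k (fun v => P v -> Q v).
Proof.
move=> [p [Hp HP]] [q [Hq HQ]]; exists (fimp p q); split=> [|v]; first by constructor.
by rewrite /= HP HQ.
Qed.

Lemma D0_ball k f (P : N -> (nat -> N) -> Prop) :
  T0 k f -> D0 k.+1 (fun v => P (v 0%N) (tl v)) -> D0 k (fun v => forall a, a < f v -> P a v).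
Proof.
move=> [t Ht] [p [Hp HP]].
exists (fall0 (fimp (flt (tvar 0) (tlift t)) p)); split=> [|v]; first exact: D_ball.
have E a : P a v <-> sat M (mix k.+1 (scons a v)) (rset0 M) p by exact: (HP (scons a v)).
by split=> /= H a; have := H a; rewrite eval_tlift -Ht mix_scons E.
Qed.

Lemma D0_not k P : D0 k P -> D0 k (fun v => ~ P v).
Proof. by move=> H; apply: D0_imp => //; exact: D0_bot. Qed.

Lemma D0_and k P Q : D0 k P -> D0 k Q -> D0 k (fun v => P v /\ Q v).
Proof.
move=> HP HQ; apply: D0_ext (D0_not (D0_imp HP (D0_not HQ))) _ => v.
by split=> [H|]; [split; apply: contrapT|]; tauto.
Qed.

Lemma D0_or k P Q : D0 k P -> D0 k Q -> D0 k (fun v => P v \/ Q v).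
Proof.
move=> HP HQ; apply: D0_ext (D0_imp (D0_not HP) HQ) _ => v.
by split; case: (pselect (P v)); tauto.
Qed.

Lemma D0_bex k f (P : N -> (nat -> N) -> Prop) :
  T0 k f -> D0 k.+1 (fun v => P (v 0%N) (tl v)) -> D0 k (fun v => exists a, a < f v /\ P a v).
Proof.
move=> Hf HP.
apply: D0_ext (D0_not (D0_ball Hf (P := fun a v => ~ P a v) (D0_not HP))) _ => v.
split=> [H|[a [Ha HPa]] H]; last exact: (H a).
by apply: contrapT => H'; apply: H => a Ha HPa; apply: H'; exists a.
Qed.

Definition rsub k k' (r : nat -> nat) i := tvar (if (i < k)%N then r i else (i - k + k')%N).

Lemma mix_rsub k k' r v : (forall i, (i < k)%N -> (r i < k')%N) ->
  (fun i => eval M (mix k' v) (rsub k k' r i)) = mix k (fun i => v (r i)).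
Proof.
move=> Hr; apply: funext => i; rewrite /= {2}/mix; case: ifP => Hi.
- by rewrite /mix Hr.
- by rewrite /mix (ltnNge _ k') leq_addl /= addnK.
Qed.

Lemma T0_ren k k' r f : (forall i, (i < k)%N -> (r i < k')%N) ->
  T0 k f -> T0 k' (fun v => f (fun i => v (r i))).
Proof.
by move=> Hr [t Ht]; exists (tsubst (rsub k k' r) t) => v; rewrite Ht eval_subst mix_rsub.
Qed.

Lemma D0_ren k k' r P : (forall i, (i < k)%N -> (r i < k')%N) ->
  D0 k P -> D0 k' (fun v => P (fun i => v (r i))).
Proof.
move=> Hr [p [Hp HP]]; exists (fsubst (rsub k k' r) (fun X => X) p).
by split=> [|v]; [exact: Delta00_subst | rewrite HP sat_subst mix_rsub].
Qed.

Definition S1 k (P : (nat -> N) -> Prop) :=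
  exists Q, D0 k.+1 Q /\ forall v, P v <-> exists a, Q (scons a v).

Lemma S1_D0 k P : D0 k P -> S1 k P.
Proof.
move=> HP; exists (fun v => P (tl v)); split; first exact: (@D0_ren _ _ S _ _ HP).
by move=> v; split=> [H|[a]]; [exists 0|].
Qed.

Lemma S1_exD0 k (P : N -> (nat -> N) -> Prop) :
  D0 k.+1 (fun v => P (v 0%N) (tl v)) -> S1 k (fun v => exists a, P a v).
Proof. by move=> HP; exists (fun v => P (v 0%N) (tl v)). Qed.

Lemma S1_ext k P Q : S1 k P -> (forall v, P v <-> Q v) -> S1 k Q.
Proof. by move=> [R [HR H]] E; exists R; split=> // v; rewrite -E. Qed.

Lemma S1_form k P : S1 k P ->
  exists p, Sigma01 p /\ forall v, P v <-> sat M (mix k v) (rset0 M) p.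
Proof.
move=> [Q [[p [Hp HQ]] HP]]; exists (fex0 p); split=> [|v]; first by constructor.
by rewrite HP sat_ex0; split=> -[a Ha]; exists a; move: Ha; rewrite HQ mix_scons.
Qed.

Lemma sat_schema0_mix p (P : N -> Prop) a d rho e tau :
  (forall v, P (v 0%N) <-> sat M (mix 1 v) (rset0 M) p) ->
  (forall i, rho (i + d)%N = renv0 M i) -> (forall X, tau (X + e)%N = rset0 M X) ->
  forall n, eval M rho (n d) = a -> sat M rho tau (schema0 p n d e) <-> P a.
Proof.
move=> H Hr Ht n Hn; rewrite sat_schema0 Hn.
rewrite (_ : (fun X => tau _) = rset0 M); last exact: funext.
rewrite (_ : (fun i => rho _) = renv0 M); last exact: funext.
by rewrite (H (scons a (renv0 M))) -mix_scons mix0.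
Qed.

Lemma sat_impE (rho : nat -> N) tau p q :
  sat M rho tau (fimp p q) -> sat M rho tau p -> sat M rho tau q.
Proof. by []. Qed.

Theorem induct (P : N -> Prop) : S1 1 (fun v => P (v 0%N)) ->
  P 0 -> (forall n, P n -> P (n + 1)) -> forall n, P n.
Proof.
move=> /S1_form [p [Hp HP]] H0 HS.
have H := rax (renv0 M) (@RCA0_induction _ Hp) (rset0P M).
have E := sat_schema0_mix HP.
move=> n.
have E1 (X : nat) : rset0 M (X + 0)%N = rset0 M X by rewrite addn0.
have E2 a i : scons a (renv0 M) (i + 1)%N = renv0 M i by rewrite addn1.
apply/(E n _ _ _ _ (E2 n) E1 (bound0 0) erefl).
move: n; apply: (sat_impE H).
apply/sat_and; split=> [|a].
  by apply/(E 0) => // i; rewrite addn0.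
by move/(E a _ _ _ _ (E2 a) E1 (bound0 0) erefl)/HS/(E _ _ _ _ _ (E2 a) E1 (add (bound0 0) one) erefl).
Qed.

Theorem comprehend (P : N -> Prop) :
  S1 1 (fun v => P (v 0%N)) -> S1 1 (fun v => ~ P (v 0%N)) -> dset M P.
Proof.
move=> /S1_form [p [Hp HP]] [Q [[q [Hq HQ]] HQ']].
have Hq' : Pi01 (fall0 (fneg q)) by constructor; apply: D_imp => //; constructor.
have HP' v : P (v 0%N) <-> sat M (mix 1 v) (rset0 M) (fall0 (fneg q)).
  rewrite -[P _]not_notP HQ' /=; split=> [H a Ha|H [a Ha]].
  - by apply: H; exists a; rewrite HQ -mix_scons.
  - by apply: (H a); rewrite mix_scons -HQ.
have H := rax (renv0 M) (@RCA0_comprehension _ _ Hp Hq') (rset0P M).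
have E := sat_schema0_mix HP.
have E' := sat_schema0_mix HP'.
have E1 (X : nat) : rset0 M (X + 0)%N = rset0 M X by rewrite addn0.
have E2 n i : scons n (renv0 M) (i + 1)%N = renv0 M i by rewrite addn1.
have {}H := sat_impE H (fun n => proj2 (sat_iff _ _ _ _)
  (iff_trans (E n _ _ _ _ (E2 n) E1 (bound0 0) erefl)
             (iff_sym (E' n _ _ _ _ (E2 n) E1 (bound0 0) erefl)))).
move/sat_ex1: H => [A [HA H]].
(* Sets are predicates, so by extensionality the set supplied by the axiom is [P] itself. *)
suff -> : P = A by [].
apply: funext => n; apply: propext; symmetry.
have Hn : A n <-> sat M (scons n (renv0 M)) (scons A (rset0 M)) (schema0 p (bound0 0) 1%N 1%N).
  have H1 : sat M (scons n (renv0 M)) (scons A (rset0 M))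
      (fiff (fmem (tvar 0) 0) (schema0 p (bound0 0) 1%N 1%N)) := H n.
  by move/sat_iff: H1.
rewrite Hn; by apply: E => // X; rewrite addn1.
Qed.

End Definability.
(** * Arithmetic of a model *)

Ltac d0 :=
  cbv beta;
  lazymatch goal with
  | |- D0 _ (fun v => _ = _) => apply: D0_eq; d0
  | |- D0 _ (fun v => dlt _ _) => apply: D0_lt; d0
  | |- D0 _ (fun v => dle _ _) => apply: D0_not; d0
  | |- D0 _ (fun v => _ /\ _) => apply: D0_and; d0
  | |- D0 _ (fun v => _ \/ _) => apply: D0_or; d0
  | |- D0 _ (fun v => ~ _) => apply: D0_not; d0
  | |- D0 _ (fun v => forall a, dlt a _ -> _) => apply: D0_ball; d0
  | |- D0 _ (fun v => exists a, dlt a _ /\ _) => apply: D0_bex; d0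
  | |- D0 _ (fun v => _ -> _) => apply: D0_imp; d0
  | |- T0 _ (fun v => dadd _ _) => apply: T0_add; d0
  | |- T0 _ (fun v => dmul _ _) => apply: T0_mul; d0
  | |- T0 _ (fun v => v _) => apply: T0_var; done
  | |- T0 _ (fun v => _) => apply: T0_const
  end.

Section Arithmetic.
Variable M : rcaModel.
Local Notation N := (dom M).
Local Open Scope M_scope.
Implicit Types x y z a b n m : N.

Lemma ind0 (P : N -> Prop) : D0 1 (fun v => P (v 0%N)) ->
  P 0 -> (forall n, P n -> P (n + 1)) -> forall n, P n.
Proof. by move=> H; apply: induct; exact: S1_D0. Qed.

Lemma sat_basic p : basic p -> sat M (renv0 M) (rset0 M) p.
Proof. by move=> H; apply: rax (rset0P M); exact: RCA0_basic. Qed.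

Lemma succ_neq0 n : n + 1 <> 0. Proof. exact: (sat_basic B_succ_neq0 n). Qed.
Lemma succ_inj m n : m + 1 = n + 1 -> m = n. Proof. exact: (sat_basic B_succ_inj m n). Qed.
Lemma madd0 m : m + 0 = m. Proof. exact: (sat_basic B_add0 m). Qed.
Lemma maddS m n : m + (n + 1) = m + n + 1. Proof. exact: (sat_basic B_addS m n). Qed.
Lemma mmul0 m : m * 0 = 0. Proof. exact: (sat_basic B_mul0 m). Qed.
Lemma mmulS m n : m * (n + 1) = m * n + m. Proof. exact: (sat_basic B_mulS m n). Qed.
Lemma mlt0 m : ~ m < 0. Proof. exact: (sat_basic B_lt0 m). Qed.
Lemma mltS m n : m < n + 1 <-> m < n \/ m = n.
Proof.
have H : sat M (scons n (scons m (renv0 M))) (rset0 M)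
    (fiff (flt (tvar 1) (tadd (tvar 0) tone))
      (for_ (flt (tvar 1) (tvar 0)) (feq (tvar 1) (tvar 0)))) := sat_basic B_ltS m n.
by move/sat_iff: H; rewrite sat_or.
Qed.

Lemma maddA x y z : x + (y + z) = x + y + z.
Proof.
elim/ind0: z => [||z IH]; first by d0.
  by rewrite !madd0.
by rewrite !maddS IH.
Qed.

Lemma madd0l x : 0 + x = x.
Proof. by elim/ind0: x => [||x IH]; [d0|rewrite madd0|rewrite maddS IH]. Qed.

Lemma madd1l x : 1 + x = x + 1.
Proof. by elim/ind0: x => [||x IH]; [d0|rewrite madd0 madd0l|rewrite maddS IH]. Qed.

Lemma maddC x y : x + y = y + x.
Proof.
elim/ind0: y => [||y IH]; [by d0|by rewrite madd0 madd0l|].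
by rewrite maddS IH -[in RHS]maddA madd1l maddA.
Qed.

Lemma mmul0l x : 0 * x = 0.
Proof. by elim/ind0: x => [||x IH]; [d0|rewrite mmul0|rewrite mmulS IH madd0]. Qed.

Lemma mmulSl x y : (x + 1) * y = x * y + y.
Proof.
elim/ind0: y => [||y IH]; [by d0|by rewrite !mmul0 madd0|].
by rewrite !mmulS IH -!maddA; congr (_ + _); rewrite !maddA [y + x]maddC.
Qed.

Lemma mmulC x y : x * y = y * x.
Proof.
elim/ind0: y => [||y IH]; [by d0|by rewrite mmul0 mmul0l|].
by rewrite mmulS mmulSl IH.
Qed.

Lemma mmulDr x y z : x * (y + z) = x * y + x * z.
Proof.
elim/ind0: z => [||z IH]; [by d0|by rewrite mmul0 !madd0|].
by rewrite maddS !mmulS IH maddA.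
Qed.

Lemma mmulA x y z : x * (y * z) = x * y * z.
Proof.
elim/ind0: z => [||z IH]; [by d0|by rewrite !mmul0|].
by rewrite !mmulS mmulDr IH.
Qed.

Lemma mmul1 x : x * 1 = x.
Proof. by rewrite -[X in x * X]madd0l mmulS mmul0 madd0l. Qed.

Lemma maddI x y z : x + z = y + z -> x = y.
Proof.
elim/ind0: z => [||z IH]; [by d0|by rewrite !madd0|].
by rewrite !maddS => /succ_inj.
Qed.

Lemma mcases x : x = 0 \/ exists y, x = y + 1.
Proof.
suff [y [->|->]] : exists y, x = 0 \/ x = y + 1 by [left|right; exists y].
elim/induct: x => [||x _]; first by apply: S1_exD0; d0.
  by exists 0; left.
by exists x; right.
Qed.

Lemma mltE x y : x < y <-> exists z, y = x + (z + 1).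
Proof.
split.
- elim/induct: y => [||y IH].
  (* The existential quantifier is pulled in front of the implication, with 0 as witness where the
     premise fails, because closure of Sigma_1 under implication comes only later. *)
  + suff H : S1 1 (fun v => exists z : N, x < v 0%N -> v 0%N = x + (z + 1)).
      apply: S1_ext H _ => v.
      split=> [[z Hz] /Hz|H]; first by exists z.
      by case: (pselect (x < v 0%N)) => [/H [z]|?]; [exists z|exists 0].
    by apply: S1_exD0; d0.
  + by move/mlt0.
  + move/mltS => [/IH [z ->]|->]; first by exists (z + 1); rewrite !maddA.
    by exists 0; rewrite madd0l.
- move=> [z ->]; elim/ind0: z => [||z IH]; first by d0.
    by rewrite madd0l; apply/mltS; right.
  by rewrite maddA; apply/mltS; left.
Qed.

Lemma mleE x y : x <= y <-> exists z, y = x + z.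
Proof.
suff H : forall x y, x <= y \/ y < x -> (exists z, y = x + z) \/ y < x.
  split=> [Hxy|[z ->] /mltE [z']].
    by case: (H x y (or_introl Hxy)).
  rewrite -maddA -[LHS]madd0 => E.
  have : 0 = z + (z' + 1) by apply: (@maddI _ _ x); rewrite !(maddC _ x).
  by rewrite maddA => /esym /succ_neq0.
move=> {}x {}y _.
suff : exists z, y = x + z \/ x = y + (z + 1).
  by move=> [z [H|H]]; [left; exists z|right; apply/mltE; exists z].
elim/induct: y => [||y [z [->|->]]]; first by apply: S1_exD0; d0.
- case: (mcases x) => [->|[z ->]]; [exists 0; left|exists z; right].
    by rewrite madd0.
  by rewrite madd0l.
- by exists (z + 1); left; rewrite maddA.
- case: (mcases z) => [->|[w ->]]; [exists 0; left|exists w; right].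
    by rewrite madd0 madd0l.
  by rewrite -[RHS]maddA [1 + _]maddC.
Qed.

Lemma mltNge x y : x < y <-> ~ y <= x. Proof. by rewrite /dle not_notP. Qed.

Lemma madd_eq0 x y : x + y = 0 -> x = 0.
Proof. by case: (mcases x) => // -[z ->]; rewrite maddC maddA => /succ_neq0. Qed.

Lemma mmul_eq0 x y : x * y = 0 -> x = 0 \/ y = 0.
Proof.
case: (mcases y) => [->|[z ->]]; first by right.
by rewrite mmulS maddC => /madd_eq0; left.
Qed.

End Arithmetic.
(** * The ordered field of rationals of a model *)

(** A copy of [dom M] to carry the algebraic instances. *)
Definition NM (M : rcaModel) : Type := dom M.

HB.instance Definition _ M := gen_eqMixin (NM M).
HB.instance Definition _ M := gen_choiceMixin (NM M).
HB.instance Definition _ M :=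
  @GRing.isNmodule.Build (NM M) (dzero M) (@dadd M) (@maddA M) (@maddC M) (@madd0l M).

Lemma NM_mul1l M : left_id (done_ M : NM M) (@dmul M : NM M -> NM M -> NM M).
Proof. by move=> x; rewrite mmulC mmul1. Qed.
Lemma NM_mulDl M : left_distributive (@dmul M : NM M -> NM M -> NM M) +%R.
Proof. by move=> x y z; rewrite /= mmulC mmulDr !(mmulC z). Qed.
Lemma NM_mul0l M : left_zero (0%R : NM M) (@dmul M : NM M -> NM M -> NM M).
Proof. exact: mmul0l. Qed.
HB.instance Definition _ M :=
  @GRing.Nmodule_isComPzSemiRing.Build (NM M) (done_ M) (@dmul M)
   (@mmulA M) (@mmulC M) (@NM_mul1l M) (@NM_mulDl M) (@NM_mul0l M).

Local Open Scope ring_scope.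

Section Rationals.
Variable M : rcaModel.
Local Notation N := (NM M).

Lemma N_addI (x y z : N) : x + z = y + z -> x = y. Proof. exact: maddI. Qed.
Lemma N_succ_neq0 (x : N) : x + 1 <> 0. Proof. exact: succ_neq0. Qed.
Lemma N_mul_eq0 (x y : N) : x * y = 0 -> x = 0 \/ y = 0. Proof. exact: mmul_eq0. Qed.
Lemma N_add_eq0 (x y : N) : x + y = 0 -> x = 0. Proof. exact: madd_eq0. Qed.
Lemma N_cases (x : N) : x = 0 \/ exists y, x = y + 1. Proof. exact: mcases. Qed.
Lemma N_total (x y : N) : (exists z, y = x + z) \/ (exists z, x = y + (z + 1)).
Proof.
case: (pselect (dle (x : M) y)) => [/mleE ?|/mltNge /mltE ?]; [by left|by right].
Qed.

Lemma N_mulI (x y z : N) : x * (z + 1) = y * (z + 1) -> x = y.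
Proof.
wlog [w ->] : x y / exists w, y = x + w.
  move=> H E; case: (N_total x y) => [Hw|[w Hw]]; first exact: H.
  by symmetry; apply: H => //; exists (w + 1).
move=> E; have : 0 = w * (z + 1).
  by apply: (@N_addI _ _ (x * (z + 1))); rewrite add0r [LHS]E; ring.
by move=> /esym /N_mul_eq0 [->|/N_succ_neq0 //]; rewrite addr0.
Qed.

(* The triple [(p, n, d)] stands for the fraction [(p - n) / (d + 1)]. *)
Definition trip : Type := (N * N * N)%type.
Implicit Types t u w : trip.

Definition qrel t u : Prop :=
  t.1.1 * (u.2 + 1) + u.1.2 * (t.2 + 1) = u.1.1 * (t.2 + 1) + t.1.2 * (u.2 + 1).

Lemma qrel_refl t : qrel t t. Proof. by []. Qed.
Lemma qrel_sym t u : qrel t u -> qrel u t.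
Proof. by rewrite /qrel => H; rewrite -H. Qed.
Lemma qrel_trans t u w : qrel t u -> qrel u w -> qrel t w.
Proof.
case: t u w => [[p n] d] [[q m] e] [[r l] f]; rewrite /qrel /= => H1 H2.
apply: (@N_mulI _ _ e); apply: (@N_addI _ _ ((q + m) * (d + 1) * (f + 1))).
transitivity ((p * (e + 1) + m * (d + 1)) * (f + 1) + (q * (f + 1) + l * (e + 1)) * (d + 1)).
  by ring.
by rewrite H1 H2; ring.
Qed.

(** A rational is the class of its triples, taken as a predicate; extensionality then gives a
    quotient with Leibniz equality. *)
Definition QT : Type := {C : trip -> Prop | exists t, C = qrel t}.
Definition qcl t : QT := exist _ (qrel t) (ex_intro _ t erefl).
Definition qrep (x : QT) : trip := projT1 (cid (svalP x)).

Lemma qcl_eq t u : qcl t = qcl u <-> qrel t u.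
Proof.
split=> [[E]|H].
  by rewrite E; exact: qrel_refl.
apply: eq_exist; apply: funext => w; apply: propext.
by split; apply: qrel_trans => //; exact: qrel_sym.
Qed.

Lemma qrepK (x : QT) : qcl (qrep x) = x.
Proof.
rewrite /qrep; case: cid => t /=; case: x => C HC /= E.
by apply: eq_exist.
Qed.

Lemma qW (P : QT -> Prop) : (forall p n d, P (qcl (p, n, d))) -> forall x, P x.
Proof. by move=> H x; rewrite -[x]qrepK; case: (qrep x) => [[p n] d]. Qed.

Lemma qrep_rel t : qrel (qrep (qcl t)) t.
Proof. by apply/qcl_eq; rewrite qrepK. Qed.

Definition tadd3 t u : trip :=
  (t.1.1 * (u.2 + 1) + u.1.1 * (t.2 + 1), t.1.2 * (u.2 + 1) + u.1.2 * (t.2 + 1),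
   t.2 * u.2 + t.2 + u.2).
Definition tmul3 t u : trip :=
  (t.1.1 * u.1.1 + t.1.2 * u.1.2, t.1.1 * u.1.2 + t.1.2 * u.1.1, t.2 * u.2 + t.2 + u.2).

Definition qadd (x y : QT) := qcl (tadd3 (qrep x) (qrep y)).
Definition qmul (x y : QT) := qcl (tmul3 (qrep x) (qrep y)).
Definition qopp (x : QT) := let t := qrep x in qcl (t.1.2, t.1.1, t.2).

Lemma qaddE t u : qadd (qcl t) (qcl u) = qcl (tadd3 t u).
Proof.
apply/qcl_eq; move: (qrep_rel t) (qrep_rel u).
move: (qrep (qcl t)) (qrep (qcl u)) => [[p n] d] [[q m] e].
case: t u => [[p' n'] d'] [[q' m'] e'].
rewrite /qrel /tadd3 /= => H1 H2.
transitivity ((e + 1) * (e' + 1) * (p * (d' + 1) + n' * (d + 1)) +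
              (d + 1) * (d' + 1) * (q * (e' + 1) + m' * (e + 1))); first by ring.
by rewrite H1 H2; ring.
Qed.

Lemma tmul3C t u : tmul3 t u = tmul3 u t.
Proof. by congr (_, _, _); ring. Qed.

Lemma qrel_mul t t' u : qrel t t' -> qrel (tmul3 t u) (tmul3 t' u).
Proof.
case: t t' u => [[p n] d] [[p' n'] d'] [[q m] e]; rewrite /qrel /tmul3 /= => H.
transitivity ((e + 1) * (q * (p * (d' + 1) + n' * (d + 1)) +
   m * (p' * (d + 1) + n * (d' + 1)))); first by ring.
by rewrite H -[in X in m * X]H; ring.
Qed.

Lemma qmulE t u : qmul (qcl t) (qcl u) = qcl (tmul3 t u).
Proof.
apply/qcl_eq; apply: qrel_trans (qrel_mul _ (qrep_rel t)) _.
rewrite tmul3C [tmul3 t u]tmul3C; exact: qrel_mul (qrep_rel u).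
Qed.

Lemma qoppE p n d : qopp (qcl (p, n, d)) = qcl (n, p, d).
Proof.
rewrite /qopp; apply/qcl_eq; have := qrep_rel (p, n, d).
case: (qrep _) => [[p' n'] d']; rewrite /qrel /= => H.
by rewrite addrC -H addrC.
Qed.

Definition qzero := qcl (0, 0, 0).
Definition qone := qcl (1, 0, 0).

HB.instance Definition _ := gen_eqMixin QT.
HB.instance Definition _ := gen_choiceMixin QT.

Lemma qaddA : associative qadd.
Proof.
elim/qW=> p n d; elim/qW=> q m e; elim/qW=> r l f; rewrite !qaddE; congr qcl.
by rewrite /tadd3 /=; congr (_, _, _); ring.
Qed.
Lemma qaddC : commutative qadd.
Proof.
elim/qW=> p n d; elim/qW=> q m e; rewrite !qaddE; congr qcl.
by rewrite /tadd3 /=; congr (_, _, _); ring.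
Qed.
Lemma qadd0 : left_id qzero qadd.
Proof.
elim/qW=> p n d; rewrite !qaddE; congr qcl.
by rewrite /tadd3 /=; congr (_, _, _); ring.
Qed.
Lemma qaddN : left_inverse qzero qopp qadd.
Proof.
elim/qW=> p n d; rewrite qoppE qaddE; apply/qcl_eq; rewrite /qrel /tadd3 /=; ring.
Qed.
HB.instance Definition _ := @GRing.isZmodule.Build QT qzero qopp qadd qaddA qaddC qadd0 qaddN.

Lemma qmulA : associative qmul.
Proof.
elim/qW=> p n d; elim/qW=> q m e; elim/qW=> r l f; rewrite !qmulE; congr qcl.
by rewrite /tmul3 /=; congr (_, _, _); ring.
Qed.
Lemma qmulC : commutative qmul.
Proof. by elim/qW=> p n d; elim/qW=> q m e; rewrite !qmulE tmul3C. Qed.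
Lemma qmul1 : left_id qone qmul.
Proof.
elim/qW=> p n d; rewrite !qmulE; congr qcl.
by rewrite /tmul3 /=; congr (_, _, _); ring.
Qed.
Lemma qmulDl : left_distributive qmul +%R.
Proof.
elim/qW=> p n d; elim/qW=> q m e; elim/qW=> r l f.
rewrite /GRing.add /= qaddE !qmulE qaddE; apply/qcl_eq.
by rewrite /qrel /tmul3 /tadd3 /=; ring.
Qed.
Lemma qone_neq0 : qone != 0.
Proof.
apply/eqP => /qcl_eq; rewrite /qrel /= !(mul0r, mulr1, addr0, add0r) => H.
by apply: (@N_succ_neq0 0); rewrite add0r.
Qed.
HB.instance Definition _ :=
  @GRing.Zmodule_isComNzRing.Build QT qone qmul qmulA qmulC qmul1 qmulDl qone_neq0.

Lemma qinv_ex (x : QT) : exists y : QT, x != 0 -> y * x = 1.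
Proof.
elim/qW: x => p n d; case: (N_total p n) => [[z ->]|[z ->]].
- case: (N_cases z) => [->|[w ->]].
    exists 0 => /eqP []; apply/qcl_eq; rewrite /qrel /=; ring.
  exists (qcl (0, d + 1, w)) => _; rewrite /GRing.mul /= qmulE; apply/qcl_eq.
  by rewrite /qrel /tmul3 /=; ring.
- exists (qcl (d + 1, 0, z)) => _; rewrite /GRing.mul /= qmulE; apply/qcl_eq.
  by rewrite /qrel /tmul3 /=; ring.
Qed.

Definition qinv (x : QT) : QT :=
  if x == 0 then 0 else projT1 (cid (qinv_ex x)).
Lemma qmulV x : x != 0 -> qinv x * x = 1.
Proof. by rewrite /qinv => H; case: cid => y /= Hy; rewrite (negbTE H) Hy. Qed.
Lemma qinv0 : qinv 0 = 0. Proof. by rewrite /qinv; case: cid => y /= _; rewrite eqxx. Qed.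
HB.instance Definition _ := @GRing.ComNzRing_isField.Build QT qinv qmulV qinv0.

Definition qnn (x : QT) : Prop := exists p d, x = qcl (p, 0, d).
Definition qle (x y : QT) : bool := `[< qnn (y - x) >].
Definition qlt (x y : QT) : bool := (y != x) && qle x y.
Definition qnorm (x : QT) : QT := if qle 0 x then x else - x.

Lemma qle0 x : qle 0 x = `[< qnn x >]. Proof. by rewrite /qle subr0. Qed.
Lemma qle0_add x y : qle 0 x -> qle 0 y -> qle 0 (x + y).
Proof.
rewrite !qle0 => /asboolP [p [d ->]] /asboolP [q [e ->]]; apply/asboolP.
rewrite /GRing.add /= qaddE /tadd3 /= !mul0r addr0.
by exists (p * (e + 1) + q * (d + 1)), (d * e + d + e).
Qed.
Lemma qle0_mul x y : qle 0 x -> qle 0 y -> qle 0 (x * y).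
Proof.
rewrite !qle0 => /asboolP [p [d ->]] /asboolP [q [e ->]]; apply/asboolP.
rewrite /GRing.mul /= qmulE /tmul3 /= !(mul0r, mulr0, addr0).
by exists (p * q), (d * e + d + e).
Qed.
Lemma qle0_anti x : qle 0 x -> qle x 0 -> x = 0.
Proof.
rewrite qle0 /qle sub0r => /asboolP [p [d ->]] /asboolP [q [e]].
rewrite /GRing.opp /= qoppE => /qcl_eq; rewrite /qrel /= !mul0r addr0.
rewrite addrC => /esym /N_add_eq0 /N_mul_eq0 [->|/N_succ_neq0 //].
by apply/qcl_eq; rewrite /qrel /=; ring.
Qed.
Lemma qsub_ge0 x y : qle 0 (y - x) = qle x y. Proof. by rewrite /qle subr0. Qed.
Lemma qle0_total x : qle 0 x || qle x 0.
Proof.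
rewrite /qle subr0 sub0r; elim/qW: x => p n d.
case: (N_total p n) => [[z ->]|[z ->]]; apply/orP; [right|left]; apply/asboolP.
- by rewrite /GRing.opp /= qoppE; exists z, d; apply/qcl_eq; rewrite /qrel /=; ring.
- by exists (z + 1), d; apply/qcl_eq; rewrite /qrel /=; ring.
Qed.
Lemma qnorm_opp x : qnorm (- x) = qnorm x.
Proof.
have E : qle 0 (- x) = qle x 0 by rewrite /qle subr0 sub0r.
rewrite /qnorm E opprK; case H1: (qle 0 x); case H2: (qle x 0) => //.
- by rewrite (qle0_anti H1 H2) oppr0.
- by have := qle0_total x; rewrite H1 H2.
Qed.
Lemma qnorm_ge0 x : qle 0 x -> qnorm x = x. Proof. by rewrite /qnorm => ->. Qed.
Lemma qlt_def x y : qlt x y = (y != x) && qle x y. Proof. by []. Qed.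
HB.instance Definition _ := @Num.IntegralDomain_isLeReal.Build QT qle qlt qnorm
  qle0_add qle0_mul qle0_anti qsub_ge0 qle0_total qnorm_opp qnorm_ge0 qlt_def.

Definition iT (n : M) : QT := qcl ((n : N), 0, 0).

Lemma iT_D (x y : M) : iT (x + y)%M = iT x + iT y.
Proof.
rewrite (_ : iT x + iT y = qadd (iT x) (iT y)) // qaddE.
by apply/qcl_eq; rewrite /qrel /tadd3 /= !(mul0r, addr0, add0r, mulr1).
Qed.
Lemma iT_M (x y : M) : iT (x * y)%M = iT x * iT y.
Proof.
rewrite (_ : iT x * iT y = qmul (iT x) (iT y)) // qmulE.
by apply/qcl_eq; rewrite /qrel /tmul3 /= -[(x * y)%M]/((x : N) * (y : N)); ring.
Qed.
Lemma iT_ge0 (x : M) : 0 <= iT x.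
Proof. by rewrite /Order.le /= qle0; apply/asboolP; exists x, 0. Qed.
Lemma iT_inj : injective iT.
Proof. by move=> x y /qcl_eq; rewrite /qrel /= !(add0r, mulr1, mul0r, addr0). Qed.

Lemma iT_succ_neq0 (x : M) : iT x + 1 != 0.
Proof. by apply: lt0r_neq0; have := iT_ge0 x; lra. Qed.

Lemma iT_surj (x : QT) : exists p n d : M, x = (iT p - iT n) / (iT d + 1).
Proof.
elim/qW: x => p n d; exists p, n, d.
apply: (mulIf (iT_succ_neq0 d)); rewrite divfK ?iT_succ_neq0 //.
rewrite -[1 in LHS]/(iT 1%M) -iT_D.
rewrite /iT {1}/GRing.opp /= qoppE /GRing.add /= qaddE /GRing.mul /= qmulE.
by apply/qcl_eq; rewrite /qrel /tadd3 /tmul3 /= -[dadd _ (done_ M)]/((d : N) + 1); ring.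
Qed.

(* The field is sealed, so that only these properties are available and unifying
   rationals never unfolds the quotient. *)
Lemma rationals_ex : exists (R : realFieldType) (i : M -> R),
  ((i 0%M = 0 /\ i 1%M = 1) /\ ((forall x y, i (x + y)%M = i x + i y) /\
   (forall x y, i (x * y)%M = i x * i y))) /\
  (((forall x, 0 <= i x) /\ injective i) /\
   forall x, exists p n d : M, x = (i p - i n) / (i d + 1)).
Proof.
by exists QT, iT; do !split; [exact: iT_D|exact: iT_M|exact: iT_ge0|exact: iT_inj|exact: iT_surj].
Qed.

Definition QM : realFieldType := projT1 (cid rationals_ex).
Definition iN : M -> QM := projT1 (cid (projT2 (cid rationals_ex))).
Lemma iNP : ((iN 0%M = 0 /\ iN 1%M = 1) /\ ((forall x y, iN (x + y)%M = iN x + iN y) /\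
   (forall x y, iN (x * y)%M = iN x * iN y))) /\
  (((forall x, 0 <= iN x) /\ injective iN) /\
   forall x, exists p n d : M, x = (iN p - iN n) / (iN d + 1)).
Proof. exact: (projT2 (cid (projT2 (cid rationals_ex)))). Qed.

Lemma iN0 : iN 0%M = 0. Proof. by case: iNP => -[[]]. Qed.
Lemma iN1 : iN 1%M = 1. Proof. by case: iNP => -[[]]. Qed.
Lemma iND (x y : M) : iN (x + y)%M = iN x + iN y. Proof. by case: iNP => -[_ []]. Qed.
Lemma iNM (x y : M) : iN (x * y)%M = iN x * iN y. Proof. by case: iNP => -[_ []]. Qed.
Lemma iN_ge0 (x : M) : 0 <= iN x. Proof. by case: iNP => _ [[]]. Qed.
Lemma iN_inj : injective iN. Proof. by case: iNP => _ [[]]. Qed.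

Lemma iN_lt (x y : M) : (x < y)%M <-> iN x < iN y.
Proof.
split=> [/mltE [z ->]|]; first by rewrite !iND iN1; have := iN_ge0 z; lra.
move=> H; apply: contrapT => /mleE [z E]; move: H.
by rewrite E iND; have := iN_ge0 z; lra.
Qed.
Lemma iN_le (x y : M) : (x <= y)%M <-> iN x <= iN y.
Proof. by rewrite /dle iN_lt leNgt; split=> /negP. Qed.
Lemma iN_lt1 (x y : M) : iN x < iN y -> iN x + 1 <= iN y.
Proof. by move=> /iN_lt /mltE [z ->]; rewrite !iND iN1; have := iN_ge0 z; lra. Qed.

Definition qv (a : mrat M) : QM := (iN (mpos a) - iN (mneg a)) / (iN (mden a) + 1).

Lemma qv_surj (x : QM) : exists a, x = qv a.
Proof. by have [p [n [d ->]]] := iNP.2.2 x; exists (MRat p n d). Qed.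

End Rationals.
(** * Calculus of Sigma_1 and Delta_1 definitions *)

Section OrderN.
Variable M : rcaModel.
Local Notation N := (dom M).
Implicit Types x y z : N.

Lemma iN_ltS x y : (x < y)%M <-> iN x + 1 <= iN y.
Proof. by rewrite iN_lt; split=> [/iN_lt1 //|]; lra. Qed.

Lemma iN_eq x y : x = y <-> iN x = iN y.
Proof. by split=> [->|/iN_inj]. Qed.

End OrderN.

Ltac npos :=
  repeat match goal with
  | |- context [iN ?x] =>
      lazymatch goal with
      | H : is_true (Order.le 0%R (iN x)) |- _ => fail
      | |- _ => pose proof (iN_ge0 x)
      end
  | H : context [iN ?x] |- _ =>
      lazymatch goal with
      | H' : is_true (Order.le 0%R (iN x)) |- _ => fail
      | |- _ => pose proof (iN_ge0 x)
      end
  end.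
Ltac nhyps :=
  repeat match goal with
  | H : dlt ?x ?y |- _ => apply (proj1 (iN_ltS _ _)) in H; revert H
  | H : dle ?x ?y |- _ => apply (proj1 (iN_le _ _)) in H; revert H
  | H : ~ dlt ?x ?y |- _ => change (dle y x) in H
  | H : @eq (dom _) ?x ?y |- _ => apply (proj1 (iN_eq _ _)) in H; revert H
  | H : is_true (Order.le _ _) |- _ => revert H
  | H : is_true (Order.lt _ _) |- _ => revert H
  end;
  rewrite ?(iND, iNM, iN0, iN1); intros.
Ltac ngoal :=
  match goal with
  | |- dlt _ _ => apply (proj2 (iN_ltS _ _))
  | |- dle _ _ => apply (proj2 (iN_le _ _))
  | |- ~ dlt _ _ => apply (proj2 (iN_le _ _))
  | |- @eq (dom _) _ _ => apply (proj2 (iN_eq _ _))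
  | |- _ => idtac
  end.
(* Linear, resp. nonlinear, arithmetic over the numbers of a model, by transfer
   to its rationals. *)
Ltac nlra := ngoal; nhyps; npos; lra.
Ltac nnra := ngoal; nhyps; npos; nra.

Section Calculus.
Variable M : rcaModel.
Local Notation N := (dom M).
Implicit Types x y z a b c n m : N.
Local Open Scope M_scope.
Local Notation env := (nat -> N).
Implicit Types (P Q : env -> Prop) (f g : env -> N) (A : N -> Prop).

Lemma nle_refl x : x <= x. Proof. by nlra. Qed.
Lemma nle_trans x y z : x <= y -> y <= z -> x <= z. Proof. by move=> *; nlra. Qed.
Lemma nle_ltS x y : x <= y -> x < y + 1. Proof. by move=> *; nlra. Qed.
Lemma nle_self_addr x y : x <= x + y. Proof. by nlra. Qed.
Lemma le_lt x y : x <= y \/ y < x. Proof. by case: (pselect (y < x)) => H; [right|left]. Qed.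
Lemma lt_eq_gt x y : x < y \/ x = y \/ y < x.
Proof.
case: (le_lt x y) => H; last by right; right.
case: (le_lt y x) => H'; last by left.
by right; left; apply/iN_eq; nlra.
Qed.

(** Bounding the witness by [c] instead of naming it makes the matrix monotone in [c], so that
    several witnesses can be merged into one bound. *)
Lemma S1_mono k P : S1 k P -> exists R : N -> env -> Prop,
  [/\ D0 k.+1 (fun v => R (v 0%N) (tl v)),
      (forall c c' v, c <= c' -> R c v -> R c' v) & forall v, P v <-> exists c, R c v].
Proof.
move=> [Q [HQ HP]]; exists (fun c v => exists a, a < c /\ Q (scons a v)); split.
- apply: (@D0_bex _ _ _ (fun a v => Q (scons a (tl v)))); first exact: T0_var.
  have := @D0_ren M k.+1 k.+2 (fun i => if i is j.+1 then j.+2 else 0%N) Q.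
  move=> H; apply: D0_ext (H _ HQ) _; first by case.
  by move=> v; rewrite (_ : (fun i => v _) = scons (v 0%N) (tl (tl v))) //; apply: funext => -[].
- by move=> c c' v Hc [a [Ha Ha']]; exists a; split=> //; nlra.
- move=> v; rewrite HP; split=> [[a Ha]|[c [a [_ Ha]]]]; last by exists a.
  by exists (a + 1), a; split=> //; nlra.
Qed.

Lemma S1_intro k (R : N -> env -> Prop) : D0 k.+1 (fun v => R (v 0%N) (tl v)) ->
  S1 k (fun v => exists c, R c v).
Proof. exact: S1_exD0. Qed.

Lemma S1_and k P Q : S1 k P -> S1 k Q -> S1 k (fun v => P v /\ Q v).
Proof.
move=> /S1_mono [R [HR mR HP]] /S1_mono [R' [HR' mR' HQ]].
apply: S1_ext (S1_intro (R := fun c v => R c v /\ R' c v) (D0_and HR HR')) _ => v.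
rewrite HP HQ; split=> [[c [H H']]|[[c H] [c' H']]]; first by split; exists c.
by exists (c + c'); split; [apply: mR H|apply: mR' H']; nlra.
Qed.

Lemma S1_or k P Q : S1 k P -> S1 k Q -> S1 k (fun v => P v \/ Q v).
Proof.
move=> /S1_mono [R [HR mR HP]] /S1_mono [R' [HR' mR' HQ]].
apply: S1_ext (S1_intro (R := fun c v => R c v \/ R' c v) (D0_or HR HR')) _ => v.
rewrite HP HQ; split=> [[c [H|H]]|[[c H]|[c H]]];
  by [left; exists c|right; exists c|exists c; left|exists c; right].
Qed.

Lemma D0_swap k (R : N -> N -> env -> Prop) :
  D0 k.+2 (fun v => R (v 0%N) (v 1%N) (tl (tl v))) ->
  D0 k.+2 (fun v => R (v 1%N) (v 0%N) (tl (tl v))).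
Proof.
move=> H; have := @D0_ren M _ k.+2 (fun i => match i with 0 => 1 | 1 => 0 | _ => i end)%N _ _ H.
by apply; case=> [|[]].
Qed.

Lemma S1_ex k (P : N -> env -> Prop) :
  S1 k.+1 (fun v => P (v 0%N) (tl v)) -> S1 k (fun v => exists a, P a v).
Proof.
move=> /S1_mono [R [HR mR HP]].
have HP' a v : P a v <-> exists c, R c (scons a v) by rewrite -HP.
apply: S1_ext (S1_intro (R := fun c v => exists a, a < c /\ R c (scons a v)) _) _.
- apply: (@D0_bex _ _ _ (fun a v => R (v 0%N) (scons a (tl v)))); first exact: T0_var.
  apply: (@D0_swap _ (fun c a v => R c (scons a v))).
  apply: D0_ext HR _ => v.
  by rewrite (_ : scons (v 1%N) _ = tl v) //; apply: funext => -[].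
- move=> v; split=> [[c [a [_ H]]]|[a /HP' [c H]]]; first by exists a; apply/HP'; exists c.
  by exists (a + c + 1), a; split; [nlra|apply: mR H; nlra].
Qed.

(** With a bounded matrix, the claim for the first [n] values is again Sigma_1, so Sigma_1 induction
    yields the bounding principle. *)
Lemma collection b (R : N -> N -> Prop) :
  D0 2 (fun v => R (v 0%N) (v 1%N)) -> (forall c c' x, c <= c' -> R c x -> R c' x) ->
  (forall x, x < b -> exists c, R c x) -> exists c, forall x, x < b -> R c x.
Proof.
move=> HR mR H.
suff K n : exists c, forall x, x < n -> x < b -> R c x.
  by have [c Hc] := K b; exists c => x Hx; exact: Hc.
elim/induct: n => [||n [c Hc]].
- apply: S1_intro.
  apply: (@D0_ball _ _ _ (fun x v => x < b -> R (v 0%N) x)); first exact: T0_var.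
  apply: D0_imp; first by d0.
  have := @D0_ren M _ 3 (fun i => match i with 0 => 1 | _ => 0 end)%N _ _ HR.
  by apply; case=> [|[]].
- by exists 0 => x H'; exfalso; nlra.
- case: (pselect (n < b)) => [Hn|Hn].
  + have [c' Hc'] := H n Hn; exists (c + c') => x /mltS [Hx|->] Hxb.
      by apply: mR (Hc x Hx Hxb); nlra.
    by apply: mR Hc'; nlra.
  + by exists c => x /mltS [Hx|-> //] Hxb; exact: Hc.
Qed.

(** Collection turns a witness for each [a] into one bound for all of them, after which the bounded
    quantifier is absorbed by the matrix. *)
Lemma S1_ballT k f (P : N -> env -> Prop) : T0 k f ->
  S1 k.+1 (fun v => P (v 0%N) (tl v)) -> S1 k (fun v => forall a, a < f v -> P a v).
Proof.
move=> Hf /S1_mono [R [HR mR HP]].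
have HP' a v : P a v <-> exists c, R c (scons a v) by rewrite -HP.
apply: S1_ext (S1_intro (R := fun c v => forall a, a < f v -> R c (scons a v)) _) _.
- apply: (@D0_ball _ _ (fun v => f (tl v)) (fun a v => R (v 0%N) (scons a (tl v)))).
    exact: (@T0_ren M k k.+1 S f (fun i Hi => Hi) Hf).
  apply: (@D0_swap _ (fun c a v => R c (scons a v))).
  apply: D0_ext HR _ => v.
  by rewrite (_ : scons (v 1%N) _ = tl v) //; apply: funext => -[].
- move=> v; split=> [[c H] a Ha|H]; first by apply/HP'; exists c; exact: H.
  apply: (@collection (f v) (fun c a => R c (scons a v))).
  + have [p [Hp Ep]] := HR.
    (* the parameters [v] become constants *)
    have Hs : forall j w, (j <= k)%N -> D0 (2 + j) (fun u => R (u 0%N) (scons (u 1%N)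
        (fun i => if (i < j)%N then u i.+2 else w i))).
      move=> j w Hj; have : exists d, (d + j = k)%N by exists (k - j)%N; lia.
      case=> d; elim: d j {Hj} => [|d IH] j Ej.
        have HR' : D0 (2 + j) (fun v => R (v 0%N) (tl v)).
          by rewrite (_ : (2 + j)%N = k.+2) //; lia.
        apply: D0_ext HR' _ => u.
        pose g i := if (i < j)%N then u i.+2 else w i.
        have E2 : R (u 0%N) (scons (u 1%N) g) <->
            sat M (mix k.+2 (scons (u 0%N) (scons (u 1%N) g))) (rset0 M) p.
          exact: (Ep (scons (u 0%N) (scons (u 1%N) g))).
        rewrite -/g E2 Ep (_ : mix _ _ = mix k.+2 u) //.
        apply: funext => -[|[|i]] //=; rewrite /mix !ltnS /g.
        have -> : k = j by lia.
        by case E: (i < j)%N => //=; rewrite E.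
      have := IH j.+1 ltac:(lia); have [t Ht] := T0_const (2 + j) (w j).
      move=> [q [Hq Eq]].
      exists (fsubst (fun i => if (i < 2 + j)%N then tvar i else
        if i == (2 + j)%N then t else tvar i.-1) (fun X => X) q).
      split=> [|u]; first exact: Delta00_subst.
      rewrite sat_subst.
      rewrite (_ : (fun i => eval _ _ _) = mix (2 + j.+1) (fun i =>
         if (i < 2 + j)%N then u i else w j)).
        rewrite -Eq /= (_ : (fun i => if (i < j)%N then _ else _) =
          (fun i => if (i < j.+1)%N then (if (i.+2 < 2 + j)%N then u i.+2 else w j) else w i)) //.
        apply: funext => i; rewrite !ltnS.
        by case: (ltngtP i j) => // ->.
      apply: funext => i; rewrite /mix addnS ltnS.
      case: (ltngtP i (2 + j)%N) => Hi /=.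
      * by rewrite /mix Hi.
      * rewrite /mix; have -> : (i.-1 < 2 + j)%N = false by lia.
        by congr (renv0 _ _); lia.
      * by rewrite -(Ht u).
    exact: (Hs 0%N v).
  + by move=> c c' a; exact: mR.
  + by move=> a /H /HP'.
Qed.

Lemma S1_ren k k' r P : (forall i, (i < k)%N -> (r i < k')%N) ->
  S1 k P -> S1 k' (fun v => P (fun i => v (r i))).
Proof.
move=> Hr [Q [HQ HP]].
apply: S1_ext (S1_intro (R := fun c v => Q (scons c (fun i => v (r i)))) _) _ => [|v].
- have := @D0_ren M k.+1 k'.+1 (fun i => if i is j.+1 then (r j).+1 else 0%N) Q.
  move=> H; apply: D0_ext (H _ HQ) _; first by case=> // i; exact: Hr.
  move=> v; rewrite (_ : (fun i => v _) = scons (v 0%N) (fun i => v (r i).+1)) //.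
  by apply: funext => -[].
- by rewrite HP.
Qed.

Definition D1 k (P : env -> Prop) := S1 k P /\ S1 k (fun v => ~ P v).
(** For a total function a Sigma_1 graph is already Delta_1, so nothing more is asked. *)
Definition RF k (f : env -> N) := S1 k.+1 (fun v => v 0%N = f (tl v)).

Lemma D1_D0 k P : D0 k P -> D1 k P.
Proof. by move=> H; split; apply: S1_D0 => //; exact: D0_not. Qed.

Lemma D1_S1 k P : D1 k P -> S1 k P. Proof. by case. Qed.

Lemma D1_ext k P Q : D1 k P -> (forall v, P v <-> Q v) -> D1 k Q.
Proof.
move=> [H1 H2] E; split; first by apply: S1_ext H1 _.
by apply: S1_ext H2 _ => v; rewrite E.
Qed.

Lemma D1_ren k k' r P : (forall i, (i < k)%N -> (r i < k')%N) ->
  D1 k P -> D1 k' (fun v => P (fun i => v (r i))).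
Proof.
by move=> Hr [H1 H2]; split; [exact: S1_ren H1|exact: (S1_ren Hr H2)].
Qed.

Lemma RF_T0 k f : T0 k f -> RF k f.
Proof.
move=> Hf; apply: S1_D0; apply: D0_eq; first exact: T0_var.
exact: (@T0_ren M k k.+1 S f (fun i Hi => Hi) Hf).
Qed.

Lemma RF_tl k f : RF k f -> RF k.+1 (fun v => f (tl v)).
Proof.
move=> Hf; apply: (@S1_ren k.+1 k.+2 (fun i => if i is j.+1 then j.+2 else 0%N) _ _ Hf).
by case.
Qed.

Lemma S1_subst k f (P : N -> env -> Prop) : RF k f ->
  S1 k.+1 (fun v => P (v 0%N) (tl v)) -> S1 k (fun v => P (f v) v).
Proof.
move=> Hf HP; apply: S1_ext (S1_ex (P := fun y v => y = f v /\ P y v) _) _.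
- exact: S1_and.
- by move=> v; split=> [[y [-> //]]|H]; exists (f v).
Qed.

Lemma D1_subst k f (P : N -> env -> Prop) : RF k f ->
  D1 k.+1 (fun v => P (v 0%N) (tl v)) -> D1 k (fun v => P (f v) v).
Proof.
move=> Hf [H1 H2]; split; first exact: S1_subst.
exact: (@S1_subst _ _ (fun y v => ~ P y v)).
Qed.

Lemma D1_eq k f g : RF k f -> RF k g -> D1 k (fun v => f v = g v).
Proof.
move=> Hf Hg; apply: (D1_subst (P := fun y v => y = g v) Hf).
apply: (D1_subst (P := fun z v => v 0%N = z) (RF_tl Hg)).
by apply: D1_D0; d0.
Qed.

Lemma D1_lt k f g : RF k f -> RF k g -> D1 k (fun v => f v < g v).
Proof.
move=> Hf Hg; apply: (D1_subst (P := fun y v => y < g v) Hf).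
apply: (D1_subst (P := fun z v => v 0%N < z) (RF_tl Hg)).
by apply: D1_D0; d0.
Qed.

Lemma D1_mem k f A : dset M A -> RF k f -> D1 k (fun v => A (f v)).
Proof.
move=> HA Hf; apply: (D1_subst (P := fun y v => A y) Hf).
by apply: D1_D0; apply: D0_mem => //; exact: T0_var.
Qed.

Lemma D1_not k P : D1 k P -> D1 k (fun v => ~ P v).
Proof. by move=> [H1 H2]; split=> //; apply: S1_ext H1 _ => v; rewrite not_notP. Qed.

Lemma D1_and k P Q : D1 k P -> D1 k Q -> D1 k (fun v => P v /\ Q v).
Proof.
move=> [H1 H2] [H1' H2']; split; first exact: S1_and.
by apply: S1_ext (S1_or H2 H2') _ => v; rewrite not_andP.
Qed.

Lemma D1_or k P Q : D1 k P -> D1 k Q -> D1 k (fun v => P v \/ Q v).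
Proof.
move=> [H1 H2] [H1' H2']; split; first exact: S1_or.
by apply: S1_ext (S1_and H2 H2') _ => v; rewrite not_orP.
Qed.

Lemma S1_imp k P Q : D1 k P -> S1 k Q -> S1 k (fun v => P v -> Q v).
Proof.
move=> [_ H] H'; apply: S1_ext (S1_or H H') _ => v.
by case: (pselect (P v)); tauto.
Qed.

Lemma D1_imp k P Q : D1 k P -> D1 k Q -> D1 k (fun v => P v -> Q v).
Proof.
move=> H [H1 H2]; split; first exact: S1_imp.
apply: S1_ext (S1_and (D1_S1 H) H2) _ => v.
by case: (pselect (P v)); tauto.
Qed.

Lemma D1_iff k P Q : D1 k P -> D1 k Q -> D1 k (fun v => P v <-> Q v).
Proof. by move=> H H'; apply: D1_and; exact: D1_imp. Qed.

Lemma S1_ball k f (P : N -> env -> Prop) : RF k f ->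
  S1 k.+1 (fun v => P (v 0%N) (tl v)) -> S1 k (fun v => forall a, a < f v -> P a v).
Proof.
move=> Hf HP; apply: (S1_subst (P := fun y v => forall a, a < y -> P a v) Hf).
apply: (S1_ballT (P := fun a v => P a (tl v))); first exact: T0_var.
apply: (@S1_ren k.+1 k.+2 (fun i => if i is j.+1 then j.+2 else 0%N) _ _ HP).
by case.
Qed.

Lemma S1_bex k f (P : N -> env -> Prop) : RF k f ->
  S1 k.+1 (fun v => P (v 0%N) (tl v)) -> S1 k (fun v => exists a, a < f v /\ P a v).
Proof.
move=> Hf HP; apply: (S1_ex (P := fun a v => a < f v /\ P a v)).
apply: S1_and => //; apply: D1_S1; apply: D1_lt; last exact: RF_tl.
by apply: RF_T0; exact: T0_var.
Qed.

Lemma D1_ball k f (P : N -> env -> Prop) : RF k f ->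
  D1 k.+1 (fun v => P (v 0%N) (tl v)) -> D1 k (fun v => forall a, a < f v -> P a v).
Proof.
move=> Hf [H1 H2]; split; first exact: S1_ball.
apply: S1_ext (S1_bex (P := fun a v => ~ P a v) Hf H2) _ => v.
split=> [[a [Ha Ha']] H|H]; first exact/Ha'/H.
apply: contrapT => H'; apply: H => a Ha; apply: contrapT => Ha'; apply: H'.
by exists a.
Qed.

Lemma D1_bex k f (P : N -> env -> Prop) : RF k f ->
  D1 k.+1 (fun v => P (v 0%N) (tl v)) -> D1 k (fun v => exists a, a < f v /\ P a v).
Proof.
move=> Hf [H1 H2]; split; first exact: S1_bex.
apply: S1_ext (S1_ball (P := fun a v => ~ P a v) Hf H2) _ => v.
split=> [H [a [Ha Ha']]|H a Ha Ha']; first exact: (H a).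
by apply: H; exists a.
Qed.

Lemma RF_var k i : (i < k)%N -> RF k (fun v => v i).
Proof. by move=> H; apply: RF_T0; exact: T0_var. Qed.
Lemma RF_const k c : RF k (fun _ => c).
Proof. by apply: RF_T0; exact: T0_const. Qed.

Lemma RF_sub k f (g : N -> env -> N) : RF k f -> RF k.+1 (fun v => g (v 0%N) (tl v)) ->
  RF k (fun v => g (f v) v).
Proof.
move=> Hf Hg.
apply: (S1_subst (P := fun y v => v 0%N = g y (tl v)) (RF_tl Hf)).
have := @S1_ren k.+2 k.+2 (fun i => match i with 0 => 1 | 1 => 0 | _ => i end)%N _ _ Hg.
by apply; case=> [|[]].
Qed.

Lemma RF_add k f g : RF k f -> RF k g -> RF k (fun v => f v + g v).
Proof.
move=> Hf Hg; apply: (RF_sub (g := fun y v => y + g v) Hf).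
apply: (RF_sub (g := fun z v => v 0%N + z) (RF_tl Hg)).
by apply: RF_T0; d0.
Qed.

Lemma RF_mul k f g : RF k f -> RF k g -> RF k (fun v => f v * g v).
Proof.
move=> Hf Hg; apply: (RF_sub (g := fun y v => y * g v) Hf).
apply: (RF_sub (g := fun z v => v 0%N * z) (RF_tl Hg)).
by apply: RF_T0; d0.
Qed.

Lemma RF_pair k f g : RF k f -> RF k g -> RF k (fun v => pairM (f v) (g v)).
Proof. by move=> Hf Hg; do !(apply: RF_add || apply: RF_mul). Qed.

Lemma RF_comp1 k (g : N -> N) f : RF 1 (fun v => g (v 0%N)) -> RF k f ->
  RF k (fun v => g (f v)).
Proof.
move=> Hg Hf; apply: (RF_sub (g := fun y v => g y) Hf).
apply: (@S1_ren 2 k.+2 (fun i => if i is 0 then 0 else 1)%N _ _ Hg).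
by case.
Qed.

Lemma RF_comp2 k (g : N -> N -> N) f f' : RF 2 (fun v => g (v 0%N) (v 1%N)) ->
  RF k f -> RF k f' -> RF k (fun v => g (f v) (f' v)).
Proof.
move=> Hg Hf Hf'; apply: (RF_sub (g := fun y v => g y (f' v)) Hf).
apply: (RF_sub (g := fun z v => g (v 0%N) z) (RF_tl Hf')).
apply: (@S1_ren 3 k.+3 (fun i => match i with 0 => 0 | 1 => 2 | _ => 1 end)%N _ _ Hg).
by case=> [|[]].
Qed.

Lemma RF_comp3 k (g : N -> N -> N -> N) f f' f'' :
  RF 3 (fun v => g (v 0%N) (v 1%N) (v 2%N)) ->
  RF k f -> RF k f' -> RF k f'' -> RF k (fun v => g (f v) (f' v) (f'' v)).
Proof.
move=> Hg Hf Hf' Hf''; apply: (RF_sub (g := fun y v => g y (f' v) (f'' v)) Hf).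
apply: (RF_sub (g := fun z v => g (v 0%N) z (f'' (tl v))) (RF_tl Hf')).
apply: (RF_sub (g := fun z v => g (v 1%N) (v 0%N) z) (RF_tl (RF_tl Hf''))).
apply: (@S1_ren 4 k.+4 (fun i => match i with 0 => 0 | 1 => 3 | 2 => 2 | _ => 1 end)%N _ _ Hg).
by case=> [|[|[]]].
Qed.

Lemma RF_if k P f g : D1 k P -> RF k f -> RF k g ->
  RF k (fun v => if pselect (P v) then f v else g v).
Proof.
move=> [H1 H2] Hf Hg.
have K := @S1_ren k k.+1 S _ (fun i Hi => Hi).
apply: S1_ext (S1_or (S1_and (K _ H1) Hf) (S1_and (K _ H2) Hg)) _ => v /=.
by case: pselect => /= H; tauto.
Qed.

Lemma comp1D1 k (P : N -> Prop) f : D1 1 (fun v => P (v 0%N)) -> RF k f ->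
  D1 k (fun v => P (f v)).
Proof.
move=> H Hf; apply: (D1_subst (P := fun y v => P y) Hf).
by apply: (@D1_ren 1 k.+1 id _ _ H); case.
Qed.

Lemma setD1 (P : N -> Prop) : D1 1 (fun v => P (v 0%N)) -> dset M P.
Proof. by case; exact: comprehend. Qed.

End Calculus.

Arguments nle_refl {M} x.
Arguments nle_self_addr {M} x y.
Create HintDb defdb.

Section CalculusMore.
Variable M : rcaModel.
Local Notation N := (dom M).
Local Notation env := (nat -> N).
Implicit Types (f g : env -> N).

Lemma comp2D1 k (P : N -> N -> Prop) f g : D1 2 (fun v => P (v 0%N) (v 1%N)) ->
  RF k f -> RF k g -> D1 k (fun v => P (f v) (g v)).
Proof.
move=> H Hf Hg; apply: (D1_subst (P := fun y v => P y (g v)) Hf).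
apply: (D1_subst (P := fun z v => P (v 0%N) z) (RF_tl Hg)).
apply: (@D1_ren M 2 k.+2 (fun i => if i is 0 then 1 else 0)%N _ _ H).
by case=> [|[]].
Qed.

Lemma comp3D1 k (P : N -> N -> N -> Prop) f g h : D1 3 (fun v => P (v 0%N) (v 1%N) (v 2%N)) ->
  RF k f -> RF k g -> RF k h -> D1 k (fun v => P (f v) (g v) (h v)).
Proof.
move=> H Hf Hg Hh; apply: (D1_subst (P := fun y v => P y (g v) (h v)) Hf).
apply: (D1_subst (P := fun z v => P (v 0%N) z (h (tl v))) (RF_tl Hg)).
apply: (D1_subst (P := fun z v => P (v 1%N) (v 0%N) z) (RF_tl (RF_tl Hh))).
apply: (@D1_ren M 3 k.+3 (fun i : nat => match i with 0 => 2 | 1 => 1 | _ => 0 end)%N _ _ H).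
by case=> [|[|[]]].
Qed.

End CalculusMore.

Ltac def :=
  cbv beta;
  lazymatch goal with
  | |- S1 _ (fun v => exists a, dlt a _ /\ _) => apply: S1_bex; def
  | |- S1 _ (fun v => exists a, _) => apply: S1_ex; def
  | |- S1 _ (fun v => _ /\ _) => apply: S1_and; def
  | |- S1 _ (fun v => _ \/ _) => apply: S1_or; def
  | |- S1 _ (fun v => forall a, dlt a _ -> _) => apply: S1_ball; def
  | |- S1 _ (fun v => ~ _) => apply: D1_S1; def
  | |- S1 _ (fun v => _ -> _) => apply: S1_imp; def
  | |- S1 _ _ => apply: D1_S1; def
  | |- D1 _ (fun v => @eq (dom _) _ _) => apply: D1_eq; def
  | |- D1 _ (fun v => dlt _ _) => apply: D1_lt; def
  | |- D1 _ (fun v => dle _ _) => apply: D1_not; apply: D1_lt; def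
  | |- D1 _ (fun v => ~ _) => apply: D1_not; def
  | |- D1 _ (fun v => _ /\ _) => apply: D1_and; def
  | |- D1 _ (fun v => _ \/ _) => apply: D1_or; def
  | |- D1 _ (fun v => _ <-> _) => apply: D1_iff; def
  | |- D1 _ (fun v => exists a, dlt a _ /\ _) => apply: D1_bex; def
  | |- D1 _ (fun v => forall a, dlt a _ -> _) => apply: D1_ball; def
  | |- D1 _ (fun v => _ -> _) => apply: D1_imp; def
  | H : D1 _ (fun v => ?P (v 0%N)) |- D1 _ (fun v => ?P _) => apply: (comp1D1 H); def
  | H : D1 _ (fun v => ?P (v 0%N) (v 1%N)) |- D1 _ (fun v => ?P _ _) => apply: (comp2D1 H); def
  | H : D1 _ (fun v => ?P (v 0%N) (v 1%N) (v 2%N)) |- D1 _ (fun v => ?P _ _ _) =>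
      apply: (comp3D1 H); def
  | H : dset _ ?A |- D1 _ (fun v => ?A _) => apply: (D1_mem H); def
  | |- D1 _ _ => solve [auto 1 with defdb nocore]
  | |- RF _ (fun v => dadd _ _) => apply: RF_add; def
  | |- RF _ (fun v => dmul _ _) => apply: RF_mul; def
  | |- RF _ (fun v => pairM _ _) => apply: RF_pair; def
  | |- RF _ (fun v => v _) => apply: RF_var; done
  | |- RF _ (fun v => if pselect _ then _ else _) => apply: RF_if; def
  | H : RF _ (fun v => ?g (v 0%N)) |- RF _ (fun v => ?g _) => apply: (RF_comp1 H); def
  | H : RF _ (fun v => ?g (v 0%N) (v 1%N)) |- RF _ (fun v => ?g _ _) => apply: (RF_comp2 H); def
  | H : RF _ (fun v => ?g (v 0%N) (v 1%N) (v 2%N)) |- RF _ (fun v => ?g _ _ _) =>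
      apply: (RF_comp3 H); def
  | |- RF _ _ => first [apply: RF_const | solve [auto 1 with defdb nocore]]
  | |- _ => solve [auto 1 with defdb nocore]
  end.

Ltac nring := apply (proj2 (iN_eq _ _)); rewrite ?(iND, iNM, iN0, iN1); ring.

(** * Least numbers, pairing and division *)

Section Induction.
Variable M : rcaModel.
Local Notation N := (dom M).
Implicit Types x y z a b c d i j k m n q u : N.
Local Open Scope M_scope.

(** The complement of [P] is Pi_1 while induction is Sigma_1, so the induction runs on the length of
    a descending chain in [P]. *)
Lemma least (P : N -> Prop) n : S1 1 (fun v => P (v 0%N)) -> P n ->
  exists m, P m /\ forall k, k < m -> ~ P k.
Proof.
move=> HP Pn; apply: contrapT => H.
have K m : P m -> exists k, k < m /\ P k.
  move=> Pm; apply: contrapT => H'; apply: H; exists m; split=> // k Hk Pk.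
  by apply: H'; exists k.
(* a descent of length n + 2 below n + 1 *)
suff D t : t <= n + 1 -> exists k, k + t <= n /\ P k.
  by have [k [Hk _]] := D (n + 1) (nle_refl _); nlra.
elim/induct: t => [||t IH Ht].
- apply: S1_imp; first by def.
  apply: S1_ex; apply: S1_and; first by def.
  by apply: (@S1_ren M 1 2 id _ _ HP); case.
- by move=> _; exists n; split=> //; nlra.
- have [k [Hk Pk]] := IH ltac:(nlra); have [l [Hl Pl]] := K k Pk.
  by exists l; split=> //; nlra.
Qed.

Lemma greatest (P : N -> Prop) a b : S1 1 (fun v => P (v 0%N)) -> P a ->
  (forall x, P x -> x <= b) -> exists m, P m /\ forall k, P k -> k <= m.
Proof.
move=> HP Pa Hb.
have HP' : S1 1 (fun v => exists k, k + v 0%N = b /\ P k).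
  apply: S1_ex; apply: S1_and; first by def.
  by apply: (@S1_ren M 1 2 id _ _ HP); case.
have [c Hc] := proj1 (mleE a b) (Hb _ Pa).
have [z [[k [Hk Pk]] Hz]] := least (P := fun z => exists k, k + z = b /\ P k) (n := c)
  HP' (ex_intro _ a (conj (esym Hc) Pa)).
exists k; split=> // l Pl; apply: contrapT => /mltNge Hl.
have [w Hw] := proj1 (mleE l b) (Hb _ Pl).
by apply: (Hz w); [nlra|exists l].
Qed.

Lemma pair_inj i j i' j' : pairM i j = pairM i' j' :> N -> i = i' /\ j = j'.
Proof.
rewrite /pairM => E.
suff Es : i + j = i' + j'.
  have Ei : i = i' by rewrite Es in E; nlra.
  by split=> //; nlra.
by case: (lt_eq_gt (i + j) (i' + j')) => [H|[//|H]]; exfalso; nnra.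
Qed.

Lemma pair_gel i j : i <= pairM i j. Proof. by rewrite /pairM; nnra. Qed.
Lemma pair_ger i j : j <= pairM i j.
Proof.
rewrite /pairM; case: (mcases j) => [->|[k ->]]; nnra.
Qed.

(** The bounds on [x] and [y] keep the definition Delta_1; they lose nothing, as a pair is at least
    as large as its components. *)
Definition setp (R : N -> N -> Prop) : N -> Prop := fun z =>
  exists x, x < z + 1 /\ exists y, y < z + 1 /\ (z = pairM x y /\ R x y).

Lemma setpE R x y : setp R (pairM x y) <-> R x y.
Proof.
split=> [[x' [_ [y' [_ [/pair_inj [-> ->] //]]]]]|H].
exists x; split; first by apply/mltS/or_comm; case: (lt_eq_gt x (pairM x y)) => [|[|/pair_gel]]; tauto.
exists y; split=> //; apply/mltS; case: (lt_eq_gt y (pairM x y)) => [|[|/pair_ger]]; tauto.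
Qed.

Lemma setp_rel R : isRelM (setp R).
Proof. by move=> z [x [_ [y [_ [-> _]]]]]; exists x, y. Qed.

Lemma setp_dset R : D1 2 (fun v => R (v 0%N) (v 1%N)) -> dset M (setp R).
Proof. by move=> H; apply: setD1; rewrite /setp; def. Qed.

Lemma dset_slice (A : N -> Prop) i : dset M A -> dset M (sliceM A i).
Proof. by move=> H; apply: setD1; rewrite /sliceM; def. Qed.

Lemma division c m : 0 < m -> exists q u, c = q * m + u /\ u < m.
Proof.
move=> Hm; elim/induct: c => [||c [q [u [-> Hu]]]]; first by def.
  by exists 0, 0; split; nlra.
case: (lt_eq_gt (u + 1) m) => [H|[H|H]].
- by exists q, (u + 1); split=> //; nlra.
- by exists (q + 1), 0; split=> //; rewrite -H; nring.
- by exfalso; nlra.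
Qed.

Lemma division_uniq m q u q' u' : q * m + u = q' * m + u' -> u < m -> u' < m ->
  q = q' /\ u = u'.
Proof.
move=> E H H'; suff Eq : q = q' by split=> //; rewrite Eq in E; nlra.
case: (lt_eq_gt q q') => [/mltE [z Ez]|[//|/mltE [z Ez]]]; exfalso; rewrite Ez in E; nnra.
Qed.

(** * Sequence coding and primitive recursion *)

Definition modulus d i := 1 + (i + 1) * d.

Lemma modulus_gt0 d i : 0 < modulus d i. Proof. by rewrite /modulus; nnra. Qed.

Lemma beta_ex c d i : exists u, betaM c d i u.
Proof.
have [q [u [H1 H2]]] := division c (modulus_gt0 d i).
by exists u; split=> //; exists q.
Qed.

Lemma beta_uniq c d i u v : betaM c d i u -> betaM c d i v -> u = v.
Proof. by move=> [Hu [q ->]] [Hv [q' E]]; case: (division_uniq E Hu Hv). Qed.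

(** The remainder exists and is unique, so the negation is Sigma_1 too: some other number is the
    remainder. *)
Lemma D1_beta (k : nat) (f g h l : (nat -> N) -> N) : RF k f -> RF k g -> RF k h -> RF k l ->
  D1 k (fun v => betaM (f v) (g v) (h v) (l v)).
Proof.
move=> Hf Hg Hh Hl.
have S : S1 4 (fun v : nat -> N => betaM (v 0%N) (v 1%N) (v 2%N) (v 3%N)) by rewrite /betaM; def.
have H : D1 4 (fun v : nat -> N => betaM (v 0%N) (v 1%N) (v 2%N) (v 3%N)).
  split=> //.
  apply: S1_ext (S1_ex (P := fun u v => u <> v 3%N /\ betaM (v 0%N) (v 1%N) (v 2%N) u) _) _.
    apply: S1_and; first by def.
    apply: (@S1_ren M 4 5 (fun i : nat => match i with 3 => 0 | _ => i.+1 end)%N _ _ S).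
    by case=> [|[|[|[]]]].
  move=> v; split=> [[u [Hu Hb]] Hb'|H]; first exact/Hu/(beta_uniq Hb Hb').
  have [u Hu] := beta_ex (v 0%N) (v 1%N) (v 2%N).
  by exists u; split=> // E; apply: H; rewrite -E.
apply: (D1_subst (P := fun y v => betaM y (g v) (h v) (l v)) Hf).
apply: (D1_subst (P := fun y v => betaM (v 0%N) y (h (tl v)) (l (tl v))) (RF_tl Hg)).
apply: (D1_subst (P := fun y v => betaM (v 1%N) (v 0%N) y (l (tl (tl v)))) (RF_tl (RF_tl Hh))).
apply: (D1_subst (P := fun y v => betaM (v 2%N) (v 1%N) (v 0%N) y) (RF_tl (RF_tl (RF_tl Hl)))).
apply: (@D1_ren M 4 k.+4 (fun i : nat => match i with 0 => 3 | 1 => 2 | 2 => 1 | _ => 0 end)%N _ _ H).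
by case=> [|[|[|[]]]].
Qed.

(** Supplies the [d] of the beta function: large enough for the values to be below their moduli, and
    divisible by 1, ..., n so that the moduli are pairwise coprime. *)
Lemma common_multiple b n : exists d, b <= d /\ 1 <= d /\
  forall x, x < n -> exists e, d = (x + 1) * e.
Proof.
elim/induct: n => [||n [d [H1 [H2 H3]]]]; first by def.
  by exists (b + 1); split; [nlra|split=> [|x Hx]; [nlra|exfalso; nlra]].
exists (d * (n + 1)); split; first by nnra.
split; first by nnra.
move=> x /mltS [/H3 [e He]|->].
  by exists (e * (n + 1)); rewrite He; nring.
exists d; nring.
Qed.

(* [m + x] is the larger index; the inverse of [modulus d m] comes from
   [modulus d (m + x) - modulus d m = x * d], where [x] divides [d] and
   [(m + x + 1) * d = -1] modulo [modulus d (m + x)]. *)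
Lemma modulus_coprime d e m y : 1 <= d -> d = (y + 1) * e ->
  exists u w, u * modulus d m = w * modulus d (m + (y + 1)) + 1.
Proof.
move=> /mleE [d' Hd] He; pose j := m + (y + 1).
exists ((j + 1) * (j + 1) * e * ((j + 1) * d)),
  ((j + 1) * (j + 1) * e * ((m + 1) * d) + j * d + d').
move/iN_eq: Hd => Hd; move/iN_eq: He => He; apply/iN_eq; move: Hd He.
rewrite /modulus /j !(iND, iNM, iN1) => Hd He.
have -> : iN d' = iN d - 1 by rewrite Hd; ring.
by rewrite He; ring.
Qed.

(** Chinese remainders, one modulus at a time. [p] multiplies up the moduli treated so far, and its
    invertibility modulo each later one is carried as [u * p = w * modulus d j + 1], since there is
    no subtraction. *)
Lemma beta_lemma (h : N -> N) n : RF 1 (fun v => h (v 0%N)) ->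
  exists c d, forall i, i < n -> betaM c d i (h i).
Proof.
move=> Hh.
have [b Hb] : exists b, forall i, i < n -> h i < b.
  elim/induct: n => [||n [b Hb]]; first by def.
    by exists 0 => i Hi; exfalso; nlra.
  by exists (b + h n + 1) => i /mltS [/Hb Hi|->]; nlra.
have [d [Hd1 [Hd2 Hd3]]] := common_multiple b n.
suff K m : m <= n -> exists c p, (forall i, i < m ->
      (exists q, c = q * modulus d i + h i) /\ exists q, p = q * modulus d i) /\
    forall j, j < n -> m <= j -> exists u w, u * p = w * modulus d j + 1.
  have [c [p [H _]]] := K n (nle_refl n); exists c, d => i Hi.
  split; last by case: (H i Hi) => -[q Hq] _; exists q.
  by have Hbi := Hb i Hi; nnra.
elim/induct: m => [||m IH Hm]; first by rewrite /modulus; def.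
  move=> _; exists 0, 1; split=> [i Hi|j _ _]; first by exfalso; nlra.
  by exists 1, 0; nring.
have [c [p [H1 H2]]] := IH ltac:(nlra).
have [u [w Huw]] := H2 m ltac:(nlra) (nle_refl m).
(* Modulo [modulus d m] the number [(m + 1) * d] is -1, so the last factor stands for [h m - c], and
   [p * u] is 1 there. *)
exists (c + p * (u * (h m + c * ((m + 1) * d)))), (p * modulus d m); split.
- move=> i /mltS [/H1 [[q Hq] [q' Hq']]|->]; split.
  + exists (q + q' * (u * (h m + c * ((m + 1) * d)))).
    by rewrite [X in X + _]Hq [X in _ + X * _]Hq'; nring.
  + by exists (q' * modulus d m); rewrite Hq'; nring.
  + exists (w * (h m + c * ((m + 1) * d)) + c).
    rewrite mmulA (mmulC p) Huw /modulus; nring.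
  + by exists p.
- move=> j Hj Hmj; have [u1 [w1 H1w]] := H2 j Hj ltac:(nlra).
  have [y Hy] : exists y, j = m + (y + 1) by apply/mltE; nlra.
  have [e He] := Hd3 y ltac:(nlra).
  have [U [W HUW]] := modulus_coprime m Hd2 He; rewrite -Hy in HUW.
  exists (u1 * U), (w1 * W * modulus d j + w1 + W).
  rewrite (_ : u1 * U * (p * modulus d m) = (u1 * p) * (U * modulus d m)); last by nring.
  by rewrite H1w HUW; nring.
Qed.

#[local] Hint Extern 1 (D1 _ (fun v => betaM _ _ _ _)) => apply: D1_beta; def : defdb.

(** The value at [n] is read off any beta code of a correct computation of length [n]. Such a code
    is not extended in place: the old sequence with its new entry is coded afresh by
    [beta_lemma]. *)
Lemma primrec a (g : N -> N -> N) : RF 2 (fun v => g (v 0%N) (v 1%N)) ->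
  exists f : N -> N, [/\ f 0 = a, forall n, f (n + 1) = g n (f n) & RF 1 (fun v => f (v 0%N))].
Proof.
move=> Hg.
pose Sq n c d := betaM c d 0 a /\
  forall i, i < n -> exists u, betaM c d i u /\ betaM c d (i + 1) (g i u).
have Sq_ex n : exists c d, Sq n c d.
  rewrite /Sq; elim/induct: n => [||n [c [d [H0 HS]]]]; first by def.
    exists a, a; split=> [|i Hi]; last by exfalso; nlra.
    by split; [nlra|exists 0; nring].
  have [u Hu] := beta_ex c d n.
  have [bt Hbt] := choice (beta_ex c d).
  have Rbt : RF 1 (fun v => bt (v 0%N)).
    apply: S1_ext (_ : S1 2 (fun v => betaM c d (v 1%N) (v 0%N))) _; first by def.
    by move=> v; split=> [H|->//]; apply: beta_uniq H (Hbt _).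
  have Rh : RF 1 (fun v => if pselect (v 0%N <= n) then bt (v 0%N) else g n u).
    apply: RF_if. def. def. def.
  have [c' [d' Hcd]] := @beta_lemma (fun i => if pselect (i <= n) then bt i else g n u) (n + 1 + 1) Rh.
  exists c', d'; split.
    have := Hcd 0 ltac:(nlra); case: pselect => /= [_|[]]; last by nlra.
    by rewrite (beta_uniq (Hbt 0) H0).
  move=> i Hi; exists (bt i); split.
    by have := Hcd i ltac:(nlra); case: pselect => //= -[]; nlra.
  have := Hcd (i + 1) ltac:(nlra); case: pselect => /= Hin.
    have [w [Hw Hw']] := HS i ltac:(nlra).
    by rewrite (beta_uniq (Hbt _) Hw') (beta_uniq (Hbt i) Hw).
  have -> : i = n by case: (lt_eq_gt i n) => [H|[//|H]]; exfalso; [apply: Hin|]; nlra.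
  by rewrite (beta_uniq Hu (Hbt n)).
have Sq_uniq n c d c' d' : Sq n c d -> Sq n c' d' ->
    forall i, i <= n -> exists u, betaM c d i u /\ betaM c' d' i u.
  move=> [H0 HS] [H0' HS'] i; elim/induct: i => [||i IH Hi]; first by def.
    by exists a.
  have [u [Hu Hu']] := IH ltac:(nlra).
  have [w [Hw Hw']] := HS i ltac:(nlra); have [x [Hx Hx']] := HS' i ltac:(nlra).
  exists (g i u); split.
    by rewrite (beta_uniq Hu Hw).
  by rewrite (beta_uniq Hu' Hx).
have Rex n : exists u, exists c d, Sq n c d /\ betaM c d n u.
  have [c [d H]] := Sq_ex n; have [u Hu] := beta_ex c d n.
  by exists u, c, d.
have [f Hf] := choice Rex.
have Runiq n u c d : Sq n c d -> betaM c d n u -> u = f n.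
  move=> H Hu; have [c' [d' [H' Hu']]] := Hf n.
  have [w [Hw Hw']] := Sq_uniq _ _ _ _ _ H H' n (nle_refl n).
  by rewrite (beta_uniq Hu Hw) (beta_uniq Hu' Hw').
exists f; split.
- have [c [d [H H']]] := Hf 0; exact: beta_uniq H' (proj1 H).
- move=> n; have [c [d [H Hn]]] := Hf (n + 1); have [u [Hu Hu']] := proj2 H n ltac:(nlra).
  rewrite (beta_uniq Hn Hu') (@Runiq n u c d) //.
  by split; [case: H|move=> i Hi; apply: (proj2 H); nlra].
- apply: S1_ext (_ : S1 2 (fun v => exists c d, Sq (v 1%N) c d /\ betaM c d (v 1%N) (v 0%N))) _.
    by rewrite /Sq; def.
  by move=> v; split=> [[c [d [H H']]]|->]; [exact: Runiq H H'|exact: Hf].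
Qed.

Lemma e2_ex : exists f : N -> N,
  [/\ f 0 = 1, forall n, f (n + 1) = f n + f n & RF 1 (fun v => f (v 0%N))].
Proof. by apply: (@primrec 1 (fun _ u => u + u)); def. Qed.

Definition e2 : N -> N := projT1 (cid e2_ex).

Lemma e2_0 : e2 0 = 1. Proof. by rewrite /e2; case: cid => f []. Qed.
Lemma e2_S n : e2 (n + 1) = e2 n + e2 n. Proof. by rewrite /e2; case: cid => f []. Qed.
Lemma RF_e2 (k : nat) (f : (nat -> N) -> N) : RF k f -> RF k (fun v => e2 (f v)).
Proof. by apply: RF_comp1; rewrite /e2; case: cid => g []. Qed.

Lemma pow2E k m : pow2M k m <-> m = e2 k.
Proof.
have RFe := @RF_e2 1 _ (RF_var M (isT : (0 < 1)%N)).
split=> [[c [d [H0 [Hk HS]]]]|->].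
- suff H i : i <= k -> betaM c d i (e2 i) by exact: beta_uniq Hk (H k (nle_refl k)).
  elim/induct: i => [||i IH Hi]; first by def.
    by rewrite e2_0.
  have [v Hv] := beta_ex c d (i + 1).
  by rewrite e2_S -(HS i _ v _ (IH _) Hv) //; nlra.
- have [c [d H]] := beta_lemma (k + 1) RFe.
  exists c, d; split; first by rewrite -e2_0; apply: H; nlra.
  split; first by apply: H; nlra.
  move=> i u v Hi Hu Hv; rewrite (beta_uniq Hu (H i _)); last by nlra.
  by rewrite (beta_uniq Hv (H (i + 1) _)) ?e2_S //; nlra.
Qed.

End Induction.

#[export] Hint Extern 1 (D1 _ (fun v => betaM _ _ _ _)) => apply: D1_beta; def : defdb.
#[export] Hint Extern 1 (RF _ (fun v => e2 _)) => apply: RF_e2; def : defdb.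

Arguments pair_gel {M} i j.
Arguments pair_ger {M} i j.
(** * Definable rational-valued functions and real numbers *)

Section RatValues.
Variable M : rcaModel.
Local Notation N := (dom M).
Local Notation F := (QM M).
Implicit Types (a b q r : mrat M) (x y z k i j m : N).

Lemma den_gt0 x : 0 < iN x + 1 :> F.
Proof. by have := iN_ge0 x; lra. Qed.

Lemma rltE a b : rltM a b <-> qv a < qv b.
Proof.
rewrite /rltM /denM iN_lt /qv !(iND, iNM, iN1).
rewrite ltr_pdivrMr ?den_gt0 // mulrAC ltr_pdivlMr ?den_gt0 //.
by split; nra.
Qed.

Lemma rleE a b : rleM a b <-> qv a <= qv b.
Proof. by rewrite /rleM rltE leNgt; split=> /negP. Qed.

Lemma qv_add a b : qv (raddM a b) = qv a + qv b.
Proof.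
rewrite /qv /raddM /denM /= !(iND, iNM, iN1).
rewrite (_ : iN (mden a) * iN (mden b) + iN (mden a) + iN (mden b) + 1 =
  (iN (mden a) + 1) * (iN (mden b) + 1)); last by ring.
by field; rewrite !lt0r_neq0 ?den_gt0.
Qed.
Lemma qv_opp a : qv (roppM a) = - qv a.
Proof. by rewrite /qv /= -mulNr; congr (_ / _); ring. Qed.
Lemma qv_sub a b : qv (rsubM a b) = qv a - qv b.
Proof. by rewrite /rsubM qv_add qv_opp. Qed.
Lemma qv_zero : qv (rzeroM M) = 0. Proof. by rewrite /qv /= iN0 subr0 mul0r. Qed.
Lemma qv_one : qv (roneM M) = 1. Proof. by rewrite /qv /= iN0 iN1 subr0 add0r divr1. Qed.
Lemma qv_inv x : qv (rinvM x) = (iN x + 1)^-1.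
Proof. by rewrite /qv /= iN0 iN1 subr0 mul1r. Qed.

Lemma code_inj a b : codeM a = codeM b -> a = b.
Proof.
case: a b => [p n d] [p' n' d'] /pair_inj [/pair_inj [/= -> ->] /= ->] //.
Qed.

Definition hf (k : N) : F := (iN (e2 k))^-1.

Lemma e2_gt0 k : 0 < iN (e2 k) :> F.
Proof.
suff : (0 < e2 k)%M by move/iN_lt; rewrite iN0.
elim/induct: k => [||k IH]; first by def.
  by rewrite e2_0; nlra.
by rewrite e2_S; nlra.
Qed.

Lemma e2_neq0 k : e2 k <> 0%M.
Proof. by move=> E; have := e2_gt0 k; rewrite E iN0; lra. Qed.

Lemma hf_gt0 k : 0 < hf k. Proof. by rewrite invr_gt0 e2_gt0. Qed.
Lemma hf_0 : hf 0%M = 1. Proof. by rewrite /hf e2_0 iN1 invr1. Qed.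
Lemma hf_S k : hf (k + 1)%M = hf k / 2.
Proof.
rewrite /hf e2_S iND; have H := e2_gt0 k.
by field; do ?(apply/andP; split); apply: lt0r_neq0; lra.
Qed.

Lemma e2_add i j : e2 (i + j)%M = (e2 i * e2 j)%M.
Proof.
elim/induct: j => [||j IH]; first by def.
  by rewrite madd0 e2_0 mmul1.
by rewrite maddS !e2_S IH; nring.
Qed.
Lemma hf_add i j : hf (i + j)%M = hf i * hf j.
Proof. by rewrite /hf e2_add iNM invfM. Qed.

Lemma e2_gt k : iN k < iN (e2 k).
Proof.
suff : (k < e2 k)%M by move/iN_lt.
elim/induct: k => [||k IH]; first by def.
  by rewrite e2_0; nlra.
by rewrite e2_S; nlra.
Qed.

Lemma hf_mono i j : (i <= j)%M -> hf j <= hf i.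
Proof.
move=> /mleE [z ->]; rewrite hf_add; have := hf_gt0 i; have := hf_gt0 z.
suff : hf z <= 1 by nra.
by rewrite invf_le1 ?e2_gt0 //; have := e2_gt z; move/iN_lt1; have := iN_ge0 z; lra.
Qed.
Lemma hf_le1 k : hf k <= 1.
Proof. by rewrite -hf_0; apply: hf_mono; nlra. Qed.

Lemma archimedes (x : F) : exists n : N, x < iN n.
Proof.
have [[p n d] ->] := qv_surj x; exists (p + 1)%M; rewrite /qv iND iN1.
rewrite ltr_pdivrMr ?den_gt0 //=.
by have := iN_ge0 p; have := iN_ge0 n; have := iN_ge0 d; nra.
Qed.

Lemma hf_small (eps : F) : 0 < eps -> exists k, hf k < eps.
Proof.
move=> He; have [n Hn] := archimedes eps^-1; exists n.
rewrite -[eps]invrK ltf_pV2 ?posrE ?invr_gt0 ?e2_gt0 //.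
exact: lt_trans Hn (e2_gt n).
Qed.

Lemma pow2_hf k m : pow2M k (m + 1)%M -> qv (rinvM m) = hf k.
Proof. by move=> /pow2E E; rewrite qv_inv /hf -E iND iN1. Qed.

Lemma pow2_ex k : exists m, pow2M k (m + 1)%M.
Proof.
case: (mcases (e2 k)) => [/e2_neq0 //|[m Hm]].
by exists m; apply/pow2E.
Qed.

End RatValues.

(** * Definable rational-valued functions *)

Section QF.
Variable M : rcaModel.
Local Notation N := (dom M).
Local Notation F := (QM M).
Local Notation env := (nat -> N).
Implicit Types (f g : env -> N) (h : env -> F).

(** Definability is demanded of the three number components, because the field [QM] lies outside the
    model. *)
Definition QF k h := exists p n d, [/\ RF k p, RF k n, RF k d &
  forall v, h v = qv (MRat (p v) (n v) (d v))].

Lemma QF_qv k p n d : RF k p -> RF k n -> RF k d -> QF k (fun v => qv (MRat (p v) (n v) (d v))).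
Proof. by move=> *; exists p, n, d. Qed.

Lemma QF_const k (x : F) : QF k (fun _ => x).
Proof.
have [[p n d] ->] := qv_surj x.
by exists (fun _ => p), (fun _ => n), (fun _ => d); split=> //; exact: RF_const.
Qed.

Lemma QF_iN k f : RF k f -> QF k (fun v => iN (f v)).
Proof.
move=> Hf; exists f, (fun _ => 0%M), (fun _ => 0%M); split=> //; try exact: RF_const.
by move=> v; rewrite /qv /= iN0 subr0 add0r divr1.
Qed.

Lemma QF_add k h h' : QF k h -> QF k h' -> QF k (fun v => h v + h' v).
Proof.
move=> [p [n [d [Hp Hn Hd E]]]] [p' [n' [d' [Hp' Hn' Hd' E']]]].
exists (fun v => p v * (d' v + 1) + p' v * (d v + 1))%M,
  (fun v => n v * (d' v + 1) + n' v * (d v + 1))%M, (fun v => d v * d' v + d v + d' v)%M.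
split; try by do !(apply: RF_add || apply: RF_mul || apply: RF_const || assumption).
by move=> v; rewrite E E' -qv_add.
Qed.

Lemma QF_opp k h : QF k h -> QF k (fun v => - h v).
Proof. by move=> [p [n [d [? ? ? E]]]]; exists n, p, d; split=> // v; rewrite E -qv_opp. Qed.

Lemma QF_mul k h h' : QF k h -> QF k h' -> QF k (fun v => h v * h' v).
Proof.
move=> [p [n [d [Hp Hn Hd E]]]] [p' [n' [d' [Hp' Hn' Hd' E']]]].
exists (fun v => p v * p' v + n v * n' v)%M,
  (fun v => p v * n' v + n v * p' v)%M, (fun v => d v * d' v + d v + d' v)%M.
split; try by do !(apply: RF_add || apply: RF_mul || apply: RF_const || assumption).
move=> v; rewrite E E' /qv /= !(iND, iNM).
rewrite (_ : iN (d v) * iN (d' v) + iN (d v) + iN (d' v) + 1 =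
  (iN (d v) + 1) * (iN (d' v) + 1)); last by ring.
by field; rewrite !lt0r_neq0 ?den_gt0.
Qed.

Lemma QF_inv k f : RF k f -> (forall v, f v <> 0%M) -> QF k (fun v => (iN (f v))^-1).
Proof.
move=> Hf H0.
have K (x : N) : exists y : N, x <> 0%M -> x = (y + 1)%M.
  by case: (mcases x) => [->|[y ->]]; [exists 0%M|exists y].
have [pr Hpr] := choice K.
exists (fun _ => 1%M), (fun _ => 0%M), (fun v => pr (f v)).
split; try exact: RF_const.
- apply: S1_ext (_ : S1 k.+1 (fun v => f (tl v) = v 0%N + 1)%M) _.
    apply: D1_S1; apply: D1_eq; first exact: RF_tl.
    by apply: RF_add; [exact: RF_var|exact: RF_const].
  move=> v; have := Hpr (f (tl v)) (H0 _) => E; split=> [E'|->//].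
  by rewrite E' in E *; apply: (@maddI _ _ _ 1%M).
- by move=> v; rewrite /qv /= iN1 iN0 subr0 mul1r {1}(Hpr _ (H0 v)) iND iN1.
Qed.

Lemma D1_qlt k h h' : QF k h -> QF k h' -> D1 k (fun v => h v < h' v).
Proof.
move=> [p [n [d [Hp Hn Hd E]]]] [p' [n' [d' [Hp' Hn' Hd' E']]]].
apply: D1_ext (_ : D1 k (fun v => rltM (MRat (p v) (n v) (d v)) (MRat (p' v) (n' v) (d' v)))) _.
  rewrite /rltM /denM /=; apply: D1_lt;
  by do !(apply: RF_add || apply: RF_mul || apply: RF_const || assumption).
by move=> v; rewrite E E' rltE.
Qed.

Lemma D1_qle k h h' : QF k h -> QF k h' -> D1 k (fun v => h v <= h' v).
Proof.
move=> H H'; apply: D1_ext (D1_not (D1_qlt H' H)) _ => v.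
by rewrite leNgt; split=> /negP.
Qed.

Lemma QF_if k P h h' : D1 k P -> QF k h -> QF k h' ->
  QF k (fun v => if pselect (P v) then h v else h' v).
Proof.
move=> HP [p [n [d [Hp Hn Hd E]]]] [p' [n' [d' [Hp' Hn' Hd' E']]]].
exists (fun v => if pselect (P v) then p v else p' v),
  (fun v => if pselect (P v) then n v else n' v),
  (fun v => if pselect (P v) then d v else d' v).
split; try exact: RF_if.
by move=> v; case: pselect => /= _; [exact: E|exact: E'].
Qed.

Lemma QF_ext k h h' : QF k h -> h =1 h' -> QF k h'.
Proof. by move=> [p [n [d [? ? ? E]]]] E'; exists p, n, d; split=> // v; rewrite -E'. Qed.

Lemma QF_max k h h' : QF k h -> QF k h' -> QF k (fun v => Num.max (h v) (h' v)).
Proof.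
move=> H H'; apply: QF_ext (QF_if (D1_qlt H H') H' H) _ => v.
by case: pselect => /= [Hlt|/negP Hge]; rewrite /Num.max ?Hlt ?(negbTE Hge).
Qed.

Lemma QF_norm k h : QF k h -> QF k (fun v => `|h v|).
Proof.
move=> H; apply: QF_ext (QF_max H (QF_opp H)) _ => v.
by rewrite /Num.max; case: ltP => Hv; [rewrite ler0_norm|rewrite ger0_norm] => //; lra.
Qed.

Lemma QF_hf k f : RF k f -> QF k (fun v => hf (f v)).
Proof. by move=> Hf; apply: QF_inv; [exact: RF_e2|move=> v; exact: e2_neq0]. Qed.

Lemma QF_comp1 k (a : N -> F) f : QF 1 (fun v => a (v 0%N)) -> RF k f -> QF k (fun v => a (f v)).
Proof.
move=> [p [n [d [Hp Hn Hd E]]]] Hf.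
exists (fun v => p (scons (f v) v)), (fun v => n (scons (f v) v)), (fun v => d (scons (f v) v)).
have K g : RF 1 g -> RF k (fun v => g (scons (f v) v)).
  move=> Hg.
  have Hg' : RF k.+1 (fun v => g (scons (v 0%N) (tl v))).
    apply: (@S1_ext _ _ _ _ (@S1_ren M 2 k.+2 id _ ltac:(by case=> [|[]]) Hg)) => v /=.
    by rewrite (_ : scons _ _ = tl v) //; apply: funext => -[].
  exact: (RF_sub (g := fun y v => g (scons y v)) Hf Hg').
split; try exact: K.
by move=> v; rewrite -E.
Qed.

End QF.

#[export] Hint Extern 1 (D1 _ (fun v => is_true (Order.lt _ _))) => apply: D1_qlt; def : defdb.
#[export] Hint Extern 1 (D1 _ (fun v => is_true (Order.le _ _))) => apply: D1_qle; def : defdb.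
#[export] Hint Extern 1 (QF _ (fun v => iN _)) => apply: QF_iN; def : defdb.
#[export] Hint Extern 1 (QF _ (fun v => hf _)) => apply: QF_hf; def : defdb.
#[export] Hint Extern 1 (QF _ (fun v => _ + _)%R) => apply: QF_add; def : defdb.
#[export] Hint Extern 1 (QF _ (fun v => _ * _)%R) => apply: QF_mul; def : defdb.
#[export] Hint Extern 1 (QF _ (fun v => - _)%R) => apply: QF_opp; def : defdb.
#[export] Hint Extern 1 (QF _ (fun v => Num.max _ _)) => apply: QF_max; def : defdb.
#[export] Hint Extern 1 (QF _ (fun v => Num.norm _)) => apply: QF_norm; def : defdb.
#[export] Hint Extern 1 (QF _ (fun v => qv (MRat _ _ _))) => apply: QF_qv; def : defdb.
#[export] Hint Extern 2 (QF _ _) => apply: QF_const : defdb.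

(** * Reals as fast Cauchy sequences of rationals *)

Section Reals.
Variable M : rcaModel.
Local Notation N := (dom M).
Local Notation F := (QM M).
Implicit Types (A X Y : N -> Prop) (a x y : N -> F) (b r : mrat M) (k : N).

Definition fast a := forall k i, `|a k - a (k + i)%M| <= hf k.

Definition realSeq A a :=
  [/\ forall k, exists q, A (pairM k (codeM q)) /\ a k = qv q,
      forall k q, A (pairM k (codeM q)) -> a k = qv q & fast a].

Lemma isReal_seq A : isRealM A -> exists a, realSeq A a.
Proof.
move=> [[_ [Htot Huni]] [Hcod Hcau]].
have K k : exists q, A (pairM k (codeM q)).
  have [m Hm] := Htot k; have [q E] := Hcod k m Hm.
  by exists q; rewrite -E.
have [q Hq] := choice K.
have Hu k q' : A (pairM k (codeM q')) -> qv (q k) = qv q'.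
  by move=> H; congr qv; apply: code_inj; exact: Huni (Hq k) H.
exists (fun k => qv (q k)); split=> // [k|k i]; first by exists (q k).
have [m Hm] := pow2_ex k.
have [] := Hcau k i m (q k) (q (k + i)%M) (Hq _) (Hq _) Hm.
by rewrite !rleE !qv_add (pow2_hf Hm) ler_norml; lra.
Qed.

Lemma lt_RQE A a b : realSeq A a -> lt_RQM A b <-> exists k, a k + hf k < qv b.
Proof.
move=> [H1 H2 _]; split=> [[k [m [q [Hq [Hm]]]]]|[k Hk]].
- by rewrite rltE qv_add (pow2_hf Hm) -(H2 k q Hq) => ?; exists k.
- have [q [Hq Eq]] := H1 k; have [m Hm] := pow2_ex k.
  by exists k, m, q; split=> //; split=> //; rewrite rltE qv_add (pow2_hf Hm) -Eq.
Qed.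

Lemma lt_QRE A a b : realSeq A a -> lt_QRM b A <-> exists k, qv b + hf k < a k.
Proof.
move=> [H1 H2 _]; split=> [[k [m [q [Hq [Hm]]]]]|[k Hk]].
- by rewrite rltE qv_add (pow2_hf Hm) -(H2 k q Hq) => ?; exists k.
- have [q [Hq Eq]] := H1 k; have [m Hm] := pow2_ex k.
  by exists k, m, q; split=> //; split=> //; rewrite rltE qv_add (pow2_hf Hm) -Eq.
Qed.

Lemma fast_dist a k l : fast a -> (k <= l)%M -> `|a k - a l| <= hf k.
Proof. by move=> H /mleE [i ->]. Qed.

Lemma le_RQE A a b : realSeq A a -> ~ lt_QRM b A <-> forall k, a k <= qv b + hf k.
Proof.
move=> HA; rewrite (lt_QRE _ HA); split=> [H k|H [k]]; last by have := H k; lra.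
by rewrite leNgt; apply/negP => Hk; apply: H; exists k.
Qed.

Lemma le_QRE A a b : realSeq A a -> ~ lt_RQM A b <-> forall k, qv b <= a k + hf k.
Proof.
move=> HA; rewrite (lt_RQE _ HA); split=> [H k|H [k]]; last by have := H k; lra.
by rewrite leNgt; apply/negP => Hk; apply: H; exists k.
Qed.

Lemma inUnitE A a : realSeq A a -> inUnitM A -> forall k, - hf k <= a k <= 1 + hf k.
Proof.
move=> HA [_ [H1 H2]] k; move/(le_QRE _ HA)/(_ k): H1; move/(le_RQE _ HA)/(_ k): H2.
by rewrite qv_zero qv_one; lra.
Qed.

Lemma mkReal a : QF 1 (fun v => a (v 0%N)) -> fast a ->
  exists A, [/\ dset M A, isRealM A & realSeq A a].
Proof.
move=> [p [n [d [Hp Hn Hd E]]]] Ha.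
pose q k := MRat (p (fun=> k)) (n (fun=> k)) (d (fun=> k)).
have Eq k : a k = qv (q k) by rewrite -(E (fun=> k)).
have K (g : (nat -> N) -> N) : RF 1 g -> RF 2 (fun v => g (fun=> v 0%N)).
  move=> Hg.
  by apply: (@S1_ren M 2 3 (fun i : nat => match i with O => O | _ => 1%N end) _ _ Hg); case=> [|[]].
exists (setp (fun k m => m = codeM (q k))).
have HA k m : setp (fun k m => m = codeM (q k)) (pairM k m) <-> m = codeM (q k) by exact: setpE.
have HS : realSeq (setp (fun k m => m = codeM (q k))) a.
  split=> // [k|k r /HA /code_inj -> //].
  by exists (q k); split=> //; apply/HA.
split=> //.
- apply: setp_dset; rewrite /codeM /=; apply: D1_eq; first exact: RF_var.
  by apply: RF_pair; [apply: RF_pair|]; exact: K.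
- split; [split; first exact: setp_rel|].
    split=> [k|k m m' /HA -> /HA -> //]; by exists (codeM (q k)); apply/HA.
  split=> [k m /HA ->|k i m r r']; first by exists (q k).
  move=> /HA /code_inj -> /HA /code_inj -> /pow2_hf Em.
  rewrite /rdist_leM !rleE !qv_add Em -!Eq.
  by have := Ha k i; rewrite ler_norml; lra.
Qed.

End Reals.

(* [lra] compares atoms up to conversion; the defined atoms are generalized first. *)
Ltac qgen :=
  repeat match goal with H : is_true (Order.le _ _) |- _ => revert H
                       | H : is_true (Order.lt _ _) |- _ => revert H end;
  repeat match goal with
  | |- context [qv ?a] => generalize (qv a)
  | |- context [hf ?a] => generalize (hf a)
  | |- context [iN ?a] => generalize (iN a)
  end.
Ltac qlra := qgen; intros; lra.
Ltac qnra := qgen; intros; nra.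
(** * Gauges from Lipschitz approximations *)

Section Gauge.
Variable M : rcaModel.
Hypothesis cousin : cousinM M.
Local Notation N := (dom M).
Local Notation F := (QM M).
Local Notation env := (nat -> N).

Lemma QF_tl k (h : env -> F) : QF k h -> QF k.+1 (fun v => h (tl v)).
Proof.
move=> [p [n [d [? ? ? E]]]].
exists (fun v => p (tl v)), (fun v => n (tl v)), (fun v => d (tl v)).
by split=> //; exact: RF_tl.
Qed.

Lemma realSeq_QF (X : N -> Prop) x : dset M X -> isRealM X -> realSeq X x ->
  QF 1 (fun v => x (v 0%N)).
Proof.
move=> HX [[_ [_ Hu]] _] [H1 H2 _].
have [q Hq] := choice H1.
exists (fun v => mpos (q (v 0%N))), (fun v => mneg (q (v 0%N))), (fun v => mden (q (v 0%N))).
have E k r : X (pairM k (codeM r)) <-> r = q k.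
  split=> [H|->]; last by case: (Hq k).
  by apply: code_inj; exact: Hu H (proj1 (Hq k)).
split.
- apply: S1_ext (_ : S1 2 (fun v => exists n d,
    X (pairM (v 1%N) (pairM (pairM (v 0%N) n) d)))) _; first by def.
  move=> v; split=> [[n [d /(E _ (MRat _ _ _)) <-]] //|->].
  exists (mneg (q (v 1%N))), (mden (q (v 1%N))); apply/(E _ (MRat _ _ _)).
  by case: (q _).
- apply: S1_ext (_ : S1 2 (fun v => exists n d,
    X (pairM (v 1%N) (pairM (pairM n (v 0%N)) d)))) _; first by def.
  move=> v; split=> [[n [d /(E _ (MRat _ _ _)) <-]] //|->].
  exists (mpos (q (v 1%N))), (mden (q (v 1%N))); apply/(E _ (MRat _ _ _)).
  by case: (q _).
- apply: S1_ext (_ : S1 2 (fun v => exists n d,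
    X (pairM (v 1%N) (pairM (pairM n d) (v 0%N))))) _; first by def.
  move=> v; split=> [[n [d /(E _ (MRat _ _ _)) <-]] //|->].
  exists (mpos (q (v 1%N))), (mneg (q (v 1%N))); apply/(E _ (MRat _ _ _)).
  by case: (q _).
- by move=> v; rewrite (proj2 (Hq _)); case: (q _).
Qed.

(** [collection] for a Sigma_1 matrix that need not be monotone; the conclusion accordingly only
    bounds the witnesses. *)
Lemma S1_collect (P : N -> N -> Prop) b : S1 2 (fun v => P (v 0%N) (v 1%N)) ->
  (forall x, (x < b)%M -> exists c, P c x) ->
  exists c, forall x, (x < b)%M -> exists c', (c' < c)%M /\ P c' x.
Proof.
move=> HP H.
suff K n : exists c, forall x, (x < n)%M -> (x < b)%M -> exists c', (c' < c)%M /\ P c' x.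
  by have [c Hc] := K b; exists c => x Hx; exact: Hc.
elim/induct: n => [||n [c Hc]].
- apply: S1_ex; apply: S1_ball; first by def.
  apply: S1_imp; first by def.
  apply: S1_bex; first by def.
  apply: (@S1_ren M 2 4 (fun i => i) _ _ HP); by case=> [|[]].
- by exists 0%M => x Hx; exfalso; nlra.
- case: (pselect (n < b)%M) => Hn.
    have [c' Hc'] := H n Hn; exists (c + c' + 1)%M => x /mltS [Hx|->] Hxb.
      by have [d [Hd Pd]] := Hc x Hx Hxb; exists d; split=> //; nlra.
    by exists c'; split=> //; nlra.
  by exists c => x /mltS [Hx|->] // Hxb; exact: Hc.
Qed.

Section Approximations.
Variable phi : N -> N -> F -> F.
(** This is 4^s, matched to the spacing 4^-s of the base-4 points of level [s]. *)
Definition lip (s : N) : F := iN (e2 (s + s)%M).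
Hypothesis phi_lip : forall n s x y, `|phi n s x - phi n s y| <= lip s * `|x - y|.
Hypothesis phi_QF : forall k (n s : env -> N) (x : env -> F),
  RF k n -> RF k s -> QF k x -> QF k (fun v => phi (n v) (s v) (x v)).

(** Says that at the real [x] the function [phi n s] is within [e] of [y]. The term [lip s * hf k]
    is the error of replacing the real by its approximation [x k]. *)
Definition VB n s (x : N -> F) (y e : F) :=
  forall k, `|phi n s (x k) - y| <= e + lip s * hf k.
Definition LVB (x : N -> F) y e := exists n0, forall n, (n0 <= n)%M ->
  exists s0, forall s, (s0 <= s)%M -> VB n s x y e.

Hypothesis conv1 : forall X x, dset M X -> inUnitM X -> realSeq X x ->
  forall n (eps : F), 0 < eps -> exists y s0, forall s, (s0 <= s)%M -> VB n s x y eps.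
Hypothesis conv2 : forall X x, dset M X -> inUnitM X -> realSeq X x ->
  forall eps : F, 0 < eps -> exists y, LVB x y eps.
Hypothesis conv3 : forall X x, dset M X -> inUnitM X -> realSeq X x ->
  exists y e : F, e < y /\ LVB x y e.

Lemma lip_gt0 s : 0 < lip s. Proof. exact: e2_gt0. Qed.

Lemma lip_hf s j : lip s * hf (j + (s + s))%M = hf j.
Proof. by rewrite hf_add mulrCA /lip /hf mulfV ?mulr1 // lt0r_neq0 ?e2_gt0. Qed.

(** By the Lipschitz bound, the two inequalities force the ball [B(a, r)] into the closed ball about
    [b] of radius [t]. They are decidable, so the resulting code is a set of the model. *)
Definition mcond n s (a r b t : mrat M) : Prop :=
  (0 <= qv a /\ qv a <= 1 /\ 0 < qv r /\ 0 < qv t) /\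
  phi n s (qv a) <= qv b + qv t - lip s * qv r /\
  qv b - qv t + lip s * qv r <= phi n s (qv a).

Definition exq (m : N) (P : mrat M -> Prop) :=
  exists x, (x < m + 1)%M /\ exists y, (y < m + 1)%M /\ exists z, (z < m + 1)%M /\ P (MRat x y z).

Definition mcode n s m := exists i, (i < m + 1)%M /\
  exq m (fun a => exq m (fun r => exq m (fun b => exq m (fun t =>
    m = quintM i a r b t /\ mcond n s a r b t)))).

Lemma code_bounds (a : mrat M) m : (codeM a <= m)%M ->
  [/\ (mpos a < m + 1)%M, (mneg a < m + 1)%M & (mden a < m + 1)%M].
Proof.
move=> H; have H1 := pair_gel (mpos a) (mneg a); have H2 := pair_ger (mpos a) (mneg a).
have H3 := pair_gel (pairM (mpos a) (mneg a)) (mden a).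
have H4 := pair_ger (pairM (mpos a) (mneg a)) (mden a).
by split; apply: nle_ltS; apply: nle_trans H; rewrite /codeM //;
  exact: nle_trans H3.
Qed.

Lemma exq_intro m (P : mrat M -> Prop) a : (codeM a <= m)%M -> P a -> exq m P.
Proof.
move=> /code_bounds [H1 H2 H3] Ha; exists (mpos a); split=> //; exists (mneg a); split=> //.
by exists (mden a); split=> //; case: a Ha {H1 H2 H3}.
Qed.

Lemma mcodeE n s i a r b t : mcode n s (quintM i a r b t) <-> mcond n s a r b t.
Proof.
split=> [|H].
- move=> [i' [_]] [? [_ [? [_ [? [_ ]]]]]] [? [_ [? [_ [? [_ ]]]]]].
  move=> [? [_ [? [_ [? [_ ]]]]]] [? [_ [? [_ [? [_ ]]]]]] [E].
  move: E => /pair_inj [/pair_inj [/pair_inj [/pair_inj [_ /code_inj ->] /code_inj ->] /code_inj ->] /code_inj ->].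
  by [].
- have B1 := pair_ger (pairM (pairM (pairM i (codeM a)) (codeM r)) (codeM b)) (codeM t).
  have B2 := pair_gel (pairM (pairM (pairM i (codeM a)) (codeM r)) (codeM b)) (codeM t).
  have B3 := pair_gel (pairM (pairM i (codeM a)) (codeM r)) (codeM b).
  have B4 := pair_ger (pairM (pairM i (codeM a)) (codeM r)) (codeM b).
  have B5 := pair_gel (pairM i (codeM a)) (codeM r).
  have B6 := pair_ger (pairM i (codeM a)) (codeM r).
  have B7 := pair_gel i (codeM a); have B8 := pair_ger i (codeM a).
  have C3 := nle_trans B3 B2; have C5 := nle_trans B5 C3.
  exists i; split; first by apply: nle_ltS; exact: nle_trans B7 C5.
  have Ba : (codeM a <= quintM i a r b t)%M := nle_trans B8 C5.
  have Br : (codeM r <= quintM i a r b t)%M := nle_trans B6 C3.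
  have Bb : (codeM b <= quintM i a r b t)%M := nle_trans B4 B2.
  apply: (exq_intro Ba); apply: (exq_intro Br); apply: (exq_intro Bb).
  exact: (exq_intro (a := t) B1).
Qed.

Definition gcode : N -> Prop := setp (fun z n =>
  exists m, (m < z + 1)%M /\ exists s, (s < z + 1)%M /\ (z = pairM m s /\ mcode n s m)).

Lemma gcodeE n s m : sliceM (sliceM gcode n) s m <-> mcode n s m.
Proof.
rewrite /sliceM /gcode setpE; split=> [[m' [_ [s' [_ [/pair_inj [-> ->] //]]]]]|H].
have B1 := pair_gel m s; have B2 := pair_ger m s.
by exists m; split; [exact: nle_ltS|exists s; split; [exact: nle_ltS|]].
Qed.

#[local] Hint Extern 1 (QF _ (fun v => phi _ _ _)) => apply: phi_QF; def : defdb.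

Lemma gcode_dset : dset M gcode.
Proof.
apply: setp_dset; rewrite /mcode /exq /mcond /quintM /codeM /lip /=.
by def.
Qed.

Lemma mapsE n s a r b t : mapsM (sliceM (sliceM gcode n) s) a r b t <-> mcond n s a r b t.
Proof.
split=> [[i]|H]; first by rewrite gcodeE mcodeE.
by exists 0%M; rewrite gcodeE mcodeE.
Qed.

Ltac qgen ::=
  repeat match goal with H : is_true (Order.le _ _) |- _ => revert H
                       | H : is_true (Order.lt _ _) |- _ => revert H end;
  repeat match goal with
  | |- context [lip ?a] => generalize (lip a)
  | |- context [phi ?n ?s ?a] => generalize (phi n s a)
  | |- context [qv ?a] => generalize (qv a)
  | |- context [hf ?a] => generalize (hf a)
  | |- context [iN ?a] => generalize (iN a)
  end.

Section Point.
Variables (X : N -> Prop) (x : N -> F).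
Hypothesis (HX : dset M X) (HU : inUnitM X) (Hx : realSeq X x).

Lemma x_fast : fast x. Proof. by case: Hx. Qed.

Lemma x_near k l : `|x k - x l| <= hf k + hf l.
Proof.
have Hk := hf_gt0 k; have Hl := hf_gt0 l.
case: (le_lt k l) => H; first by have := fast_dist x_fast H; qlra.
have : (l <= k)%M by nlra.
by move/(fast_dist x_fast); rewrite distrC; qlra.
Qed.

Lemma x_lt_sup k (b : F) : (exists j, x j + hf j < b) -> x k < b + hf k.
Proof. by move=> [j Hj]; have := x_near k j; rewrite ler_norml; qlra. Qed.
Lemma x_gt_inf k (b : F) : (exists j, b + hf j < x j) -> b - hf k < x k.
Proof. by move=> [j Hj]; have := x_near k j; rewrite ler_norml; qlra. Qed.

(* The ball of radius [4 * 2^-k] around the truncation of [x k] to [0,1]. *)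
Lemma good_ball n s k : exists a r b t,
  mcond n s a r b t /\ dist_RQ_ltM X a r /\ qv t = 4 * lip s * hf k /\
  `|qv a - x k| <= hf k /\ qv b = phi n s (qv a).
Proof.
have /andP [H1 H2] := inUnitE Hx HU k; have Hk := hf_gt0 k; have Hs := lip_gt0 s.
have [a [Ha [Ha0 Ha1]]] : exists a, `|qv a - x k| <= hf k /\ (0 <= qv a /\ qv a <= 1).
  case: (lerP (x k) 0) => H0.
    exists (rzeroM M); rewrite qv_zero ler_norml; split; [apply/andP; split|split]; qlra.
  case: (lerP (x k) 1) => H3; last first.
    exists (roneM M); rewrite qv_one ler_norml; split; [apply/andP; split|split]; qlra.
  have [a Ea] := qv_surj (x k); exists a; rewrite -Ea subrr normr0.
  by split; [|split]; qlra.
have [r Er] := qv_surj (4 * hf k); have [b Eb] := qv_surj (phi n s (qv a)).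
have [t Et] := qv_surj (4 * lip s * hf k).
exists a, r, b, t; split; [|split; [|by []]].
- rewrite /mcond -Er -Eb -Et.
  have Hp : 0 < lip s * hf k by rewrite mulr_gt0.
  split; first by split=> //; split=> //; split; qlra.
  by split; qlra.
- move: Ha; rewrite ler_norml => /andP [Ha2 Ha3].
  split; [apply/(lt_QRE _ Hx)|apply/(lt_RQE _ Hx)]; exists k;
  by rewrite ?qv_sub ?qv_add -Er; qlra.
Qed.

(** The ball of [good_ball] contributes the radius [4 * lip s * hf k] of its image, and the passage
    from its centre to [x k] one more [lip s * hf k]. *)
Lemma value_near n s Y y : isValueM (sliceM (sliceM gcode n) s) X Y -> realSeq Y y ->
  forall k j, `|y j - phi n s (x k)| <= 5 * lip s * hf k + hf j.
Proof.
move=> [_ HV] Hy k j; have [a [r [b [t [H1 [H2 [Et [Ha Eb]]]]]]]] := good_ball n s k.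
have [] : dist_RQ_leM Y b t by apply: (HV a r) => //; exact/mapsE.
move=> /(le_QRE _ Hy)/(_ j) H3 /(le_RQE _ Hy)/(_ j); move: H3.
rewrite qv_sub qv_add Eb Et => H3 H4.
have := phi_lip n s (qv a) (x k).
have : lip s * `|qv a - x k| <= lip s * hf k by rewrite ler_pM2l ?lip_gt0.
move=> H5 H6; have : `|phi n s (qv a) - phi n s (x k)| <= lip s * hf k by qlra.
rewrite !ler_norml => /andP [H7 H8]; apply/andP; split; qlra.
Qed.

Lemma value_VB n s Y y z e : isValueM (sliceM (sliceM gcode n) s) X Y -> realSeq Y y ->
  VB n s x z e -> forall j, `|y j - z| <= e + 2 * hf j.
Proof.
move=> HV Hy H j; have Hs := lip_gt0 s; have Hj := hf_gt0 j.
(* Five parts of the error come from [value_near], the sixth from [VB]. *)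
have [k Hk] : exists k, hf k < hf j / (6 * lip s).
  by apply: hf_small; rewrite divr_gt0 //; qlra.
have := value_near HV Hy k j; have := H k.
move: Hk; rewrite ltr_pdivlMr; last by qlra.
by rewrite !ler_norml => Hk /andP [H1 H2] /andP [H3 H4]; apply/andP; split; qnra.
Qed.

Lemma value_ex n s : exists Y y, [/\ dset M Y, isValueM (sliceM (sliceM gcode n) s) X Y,
  realSeq Y y & forall j, y j = phi n s (x (j + (s + s))%M)].
Proof.
have HR : isRealM X by case: HU.
have Hq := realSeq_QF HX HR Hx.
(* Advancing the index by [s + s] divides the error by [lip s], which restores the fast rate of
   convergence after applying [phi n s]. *)
have [||Y [HY HYR Hy]] := @mkReal M (fun j => phi n s (x (j + (s + s))%M)).
- apply: phi_QF; try exact: RF_const.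
  by apply: (QF_comp1 Hq); def.
- move=> k i; apply: le_trans (phi_lip _ _ _ _) _.
  rewrite -[leRHS](lip_hf s) ler_pM2l ?lip_gt0 //.
  by apply: (fast_dist x_fast); nlra.
exists Y, (fun j => phi n s (x (j + (s + s))%M)); split=> //; split=> //.
move=> a r b t /mapsE [_ [H1 H2]] [/(lt_QRE _ Hx) Hl /(lt_RQE _ Hx) Hu].
have K j : `|phi n s (x (j + (s + s))%M) - phi n s (qv a)| <= lip s * qv r + hf j.
  apply: le_trans (phi_lip _ _ _ _) _; rewrite -(lip_hf s) -mulrDr ler_pM2l ?lip_gt0 //.
  move: (x_gt_inf (j + (s + s))%M Hl) (x_lt_sup (j + (s + s))%M Hu).
  by rewrite qv_sub qv_add ler_norml => *; apply/andP; split; qlra.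
split; [apply/(le_QRE _ Hy)|apply/(le_RQE _ Hy)] => j; have := K j;
  rewrite ?qv_sub ?qv_add ler_norml => /andP [? ?]; qlra.
Qed.

Lemma VB_inBall0 n s z t : forall e, VB n s x (qv z) e -> e < qv t ->
  inBall0M (sliceM (sliceM gcode n) s) X z t.
Proof.
move=> e H Het; have [Y [y [HY HV Hy Ey]]] := value_ex n s.
have [k Hk] : exists k, hf k < (qv t - e) / 2 by apply: hf_small; qlra.
have := H (k + (s + s))%M; rewrite lip_hf -Ey ler_norml => /andP [H1 H2].
exists Y; split=> //; split=> //; split; [apply/(lt_QRE _ Hy)|apply/(lt_RQE _ Hy)];
  by exists k; rewrite ?qv_sub ?qv_add; qlra.
Qed.

Lemma LVB_inBall1 z t e : LVB x (qv z) e -> e < qv t ->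
  exists n0, forall n, (n0 <= n)%M -> inBall1M (sliceM gcode n) X z t.
Proof.
move=> [n0 H] Het; exists n0 => n /H [s0 Hs0].
have [t' Et'] := qv_surj ((qv t + e) / 2); exists t'; split; first by rewrite rltE -Et'; qlra.
by exists s0 => s /Hs0 HV; apply: VB_inBall0 HV _; rewrite -Et'; qlra.
Qed.

Lemma LVB_inBall2 z t e : LVB x (qv z) e -> e < qv t -> inBall2M gcode X z t.
Proof.
move=> H Het; have [t' Et'] := qv_surj ((qv t + e) / 2).
exists t'; split; first by rewrite rltE -Et'; qlra.
by apply: LVB_inBall1 H _; rewrite -Et'; qlra.
Qed.

End Point.

Lemma gcode_cont n s : isContinuousM (sliceM (sliceM gcode n) s).
Proof.
have Hs := lip_gt0 s; split.
- split.
    move=> m /gcodeE [i' [_]] [? [_ [? [_ [? [_ ]]]]]] [? [_ [? [_ [? [_ ]]]]]].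
    move=> [? [_ [? [_ [? [_ ]]]]]] [? [_ [? [_ [? [_ ]]]]]] [-> [[? [? [? ?]]] _]].
    do 5 eexists; split; first reflexivity.
    by rewrite /isUnitBallM !rleE !rltE qv_zero qv_one.
  split; [|split].
  + move=> a r b t b' t' /mapsE [[_ [_ [Hr _]]] [H1 H2]] /mapsE [_ [H3 H4]].
    rewrite /rdist_leM !rleE !qv_add; split; qnra.
  + move=> a r b t a' r' /mapsE [[_ [_ [Hr Ht]]] [H1 H2]] [].
    rewrite !rleE rltE qv_zero qv_one => H3 [H4 H5] [].
    rewrite !rltE !qv_add => H6 H7; apply/mapsE; split; first by [].
    have := phi_lip n s (qv a) (qv a').
    have : lip s * `|qv a - qv a'| <= lip s * (qv r - qv r').
      by rewrite ler_pM2l // ler_norml; apply/andP; split; qlra.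
    move=> H8 H9; have : `|phi n s (qv a) - phi n s (qv a')| <= lip s * (qv r - qv r') by qlra.
    by rewrite ler_norml => /andP [H10 H11]; split; qlra.
  + move=> a r b t b' t' /mapsE [[K1 [K2 [K3 Ht]]] [H1 H2]] [].
    rewrite !rltE !qv_add => H6 H7; apply/mapsE; split; last by split; qlra.
    split; first exact: K1.
    split; first exact: K2.
    by split; [exact: K3|qlra].
- move=> X HX HU eps; rewrite rltE qv_zero => He.
  have [x Hx] := isReal_seq (proj1 HU).
  have [k Hk] : exists k, hf k < qv eps / (4 * lip s).
    by apply: hf_small; rewrite divr_gt0 //; qlra.
  have [a [r [b [t [H1 [H2 [Et _]]]]]]] := good_ball HU Hx n s k.
  exists a, r, b, t; split; first exact/mapsE.
  split=> //; rewrite rltE Et; move: Hk; rewrite ltr_pdivlMr; last by qlra.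
  by qnra.
Qed.

Lemma gcode_baire1 n : isBaire1M (sliceM gcode n).
Proof.
split=> [s|X HX HU eps]; first exact: gcode_cont.
rewrite rltE qv_zero => He; have [x Hx] := isReal_seq (proj1 HU).
have [z [s0 Hz]] := @conv1 X x HX HU Hx n (qv eps / 4) ltac:(qlra).
exists s0 => m s Hm Hs Y HY Z HZ HVY HVZ.
have [y Hy] := isReal_seq (proj1 HVY); have [w Hw] := isReal_seq (proj1 HVZ).
have By := value_VB HU Hx HVY Hy (Hz m Hm); have Bw := value_VB HU Hx HVZ Hw (Hz s Hs).
have [k Hk] : exists k, hf k < qv eps / 12 by apply: hf_small; qlra.
have [a Ea] := qv_surj (z - qv eps / 2).
move: (By k) (Bw k); rewrite !ler_norml => /andP [B1 B2] /andP [B3 B4].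
split; exists a; split.
- by apply/(lt_QRE _ Hw); exists k; rewrite -Ea; qlra.
- by apply/(lt_RQE _ Hy); exists k; rewrite qv_add -Ea; qlra.
- by apply/(lt_QRE _ Hy); exists k; rewrite -Ea; qlra.
- by apply/(lt_RQE _ Hw); exists k; rewrite qv_add -Ea; qlra.
Qed.

Lemma gcode_gauge : isGaugeM gcode.
Proof.
split; [split|].
- exact: gcode_baire1.
- move=> X HX HU eps; rewrite rltE qv_zero => He; have [x Hx] := isReal_seq (proj1 HU).
  have [z Hz] := @conv2 X x HX HU Hx (qv eps / 4) ltac:(qlra).
  have [a Ea] := qv_surj z; have [r Er] := qv_surj (qv eps / 2).
  exists a, r; rewrite !rltE qv_zero -Er; split; first by qlra.
  split; first by qlra.
  apply: (LVB_inBall1 HX HU Hx (e := qv eps / 4)); first by rewrite -Ea.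
  by rewrite -Er; qlra.
- move=> X HX HU; have [x Hx] := isReal_seq (proj1 HU).
  have [z [e [Hez Hz]]] := conv3 HX HU Hx; have [a Ea] := qv_surj z.
  exists a, a; split; first by rewrite rleE.
  by apply: (LVB_inBall2 HX HU Hx (e := e)); rewrite -Ea.
Qed.

(** The cover in terms of approximations. By Sigma_1 bounding, all radii exceed one [hf kap]. The
    gap [g] records that [rho], which bounds the distance from [Y] to [p i], is strictly below the
    radius, hence below the value of the gauge. *)
Lemma gauge_cover : exists l kap P, dset M P /\ exists p : N -> N -> F,
  (forall i, (i < l)%M -> inUnitM (sliceM P i) /\ realSeq (sliceM P i) (p i)) /\
  (forall Y y, dset M Y -> inUnitM Y -> realSeq Y y -> exists i, (i < l)%M /\ exists rho : F,
     (forall k, `|y k - p i k| <= rho + 2 * hf k) /\ exists g : F, 0 < g /\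
     forall z e, LVB (p i) z e -> forall r, e < r -> rho + g < z + r /\ hf kap < z + r).
Proof.
have [l [P [HP [R [HR [H1 [_ [H3 H4]]]]]]]] := cousin gcode_dset gcode_gauge.
have [kap Hkap] : exists kap, forall i, (i < l)%M -> exists k q,
    sliceM R i (pairM k (codeM q)) /\ hf kap + hf k < qv q.
  pose Q (c i : N) := exists k x y z,
    R (pairM (pairM k (pairM (pairM x y) z)) i) /\ hf c + hf k < qv (MRat x y z).
  have [|i Hi|kap Hkap] := @S1_collect Q l.
  - by rewrite /Q; def.
  - have [_ [HRi Hpos]] := H1 i Hi; have [r Hr] := isReal_seq HRi.
    move/(lt_QRE _ Hr): Hpos => [k]; rewrite qv_zero add0r => Hk.
    have [[x y z] [Hq Eq]] := (let: And3 h _ _ := Hr in h) k.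
    have [c Hc] : exists c, hf c < r k - hf k by apply: hf_small; qlra.
    by exists c, k, x, y, z; split=> //; rewrite -Eq; qlra.
  - exists kap => i /Hkap [c [Hc [k [x [y [z [Hk Hh]]]]]]].
    exists k, (MRat x y z); split; first exact: Hk.
    have : hf kap <= hf c by apply: hf_mono; nlra.
    by move=> H; qlra.
have K i : exists p, (i < l)%M -> realSeq (sliceM P i) p.
  case: (pselect (i < l)%M) => [Hi|?]; last by exists (fun=> 0).
  have [[HPi _] _] := H1 i Hi; have [p Hp] := isReal_seq HPi; by exists p.
have [p Hp] := choice K.
exists l, kap, P; split=> //; exists p; split.
  by move=> i Hi; split; [case: (H1 i Hi)|exact: Hp].
move=> Y y HY HU Hy; have [i [Hi [rho [Hrho [Hs1 Hs2]]]]] := H3 Y HY HU.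
have [HUi [HRi _]] := H1 i Hi; have [r Hr] := isReal_seq HRi.
exists i; split=> //; exists (qv rho); split.
- move=> k; have [a [/(lt_QRE _ (Hp i Hi)) A1 /(lt_RQE _ Hy) A2]] := Hs1.
  have [b [/(lt_QRE _ Hy) B1 /(lt_RQE _ (Hp i Hi)) B2]] := Hs2.
  move: (x_gt_inf (Hp i Hi) k A1) (x_lt_sup Hy k A2) (x_gt_inf Hy k B1) (x_lt_sup (Hp i Hi) k B2).
  by rewrite !qv_add ler_norml => *; apply/andP; split; qlra.
- move/(lt_QRE _ Hr): Hrho => [k0 Hk0].
  exists (r k0 - hf k0 - qv rho); split; first by qlra.
  move=> z e Hz t Het.
  have [zq Ez] := qv_surj z; have [tq Et] := qv_surj t.
  have : lt_RQM (sliceM R i) (raddM zq tq).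
    apply: (H4 i Hi); apply: (LVB_inBall2 (dset_slice i HP) HUi (Hp i Hi) (e := e)).
      by rewrite -Ez.
    by rewrite -Et.
  move/(lt_RQE _ Hr); rewrite qv_add -Ez -Et => Hlt; split.
  + by have := x_lt_sup Hr k0 Hlt; qlra.
  + have [k [q [Hq Hkq]]] := Hkap i Hi.
    have Eq := (let: And3 _ h _ := Hr in h) k q Hq; rewrite -Eq in Hkq.
    by have := x_lt_sup Hr k Hlt; qlra.
Qed.

End Approximations.
End Gauge.
(** * Binary strings and base-4 expansions *)

Section Strings.
Variable M : rcaModel.
Local Notation N := (dom M).
Local Notation F := (QM M).
Implicit Types (X Y : N -> Prop) (x y z u w k p q s t : N).

Definition q4 u : F := hf (u + u)%M.

Lemma q4_gt0 u : 0 < q4 u. Proof. exact: hf_gt0. Qed.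
Lemma q4_0 : q4 0%M = 1. Proof. by rewrite /q4 madd0 hf_0. Qed.
Lemma q4_S u : q4 (u + 1)%M = q4 u / 4.
Proof.
rewrite /q4 (_ : (u + 1 + (u + 1))%M = (u + u + 1 + 1)%M); last by nring.
by rewrite !hf_S; field.
Qed.
Lemma q4_hf u : q4 u = hf u * hf u. Proof. exact: hf_add. Qed.
Lemma q4_le_hf u : q4 u <= hf u.
Proof. by rewrite q4_hf; have := hf_le1 u; have := hf_gt0 u; nra. Qed.
Lemma q4_mono u w : (u <= w)%M -> q4 w <= q4 u.
Proof. by move=> H; apply: hf_mono; nlra. Qed.
Lemma lip_q4 u : lip u * q4 u = 1.
Proof. by rewrite /lip /q4 /hf mulfV // lt0r_neq0 ?e2_gt0. Qed.
Lemma lip_ge1 u : 1 <= lip u.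
Proof.
have H := lip_q4 u; have H1 : q4 u <= 1 by rewrite -q4_0; apply: q4_mono; nlra.
by have H2 := q4_gt0 u; have := lip_gt0 u; nra.
Qed.

Definition oddN q := exists t, q = (t + t + 1)%M.

Lemma oddN_or q : oddN q \/ exists t, q = (t + t)%M.
Proof.
suff [t [H|H]] : exists t, q = (t + t + 1)%M \/ q = (t + t)%M by [left; exists t|right; exists t].
elim/induct: q => [||q [t [->|->]]]; first by def.
- by exists 0%M; right; nring.
- by exists (t + 1)%M; right; nring.
- by exists t; left.
Qed.

Lemma oddN_even t : ~ oddN (t + t)%M.
Proof.
move=> [u E]; case: (lt_eq_gt t u) => [/mltE [z Ez]|[Ez|/mltE [z Ez]]];
  by rewrite Ez in E; nlra.
Qed.

Lemma oddN_add q t : oddN (q + (t + t))%M <-> oddN q.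
Proof.
split=> [H|[u ->]]; last by exists (u + t)%M; nring.
case: (oddN_or q) => // -[u E]; exfalso; apply: (@oddN_even (u + t)%M).
by rewrite (_ : (u + t + (u + t))%M = (q + (t + t))%M) // E; nring.
Qed.

(* The [k]-th binary digit of [x]. *)
Definition bit x k := exists t, (t < x + 1)%M /\ exists r, (r < e2 k)%M /\ x = ((t + t + 1) * e2 k + r)%M.

Lemma D1_bit (n : nat) f g : RF n f -> RF n g -> D1 n (fun v => bit (f v) (g v)).
Proof.
move=> Hf Hg; apply: (@comp2D1 M n bit f g) => //.
by rewrite /bit; def.
Qed.

Lemma bitE x k q r : x = (q * e2 k + r)%M -> (r < e2 k)%M -> bit x k <-> oddN q.
Proof.
move=> E Hr; split=> [[t [_ [r' [Hr' E']]]]|[t Et]].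
- exists t; rewrite E in E'; by case: (division_uniq E' Hr Hr').
- exists t; split; last by exists r; split=> //; rewrite E Et.
  have := e2_gt0 k; rewrite E Et => H.
  have {H} : (0 < e2 k)%M by apply/iN_lt; rewrite iN0.
  by move: (e2 k) => c Hc; nnra.
Qed.

Lemma bit_dset x : dset M (bit x).
Proof. by apply: setD1; apply: D1_bit; def. Qed.

#[local] Hint Extern 1 (D1 _ (fun v => bit _ _)) => apply: D1_bit; def : defdb.

Definition agree s x X := forall k, (k < s)%M -> (bit x k <-> X k).

Lemma agree_ex X s : dset M X -> exists x, (x < e2 s)%M /\ agree s x X.
Proof.
move=> HX; rewrite /agree; elim/induct: s => [||s [x [Hx H]]]; first by def.
  by exists 0%M; rewrite e2_0; split=> [|k Hk]; [nlra|exfalso; nlra].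
have Hs k : (k < s)%M -> exists w, e2 s = ((e2 w + e2 w) * e2 k)%M.
  move=> /mltE [w ->]; exists w; rewrite e2_add -e2_S.
  by nring.
case: (pselect (X s)) => HXs.
- exists (x + e2 s)%M; rewrite e2_S; split; first by nlra.
  move=> k /mltS [Hk|->]; last first.
    rewrite (@bitE _ s 1%M x) //; last by nring.
    by split=> // _; exists 0%M; nring.
  rewrite -H //; have [w Ew] := Hs k Hk.
  have [q [r [E Hr]]] : exists q r, x = (q * e2 k + r)%M /\ (r < e2 k)%M.
    by apply: division; apply/iN_lt; rewrite iN0 e2_gt0.
  rewrite (bitE E Hr) (@bitE _ k (q + (e2 w + e2 w))%M r) ?oddN_add //.
  by rewrite E Ew; nring.
- exists x; rewrite e2_S; split; first by nlra.
  move=> k /mltS [Hk|->]; first exact: H.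
  rewrite (@bitE _ s 0%M x) //; last by nring.
  split=> // [[t Ht]]; exfalso; nlra.
Qed.

Definition four : N := (1 + 1 + 1 + 1)%M.
Definition digit X u : N := if pselect (X u) then 1%M else 0%M.
Definition isCod X (f : N -> N) :=
  [/\ f 0%M = 0%M, forall u, f (u + 1)%M = (four * f u + digit X u)%M & RF 1 (fun v => f (v 0%N))].

Lemma cod_ex X : dset M X -> exists f, isCod X f.
Proof.
move=> HX; apply: (@primrec M 0%M (fun u y => four * y + digit X u)%M).
apply: RF_add; first by def.
by apply: RF_if; def.
Qed.

(** The first [u] digits of [X] read as a base-4 numeral. The default makes it total, so that it can
    be written for predicates not yet known to be sets. *)
Definition cod X : N -> N :=
  match pselect (exists f, isCod X f) with
  | left H => projT1 (cid H)
  | right _ => fun _ => 0%M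
  end.

Lemma codP X : dset M X -> isCod X (cod X).
Proof.
move=> /cod_ex H; rewrite /cod; case: pselect => [H'|[]]; last exact: H.
by case: (cid H').
Qed.

Definition dg X u : F := if pselect (X u) then 1 else 0.

Lemma iN_four : iN four = 4. Proof. by rewrite /four !iND iN1; lra. Qed.
Lemma cod_S X u : dset M X -> iN (cod X (u + 1)%M) = 4 * iN (cod X u) + dg X u.
Proof.
move=> /codP [_ -> _]; rewrite iND iNM iN_four /digit /dg.
by case: pselect => /= _; rewrite ?iN1 ?iN0.
Qed.
Lemma cod_0 X : dset M X -> cod X 0%M = 0%M. Proof. by move=> /codP []. Qed.
Lemma RF_cod X (n : nat) f : dset M X -> RF n f -> RF n (fun v => cod X (f v)).
Proof. by move=> /codP [_ _ H]; exact: RF_comp1. Qed.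

Lemma cod_agree X Y u : dset M X -> dset M Y -> (forall k, (k < u)%M -> (X k <-> Y k)) ->
  cod X u = cod Y u.
Proof.
move=> HX HY H; suff K w : (w <= u)%M -> cod X w = cod Y w by exact: K (nle_refl u).
have RX := @RF_cod X 1 _ HX (RF_var M (isT : (0 < 1)%N)).
have RY := @RF_cod Y 1 _ HY (RF_var M (isT : (0 < 1)%N)).
elim/induct: w => [||w IH Hw]; first by def.
  by rewrite !cod_0.
apply/iN_eq; rewrite (cod_S _ HX) (cod_S _ HY) IH; last by nlra.
congr (_ + _); rewrite /dg.
have Hk := H w ltac:(nlra).
by case: pselect => /= h1; case: pselect => /= h2 //; exfalso; tauto.
Qed.

Definition cd x u : N := cod (bit x) u.

(** [cod] is chosen separately for each set, so uniformity in a code [x] is not automatic; the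
    recursion is rewritten as one beta-coded computation from [x] and [u]. *)
Lemma RF_cd (n : nat) f g : RF n f -> RF n g -> RF n (fun v => cd (f v) (g v)).
Proof.
apply: RF_comp2.
apply: S1_ext (_ : S1 3 (fun v => exists c d, betaM c d 0%M 0%M /\ (betaM c d (v 2%N) (v 0%N) /\
  forall i, (i < v 2%N)%M -> exists y, betaM c d i y /\
    ((bit (v 1%N) i /\ betaM c d (i + 1)%M (four * y + 1)%M) \/
     (~ bit (v 1%N) i /\ betaM c d (i + 1)%M (four * y + 0)%M))))) _; first by def.
move=> v; set x := v 1%N; set u := v 2%N.
have HD := bit_dset x; have [C0 CS RC] := codP HD.
split=> [[c [d [H0 [Hu HS]]]]|E].
- suff K i : (i <= u)%M -> betaM c d i (cd x i) by exact: beta_uniq Hu (K u (nle_refl u)).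
  rewrite /cd; elim/induct: i => [||i IH Hi]; first by def.
    by rewrite C0.
  rewrite CS /digit; have [y [Hy H]] := HS i ltac:(nlra).
  rewrite (beta_uniq (IH ltac:(nlra)) Hy).
  by case: H => -[H1 H2]; case: pselect.
- have [c [d H]] := beta_lemma (u + 1)%M RC; exists c, d.
  split; first by rewrite -{2}C0; apply: H; nlra.
  split; first by rewrite E; apply: H; nlra.
  move=> i Hi; exists (cod (bit x) i); split; first by apply: H; nlra.
  have := H (i + 1)%M ltac:(nlra); rewrite CS /digit.
  by case: pselect => h1 h2; [left|right].
Qed.

(** The real with the base-4 digits 0 and 1 given by [X], truncated after [u] places. *)
Definition mp X u : F := iN (cod X u) * q4 u.

Lemma mp_S X u : dset M X -> mp X (u + 1)%M = mp X u + dg X u * (q4 u / 4).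
Proof. by move=> HX; rewrite /mp (cod_S _ HX) q4_S; field. Qed.

Lemma QF_mp X (n : nat) f : dset M X -> RF n f -> QF n (fun v => mp X (f v)).
Proof.
move=> HX Hf; apply: QF_mul; first by apply: QF_iN; exact: RF_cod.
by apply: QF_hf; exact: RF_add.
Qed.

(** Digits are at most 1, so the tail is at most the geometric sum of the powers 4^-(u+1), 4^-(u+2),
    ..., a third of 4^-u. *)
Lemma mp_tail X u w : dset M X ->
  mp X u <= mp X (u + w)%M /\ mp X (u + w)%M <= mp X u + (q4 u - q4 (u + w)%M) / 3.
Proof.
move=> HX; have RX (n : nat) f := @QF_mp X n f HX.
elim/induct: w => [||w [H1 H2]].
- have R1 : QF 1 (fun v => mp X (u + v 0%N)%M) by apply: RX; def.
  apply: D1_S1; apply: D1_and; apply: D1_qle => //; first exact: QF_const.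
  by rewrite /q4; def.
- by rewrite madd0; split; lra.
- have Hq := q4_gt0 (u + w)%M.
  rewrite maddA (mp_S _ HX) q4_S /dg; case: pselect => /= _; rewrite ?mul1r ?mul0r ?addr0;
    by move: H1 H2 Hq; move: (mp X _) (mp X _) (q4 _) (q4 _) => a1 a2 a3 a4 *; split; lra.
Qed.

(** At the first difference the numerals are one unit apart, and the later digits of [Y] recover at
    most a third of it. *)
Lemma mp_sep X Y p w : dset M X -> dset M Y -> (forall k, (k < p)%M -> (X k <-> Y k)) ->
  X p -> ~ Y p -> 2 / 3 * q4 (p + 1)%M <= mp X (p + 1 + w)%M - mp Y (p + 1 + w)%M.
Proof.
move=> HX HY Hag HXp HYp.
have [A1 _] := mp_tail (p + 1)%M w HX; have [_ A2] := mp_tail (p + 1)%M w HY.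
have E : mp X (p + 1)%M - mp Y (p + 1)%M = q4 (p + 1)%M.
  rewrite (mp_S _ HX) (mp_S _ HY) /mp (cod_agree HX HY Hag) q4_S /dg.
  by case: pselect => [/= _|/(_ HXp) []]; case: pselect => [/HYp []|/= _]; ring.
have H := q4_gt0 (p + 1 + w)%M.
by move: A1 A2 E H; move: (mp X _) (mp X _) (mp Y _) (mp Y _) (q4 _) (q4 _) => *; lra.
Qed.

Lemma cod_inj X Y u : dset M X -> dset M Y -> cod X u = cod Y u ->
  forall k, (k < u)%M -> (X k <-> Y k).
Proof.
move=> HX HY E k Hk; apply: contrapT => Hne.
have HP : S1 1 (fun v => ~ (X (v 0%N) <-> Y (v 0%N))) by def.
have [p [Hp Hl]] := least (P := fun k => ~ (X k <-> Y k)) HP Hne.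
have Hpk : (p <= k)%M by move=> /Hl.
have Hag j : (j < p)%M -> (X j <-> Y j) by move=> /Hl; rewrite not_notP.
have [w Ew] : exists w, u = (p + 1 + w)%M by apply/mleE; nlra.
have Em : mp X u = mp Y u by rewrite /mp E.
have Hq := q4_gt0 (p + 1)%M.
case: (pselect (X p)) => HXp; case: (pselect (Y p)) => HYp; try by tauto.
- by have := mp_sep w HX HY Hag HXp HYp; rewrite -Ew Em; lra.
- have Hag' j : (j < p)%M -> (Y j <-> X j) by move=> /Hag ->.
  by have := mp_sep w HY HX Hag' HYp HXp; rewrite -Ew Em; lra.
Qed.

Lemma mp_fast X : dset M X -> fast (mp X).
Proof.
move=> HX k i; have [H1 H2] := mp_tail k i HX.
have H3 := q4_le_hf k; have H4 := q4_gt0 (k + i)%M; have H5 := hf_gt0 k.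
by rewrite distrC ger0_norm; move: H1 H2 H3 H4 H5;
  move: (mp X _) (mp X _) (q4 _) (q4 _) (hf _) => *; lra.
Qed.

Lemma mp_real X : dset M X -> exists Y, [/\ dset M Y, inUnitM Y & realSeq Y (mp X)].
Proof.
move=> HX; have [|Y [H1 H2 H3]] := mkReal _ (mp_fast HX).
  by apply: QF_mp => //; exact: RF_var.
exists Y; split=> //; split=> //.
have B k : 0 <= mp X k /\ mp X k <= 1.
  have [A1 A2] := mp_tail 0%M k HX; rewrite !madd0l q4_0 in A1 A2.
  have E : mp X 0%M = 0 by rewrite /mp (cod_0 HX) iN0 mul0r.
  rewrite E in A1 A2; have Hq := q4_gt0 k; split; first exact: A1.
  by move: A2 Hq; move: (mp X _) (q4 _) => *; lra.
split; [apply/(le_QRE _ H3)|apply/(le_RQE _ H3)] => k; have [B1 B2] := B k; have Hh := hf_gt0 k.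
- by rewrite qv_zero; move: B1 Hh; move: (mp X k) (hf k) => *; lra.
- by rewrite qv_one; move: B2 Hh; move: (mp X k) (hf k) => *; lra.
Qed.

End Strings.

#[export] Hint Extern 1 (D1 _ (fun v => bit _ _)) => apply: D1_bit; def : defdb.
#[export] Hint Extern 1 (RF _ (fun v => cd _ _)) => apply: RF_cd; def : defdb.

(** * The gauge attached to a limit computation on strings *)

Section Argmin.
Variable M : rcaModel.
Local Notation N := (dom M).
Local Notation F := (QM M).

(** The last clause, that every smaller [y'] is beaten, makes the minimizer unique, which its
    definability rests on. *)
Definition isam (b : N) (g : N -> F) (y : N) :=
  (y < b)%M /\ (forall y', (y' < b)%M -> g y <= g y') /\
  (forall y', (y' < y)%M -> exists y'', (y'' < b)%M /\ g y'' < g y').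

Definition am b g : N :=
  match pselect (exists y, isam b g y) with
  | left H => projT1 (cid H)
  | right _ => 0%M
  end.

Lemma am_spec b g : (exists y, isam b g y) -> isam b g (am b g).
Proof. by move=> H; rewrite /am; case: pselect => [H'|[]]; [case: (cid H')|]. Qed.

Lemma isam_uniq b g y y' : isam b g y -> isam b g y' -> y = y'.
Proof.
move=> [H1 [H2 H3]] [H1' [H2' H3']]; case: (lt_eq_gt y y') => [/H3'|[//|/H3]].
- by move=> [z [Hz Hlt]]; exfalso; have := H2 z Hz; lra.
- by move=> [z [Hz Hlt]]; exfalso; have := H2' z Hz; lra.
Qed.

Lemma isam_ex b g : QF 1 (fun v => g (v 0%N)) -> (0 < b)%M -> exists y, isam b g y.
Proof.
move=> Hg Hb.
have QG (n : nat) f : RF n f -> QF n (fun v => g (f v)) by exact: QF_comp1.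
have [y [Hy Hmin]] : exists y, (y < b)%M /\ forall y', (y' < b)%M -> g y <= g y'.
  have [c ->] : exists c, b = (c + 1)%M.
    by case: (mcases b) => // E; rewrite E in Hb; exfalso; nlra.
  elim/induct: c => [||c [y [Hy H]]].
  - apply: S1_ex; apply: S1_and; first by def.
    apply: S1_ball; first by def.
    by apply: D1_S1; apply: D1_qle; apply: QG; def.
  - exists 0%M; split; first by nlra.
    by move=> y' Hy'; have -> : y' = 0%M by nlra.
  - case: (lerP (g y) (g (c + 1)%M)) => Hg1.
      exists y; split; first by nlra.
      by move=> y' /mltS [/H //|->].
    exists (c + 1)%M; split; first by nlra.
    by move=> y' /mltS [/H Hy'|-> //]; lra.
have HP : S1 1 (fun v => (v 0%N < b)%M /\ forall y', (y' < b)%M -> g (v 0%N) <= g y').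
  apply: S1_and; first by def.
  apply: S1_ball; first by def.
  by apply: D1_S1; apply: D1_qle; apply: QG; def.
have [z [[Hz Hz'] Hl]] := least (P := fun y => (y < b)%M /\ forall y', (y' < b)%M -> g y <= g y') HP
  (conj Hy Hmin).
exists z; split=> //; split=> // y' Hy'; apply: contrapT => Hn; apply: (Hl y' Hy').
split; first by nlra.
move=> y'' Hy''; rewrite leNgt; apply/negP => Hlt; apply: Hn.
by exists y''.
Qed.

Lemma RF_am (n : nat) (b : (nat -> N) -> N) (g : N -> (nat -> N) -> F) :
  RF n b -> QF n.+1 (fun v => g (v 0%N) (tl v)) ->
  (forall v, exists y, isam (b v) (fun y => g y v) y) ->
  RF n (fun v => am (b v) (fun y => g y v)).
Proof.
move=> Hb Hg Hex.
apply: S1_ext (_ : S1 n.+1 (fun v => isam (b (tl v)) (fun y => g y (tl v)) (v 0%N))) _; last first.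
  move=> v; have H := am_spec (Hex (tl v)).
  by split=> [H'|->]; [exact: isam_uniq H' H|exact: H].
have K (r : nat -> nat) m : (forall i, (i < n.+1)%N -> (r i < m)%N) ->
    QF m (fun v => g (v (r 0%N)) (fun i => v (r i.+1))).
  move=> Hr; have [p [q [d [Hp Hq Hd E]]]] := Hg.
  have R (h : (nat -> N) -> N) : RF n.+1 h -> RF m (fun v => h (fun i => v (r i))).
    move=> Hh; apply: (@S1_ren M n.+2 m.+1 (fun i => if i is j.+1 then (r j).+1 else 0%N) _ _ Hh).
    by case=> // i; exact: Hr.
  exists (fun v => p (fun i => v (r i))), (fun v => q (fun i => v (r i))), (fun v => d (fun i => v (r i))).
  by split; try exact: R; move=> v; rewrite -E.
rewrite /isam; apply: D1_S1; apply: D1_and.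
  by apply: D1_lt; [exact: RF_var|exact: RF_tl].
apply: D1_and.
- apply: D1_ball; first exact: RF_tl.
  apply: D1_qle.
    by apply: (K (fun i => i.+1)).
  by apply: (K (fun i => if i is j.+1 then j.+2 else 0%N)); case.
- apply: D1_ball; first exact: RF_var.
  apply: D1_bex; first exact: (RF_tl (RF_tl Hb)).
  apply: D1_qlt.
    by apply: (K (fun i => if i is j.+1 then j.+3 else 0%N)); case.
  by apply: (K (fun i => if i is j.+1 then j.+3 else 1%N)); case.
Qed.

End Argmin.

(** * The gauge, and its values on and off the Cantor set *)

Section Master.
Variable M : rcaModel.
Hypothesis cousin : cousinM M.
Local Notation N := (dom M).
Local Notation F := (QM M).
Implicit Types (X Y : N -> Prop) (y u w k p q s t n i : N) (z : F).

Variable c : N -> N -> N -> N.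
Hypothesis RFc : RF 3 (fun v => c (v 0%N) (v 1%N) (v 2%N)).

(** Distance of [z] from the interval of radius [q4 s / 2] about the point of the string [y]. Limits
    of strings extending [y] lie within [q4 s / 3] of that point, so the interval contains them with
    room to spare. *)
Definition ds s y z : F := Num.max 0 (`|z - iN (cd y s) * q4 s| - q4 s / 2).
(** With 64 the weight stays below 1/8, the penalty that [Wm] charges a wrong string, and twice the
    weight stays below the distance of strings that differ at or before place [d]. *)
Definition wt n s y : F := q4 (c n s y) / 64.
Definition Dm s z : F := ds s (am (e2 s) (fun y => ds s y z)) z.
(** Each string carries a spike of height [wt] and slope [lip s]; minimizing the negative finds the
    spike that is highest at [z]. *)
Definition Wam n s z : N := am (e2 s) (fun y => lip s * ds s y z - wt n s y).
Definition Wm n s z : F := wt n s (Wam n s z) - lip s * ds s (Wam n s z) z.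
(** The first part settles to the distance from the Cantor set; the second settles to the weight on
    that set and to nothing positive off it. *)
Definition phi n s z : F := Num.max (Dm s z) (Wm n s z).

Ltac glra :=
  intros;
  lazymatch goal with
  | |- _ /\ _ => split; glra
  | |- is_true (_ && _) => apply/andP; split; glra
  | |- _ => lra
  end.
Ltac gnra := intros; nra.

Lemma QF_q4 (m : nat) (f : (nat -> N) -> N) : RF m f -> QF m (fun v => q4 (f v)).
Proof. by move=> H; rewrite /q4; def. Qed.
Lemma QF_lip (m : nat) (f : (nat -> N) -> N) : RF m f -> QF m (fun v => lip (f v)).
Proof. by move=> H; rewrite /lip; def. Qed.
Lemma QF_ds (m : nat) f g h : RF m f -> RF m g -> QF m h -> QF m (fun v => ds (f v) (g v) (h v)).
Proof.
move=> Hf Hg Hh; rewrite /ds; have Hq := QF_q4 Hf.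
apply: QF_max; first exact: QF_const.
apply: QF_add; last by apply: QF_opp; apply: QF_mul => //; exact: QF_const.
apply: QF_norm; apply: QF_add => //; apply: QF_opp; apply: QF_mul => //.
by apply: QF_iN; exact: RF_cd.
Qed.
Lemma QF_wt (m : nat) f g h : RF m f -> RF m g -> RF m h -> QF m (fun v => wt (f v) (g v) (h v)).
Proof.
move=> Hf Hg Hh; apply: QF_mul; last exact: QF_const.
by apply: QF_q4; exact: (RF_comp3 RFc).
Qed.

Lemma e2_pos s : (0 < e2 s)%M. Proof. by apply/iN_lt; rewrite iN0 e2_gt0. Qed.

Lemma Dam_ex s z : exists y, isam (e2 s) (fun y => ds s y z) y.
Proof.
apply: isam_ex (e2_pos s); apply: QF_ds; [exact: RF_const|exact: RF_var|exact: QF_const].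
Qed.
Lemma Wam_ex n s z : exists y, isam (e2 s) (fun y => lip s * ds s y z - wt n s y) y.
Proof.
apply: isam_ex (e2_pos s); apply: QF_add; [apply: QF_mul; first exact: QF_const|apply: QF_opp].
  by apply: QF_ds; [exact: RF_const|exact: RF_var|exact: QF_const].
by apply: QF_wt; [exact: RF_const|exact: RF_const|exact: RF_var].
Qed.

Lemma phi_QF (m : nat) (n s : (nat -> N) -> N) (x : (nat -> N) -> F) :
  RF m n -> RF m s -> QF m x -> QF m (fun v => phi (n v) (s v) (x v)).
Proof.
move=> Hn Hs Hx.
have R1 : RF m (fun v => am (e2 (s v)) (fun y => ds (s v) y (x v))).
  apply: (@RF_am _ _ (fun v => e2 (s v)) (fun y v => ds (s v) y (x v))); first exact: RF_e2.
    by apply: QF_ds; [exact: RF_tl|exact: RF_var|exact: QF_tl].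
  by move=> v; exact: Dam_ex.
have R2 : RF m (fun v => Wam (n v) (s v) (x v)).
  apply: (@RF_am _ _ (fun v => e2 (s v))
    (fun y v => lip (s v) * ds (s v) y (x v) - wt (n v) (s v) y)); first exact: RF_e2.
    apply: QF_add; [apply: QF_mul; first by apply: QF_lip; exact: RF_tl|apply: QF_opp].
      by apply: QF_ds; [exact: RF_tl|exact: RF_var|exact: QF_tl].
    by apply: QF_wt; [exact: RF_tl|exact: RF_tl|exact: RF_var].
  by move=> v; exact: Wam_ex.
apply: QF_max; first exact: QF_ds.
apply: QF_add; first exact: QF_wt.
by apply: QF_opp; apply: QF_mul; [exact: QF_lip|exact: QF_ds].
Qed.

Lemma Dm_le s y z : (y < e2 s)%M -> Dm s z <= ds s y z.
Proof. by move=> Hy; have [_ [H _]] := am_spec (Dam_ex s z); exact: H. Qed.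
Lemma Dm_ex s z : exists y, (y < e2 s)%M /\ Dm s z = ds s y z.
Proof. by have [H _] := am_spec (Dam_ex s z); exists (am (e2 s) (fun y => ds s y z)). Qed.
Lemma Wm_ge n s y z : (y < e2 s)%M -> wt n s y - lip s * ds s y z <= Wm n s z.
Proof.
move=> Hy; have [_ [H _]] := am_spec (Wam_ex n s z).
have A : lip s * ds s (Wam n s z) z - wt n s (Wam n s z) <= lip s * ds s y z - wt n s y := H y Hy.
by rewrite /Wm; move: A; glra.
Qed.
Lemma Wm_ex n s z : exists y, (y < e2 s)%M /\ Wm n s z = wt n s y - lip s * ds s y z.
Proof. by have [H _] := am_spec (Wam_ex n s z); exists (Wam n s z). Qed.

Lemma ds_ge0 s y z : 0 <= ds s y z. Proof. by rewrite /ds le_max lexx. Qed.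
Lemma ds_ge s y z : `|z - iN (cd y s) * q4 s| - q4 s / 2 <= ds s y z.
Proof. by rewrite /ds le_max lexx orbT. Qed.
Lemma ds_le s y z (b : F) : 0 <= b -> `|z - iN (cd y s) * q4 s| - q4 s / 2 <= b -> ds s y z <= b.
Proof. by move=> H1 H2; rewrite /ds ge_max H1 H2. Qed.
Lemma Dm_ge0 s z : 0 <= Dm s z. Proof. exact: ds_ge0. Qed.

Lemma ds_lip s y z z' : ds s y z <= ds s y z' + `|z - z'|.
Proof.
apply: ds_le.
  by have := ds_ge0 s y z'; have := normr_ge0 (z - z'); glra.
have := ds_ge s y z'; have := ler_distD z' z (iN (cd y s) * q4 s).
by glra.
Qed.

Lemma Dm_lip s z z' : Dm s z <= Dm s z' + `|z - z'|.
Proof.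
have [y [Hy ->]] := Dm_ex s z'.
by apply: le_trans (Dm_le z Hy) _; exact: ds_lip.
Qed.

Lemma Wm_lip n s z z' : Wm n s z <= Wm n s z' + lip s * `|z - z'|.
Proof.
have [y [Hy ->]] := Wm_ex n s z; have := Wm_ge n z' Hy; have := ds_lip s y z' z.
rewrite distrC => H1 H2; have H3 := lip_gt0 s.
have : lip s * ds s y z' <= lip s * (ds s y z + `|z - z'|) by rewrite ler_pM2l.
by rewrite mulrDr; glra.
Qed.

Lemma phi_lip n s z z' : `|phi n s z - phi n s z'| <= lip s * `|z - z'|.
Proof.
have K a b : phi n s a <= phi n s b + lip s * `|a - b|.
  have H1 := Dm_lip s a b; have H2 := Wm_lip n s a b.
  have H3 : `|a - b| <= lip s * `|a - b|.
    by have := lip_ge1 s; have := normr_ge0 (a - b); gnra.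
  rewrite /phi ge_max; move: (le_max (Dm s b) (Dm s b) (Wm n s b)) (le_max (Wm n s b) (Dm s b) (Wm n s b)).
  rewrite !lexx orbT => /= H4 H5; apply/andP; split.
    by move: H1 H3 H4; glra.
  by move: H2 H5; glra.
have H1 := K z z'; have H2 := K z' z; rewrite (distrC z' z) in H2.
by rewrite ler_norml; move: H1 H2; glra.
Qed.

Lemma cd_agree X s y : dset M X -> agree s y X -> cd y s = cod X s.
Proof. by move=> HX H; apply: cod_agree => //; exact: bit_dset. Qed.

(** An interval of a later level lies in that of its initial segment, since [1 / 3 + 1 / 8 < 1 / 2];
    conversely, lengthening the string moves its point by at most a third of [q4 u]. *)
Lemma Dm_mono u w z : Dm u z <= Dm (u + 1 + w)%M z /\ Dm (u + 1 + w)%M z <= Dm u z + q4 u.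
Proof.
have Q1 := q4_gt0 u; have Q2 : q4 (u + 1 + w)%M <= q4 u / 4.
  by rewrite -q4_S; apply: q4_mono; nlra.
have Q3 := q4_gt0 (u + 1 + w)%M; rewrite -maddA in Q2 Q3 *.
have near X : dset M X -> `|mp X (u + (1 + w))%M - mp X u| <= q4 u / 3.
  move=> HX; have [A1 A2] := mp_tail u (1 + w)%M HX.
  by rewrite ger0_norm; move: A1 A2 Q3; glra.
split.
- have [y [Hy ->]] := Dm_ex (u + (1 + w))%M z.
  have [y0 [Hy0 Hag]] := agree_ex u (bit_dset y).
  apply: le_trans (Dm_le z Hy0) _; apply: ds_le; first exact: ds_ge0.
  rewrite (cd_agree (bit_dset y) Hag) -/(mp _ _).
  have := ds_ge (u + (1 + w))%M y z; rewrite -/(mp (bit y) _).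
  have := near _ (bit_dset y); have := ler_distD (mp (bit y) (u + (1 + w))%M) z (mp (bit y) u).
  by move: Q1 Q2; glra.
- have [y0 [Hy0 E0]] := Dm_ex u z.
  have [y [Hy Hag]] := agree_ex (u + (1 + w))%M (bit_dset y0).
  apply: le_trans (Dm_le z Hy) _; apply: ds_le.
    by have := Dm_ge0 u z; glra.
  rewrite (cd_agree (bit_dset y0) Hag) -/(mp _ _) E0.
  have := ds_ge u y0 z; rewrite -/(mp (bit y0) _).
  have := near _ (bit_dset y0); have := ler_distD (mp (bit y0) u) z (mp (bit y0) (u + (1 + w))%M).
  rewrite [`|mp _ u - mp _ _|]distrC.
  by move: Q1 Q2 Q3; glra.
Qed.

Lemma wt_le n s y : wt n s y <= 1 / 64.
Proof.
have : q4 (c n s y) <= 1 by rewrite -(q4_0 M); apply: q4_mono; nlra.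
by rewrite /wt; glra.
Qed.
Lemma wt_gt0 n s y : 0 < wt n s y.
Proof. by have := q4_gt0 (c n s y); rewrite /wt; glra. Qed.

Definition LimN n X d := exists s0, forall s, (s0 <= s)%M -> forall y, agree s y X -> c n s y = d.
Definition LimC X d := exists n0, forall n, (n0 <= n)%M -> LimN n X d.

Hypothesis lim1 : forall X, dset M X -> forall n, exists d, LimN n X d.
Hypothesis lim2 : forall X, dset M X -> exists d, LimC X d.

Section Point.
Variable x : N -> F.
Hypothesis Hfast : fast x.

(** As [x k] is within [hf k] of the real, this puts the real at distance 0 from every level, that
    is, in the Cantor set. *)
Definition onC := forall u k, Dm u (x k) <= hf k.

Lemma xnear k l : `|x k - x l| <= hf k + hf l.
Proof.
have Hk := hf_gt0 k; have Hl := hf_gt0 l.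
case: (le_lt k l) => H; first by have := fast_dist Hfast H; glra.
have : (l <= k)%M by nlra.
by move/(fast_dist Hfast); rewrite distrC; glra.
Qed.

Lemma Dm_near u k l : Dm u (x k) <= Dm u (x l) + hf k + hf l.
Proof.
have := Dm_lip u (x k) (x l); have := xnear k l.
by glra.
Qed.

Lemma hf_le_lip s k : hf k <= lip s * hf k.
Proof. by have H1 := lip_ge1 s; have H2 := hf_gt0 k; gnra. Qed.

(* Off the Cantor set [phi] settles to the distance to it; [g] bounds that
   distance from below. *)
Lemma off_VB : ~ onC -> exists g u0, 0 < g /\ forall u k0, (u0 < u)%M ->
  g <= Dm u (x k0) + hf k0 /\ exists s0, forall n s, (s0 <= s)%M ->
    VB phi n s x (Dm u (x k0)) (q4 u + hf k0).
Proof.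
move=> Hoff.
have [u [k Huk]] : exists u k, hf k < Dm u (x k).
  apply: contrapT => Hn; apply: Hoff => u k; rewrite leNgt; apply/negP => Hlt.
  by apply: Hn; exists u, k.
have [g Eg] : exists g, g = Dm u (x k) - hf k by eexists.
have Hg : 0 < g by rewrite Eg; glra.
have Gu j : g <= Dm u (x j) + hf j.
  by have := Dm_near u k j; rewrite Eg; glra.
have G u' j : (u < u')%M -> g <= Dm u' (x j) + hf j.
  move=> /mltE [w ->]; rewrite (_ : (u + (w + 1))%M = (u + 1 + w)%M); last by nring.
  have [H _] := Dm_mono u w (x j); have := Gu j.
  by glra.
exists g, u; split=> // u1 k0 Hu1; split; first exact: G.
have [m Hm] := hf_small Hg.
(* From this level on [q4 s < g], so at distance [g] the penalty is at least 1, more than any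
   weight. *)
exists (u1 + 1 + m)%M => n s Hs j; rewrite distrC.
have [w Ew] : exists w, s = (u1 + 1 + w)%M by apply/mleE; nlra.
have [D1 D2] := Dm_mono u1 w (x j); rewrite -Ew in D1 D2.
have D3 := Dm_near u1 j k0; have D4 := Dm_near u1 k0 j.
have Hjl := hf_le_lip s j; have Hj := hf_gt0 j; have Hk0 := hf_gt0 k0; have Hq := q4_gt0 u1.
have D5 := Dm_ge0 u1 (x k0).
have HW : Wm n s (x j) <= lip s * hf j.
  have [y [Hy ->]] := Wm_ex n s (x j).
  have A1 : g <= ds s y (x j) + hf j.
    have := G s j ltac:(nlra); have := Dm_le (x j) Hy.
    by glra.
  have A2 : 1 <= lip s * g.
    have B1 : q4 s <= hf m by apply: le_trans (q4_le_hf s) _; apply: hf_mono; nlra.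
    have B2 := lip_q4 s; have B3 := lip_gt0 s.
    rewrite -B2 ler_pM2l //; move: B1 Hm; glra.
  have A3 : lip s * g <= lip s * (ds s y (x j) + hf j) by rewrite ler_pM2l ?lip_gt0.
  rewrite mulrDr in A3; have := wt_le n s y.
  by glra.
rewrite /phi; case: (leP (Dm s (x j)) (Wm n s (x j))) => Hmax; rewrite ler_norml;
  move: D1 D2 D3 D4 Hjl Hj Hk0 Hq D5 HW Hmax;
  glra.
Qed.

Section On.
Hypothesis Hon : onC.

(** The window is asymmetric because later digits only move a point to the right. Its length is
    below the spacing [q4 u], so at most one numeral of level [u] qualifies. *)
Definition closeTo u X := forall k,
  - (q4 u / 16) - hf k <= x k - mp X u /\ x k - mp X u <= 3 / 8 * q4 u + hf k.

Lemma close_ex u : exists X, dset M X /\ closeTo u X.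
Proof.
(* Two levels deeper the interval has radius [q4 u / 32], and the two extra digits add at most
   [5 / 16 * q4 u]. This leaves room inside the window for the error [hf k0]. *)
have Q := q4_gt0 u; have E : q4 (u + 1 + 1)%M = q4 u / 16.
  by rewrite !q4_S; field.
have [k0 Hk0] : exists k0, hf k0 < q4 u / 1024.
  by apply: hf_small; glra.
have [y [Hy Ey]] := Dm_ex (u + 1 + 1)%M (x k0).
exists (bit y); split=> [|k]; first exact: bit_dset.
have A1 := Hon (u + 1 + 1)%M k0; rewrite Ey in A1.
have A2 := ds_ge (u + 1 + 1)%M y (x k0); rewrite -/(mp (bit y) _) E in A2.
have [A3 A4] := mp_tail u (1 + 1)%M (bit_dset y); rewrite maddA E in A3 A4.
have A5 := xnear k k0; rewrite ler_norml in A5; case/andP: A5 => A5 A6.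
have : `|x k0 - mp (bit y) (u + 1 + 1)%M| <= q4 u / 32 + hf k0.
  by move: A1 A2; glra.
rewrite ler_norml => /andP [A7 A8]; move: Q Hk0 A3 A4 A5 A6 A7 A8.
glra.
Qed.

(* Two level-[u] points near [x] have the same integer code. *)
Lemma close_uniq u X Y : (forall k, - (q4 u / 16) - hf k <= x k - mp X u /\
    x k - mp X u <= 1 / 2 * q4 u + hf k) -> closeTo u Y -> cod X u = cod Y u.
Proof.
move=> HX HY; have Q := q4_gt0 u.
have [k Hk] : exists k, hf k < q4 u / 16 by apply: hf_small; glra.
have [A1 A2] := HX k; have [A3 A4] := HY k.
have A : mp X u - mp Y u < q4 u /\ mp Y u - mp X u < q4 u.
  move: A1 A2 A3 A4 Hk Q; glra.
case: A; rewrite /mp -!mulrBl !gtr_pMl // => B1 B2.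
case: (lt_eq_gt (cod X u) (cod Y u)) => [/iN_ltS H|[//|/iN_ltS H]]; exfalso;
  by move: B1 B2 H; glra.
Qed.

(** The integer part of 4^(q+1) times the real, shifted by [1 / 3] to stay clear of integers, is the
    numeral of the first [q + 1] digits, and its parity is the last of these. The index makes the
    approximation accurate to [q4 (q + 1) / 4]. *)
Definition xbit (q : N) : Prop := exists t,
  iN (t + t + 1)%M <= lip (q + 1)%M * x (q + 1 + (q + 1) + 1 + 1)%M + 1 / 3 /\
  lip (q + 1)%M * x (q + 1 + (q + 1) + 1 + 1)%M + 1 / 3 < iN (t + t + 1)%M + 1.

Lemma xbit_cod q X : dset M X -> closeTo (q + 1)%M X -> xbit q <-> X q.
Proof.
move=> HX /(_ (q + 1 + (q + 1) + 1 + 1)%M) [A1 A2].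
have Q := q4_gt0 (q + 1)%M; have L := lip_gt0 (q + 1)%M; have LQ := lip_q4 (q + 1)%M.
have Eh : hf (q + 1 + (q + 1) + 1 + 1)%M = q4 (q + 1)%M / 4.
  by rewrite !hf_S /q4; field.
rewrite Eh in A1 A2; rewrite /xbit.
set xx := x _ in A1 A2 *; set l := lip _ in L LQ *; set qq := q4 _ in A1 A2 Q LQ.
have Em : l * mp X (q + 1)%M = iN (cod X (q + 1)%M).
  by rewrite /mp -/qq mulrCA LQ mulr1.
clearbody xx l qq.
(* In units of [q4 (q + 1)] the window and the error together span [[-5/16, 5/8]]; adding [1 / 3]
   moves this into [[1/48, 23/24]]. *)
have [B1 B2] : iN (cod X (q + 1)%M) + 1 / 48 <= l * xx + 1 / 3 /\
    l * xx + 1 / 3 <= iN (cod X (q + 1)%M) + 23 / 24.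
  have C1 : l * (- (qq / 16) - qq / 4) <= l * (xx - mp X (q + 1)%M) by rewrite ler_pM2l.
  have C2 : l * (xx - mp X (q + 1)%M) <= l * (3 / 8 * qq + qq / 4) by rewrite ler_pM2l.
  rewrite [l * (xx - _)]mulrBr Em in C1 C2.
  have E1 : l * (- (qq / 16) - qq / 4) = - (5 / 16) * (l * qq) by field.
  have E2 : l * (3 / 8 * qq + qq / 4) = 5 / 8 * (l * qq) by field.
  rewrite E1 LQ in C1; rewrite E2 LQ in C2.
  by move: C1 C2; glra.
have K : (exists t, iN (t + t + 1)%M <= l * xx + 1 / 3 /\ l * xx + 1 / 3 < iN (t + t + 1)%M + 1) <->
    oddN (cod X (q + 1)%M).
  split=> [[t [C1 C2]]|[t Et]].
    exists t; case: (lt_eq_gt (cod X (q + 1)%M) (t + t + 1)%M) => [/iN_ltS H|[//|/iN_ltS H]]; exfalso;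
      by move: B1 B2 C1 C2 H; glra.
  by exists t; rewrite -Et; move: B1 B2; glra.
rewrite K; have [_ CS _] := codP HX; rewrite CS /digit.
rewrite (_ : (four M * cod X q)%M = ((cod X q + cod X q) + (cod X q + cod X q))%M); last first.
  by rewrite /four; nring.
rewrite maddC oddN_add; case: pselect => /= h; split=> //.
- by move=> _; exists 0%M; nring.
- by move=> [t Et]; exfalso; nlra.
Qed.

(** Seen from a lower level, the window of level [u] may reach as far right as [1 / 2] of the
    spacing; this is why the first hypothesis of [close_uniq] is weaker than [closeTo]. *)
Lemma xbit_close u X : dset M X -> closeTo u X -> forall q, (q < u)%M -> (xbit q <-> X q).
Proof.
move=> HX HC q Hq; have [Y [HY HYc]] := close_ex (q + 1)%M.
rewrite (xbit_cod HY HYc).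
case: (lt_eq_gt (q + 1)%M u) => [/mltE [w Ew]|[E|H]]; last by exfalso; nlra.
- have Hc : cod X (q + 1)%M = cod Y (q + 1)%M.
    apply: close_uniq HYc => k; have [A1 A2] := HC k.
    have [A3 A4] := mp_tail (q + 1)%M (w + 1)%M HX; rewrite -Ew in A3 A4.
    have A5 : q4 u <= q4 (q + 1)%M / 4 by rewrite -q4_S; apply: q4_mono; nlra.
    have A6 := q4_gt0 u.
    move: A1 A2 A3 A4 A5 A6; glra.
  have := cod_inj HY HX (esym Hc) (k := q); apply; nlra.
- have Hc : cod X (q + 1)%M = cod Y (q + 1)%M.
    apply: close_uniq HYc => k; rewrite E; have [A1 A2] := HC k; have A6 := q4_gt0 u.
    move: A1 A2 A6; glra.
  have := cod_inj HY HX (esym Hc) (k := q); apply; nlra.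
Qed.

Lemma xbit_closeTo u : dset M xbit -> closeTo u xbit.
Proof.
move=> HB k; have [X [HX HC]] := close_ex u.
have Hag q : (q < u)%M -> (xbit q <-> X q) by exact: xbit_close.
by rewrite /mp (cod_agree HB HX Hag); exact: HC.
Qed.

(** The right string has its full weight at the real. A string with another numeral is at least
    [q4 s / 8] away, where its penalty exceeds its weight, and one with the same numeral has the
    same value of [c]. *)
Lemma on_VB n s d : dset M xbit -> (forall y, agree s y xbit -> c n s y = d) ->
  VB phi n s x (q4 d / 64) 0.
Proof.
move=> HB Hd k; rewrite add0r; have [y [Hy Hag]] := agree_ex s HB.
have [A1 A2] := xbit_closeTo s HB k; have Q := q4_gt0 s; have Hk := hf_gt0 k.
have L := lip_gt0 s; have LQ := lip_q4 s; have Hjl := hf_le_lip s k.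
have Ew : wt n s y = q4 d / 64 by rewrite /wt Hd.
have Wp := wt_gt0 n s y; rewrite Ew in Wp.
have Eds : ds s y (x k) <= hf k.
  apply: ds_le; first exact: ltW.
  rewrite (cd_agree HB Hag) -/(mp xbit s).
  have : `|x k - mp xbit s| <= 3 / 8 * q4 s + hf k.
    by rewrite ler_norml; move: A1 A2 Q Hk; glra.
  by glra.
have Hlds : lip s * ds s y (x k) <= lip s * hf k by rewrite ler_pM2l.
have B1 := Wm_ge n (x k) Hy; rewrite Ew in B1.
have B2 := Dm_le (x k) Hy.
have B3 : Wm n s (x k) <= q4 d / 64 + lip s * hf k.
  have [y' [Hy' ->]] := Wm_ex n s (x k).
  have Dp := ds_ge0 s y' (x k); have LDp : 0 <= lip s * ds s y' (x k) by rewrite mulr_ge0 // ltW.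
  case: (pselect (cd y' s = cd y s)) => Ecd.
    have Hag' : agree s y' xbit.
      move=> q Hq; rewrite -Hag //; exact: cod_inj (bit_dset y') (bit_dset y) Ecd q Hq.
    rewrite /wt (Hd _ Hag'); move: LDp Hk Hjl; glra.
  have C1 : q4 s <= `|iN (cd y' s) * q4 s - iN (cd y s) * q4 s|.
    rewrite -mulrBl normrM (gtr0_norm Q) ler_peMl ?(ltW Q) //.
    case: (lt_eq_gt (cd y' s) (cd y s)) => [/iN_ltS H|[//|/iN_ltS H]].
      by rewrite distrC ger0_norm; move: H; glra.
    by rewrite ger0_norm; move: H; glra.
  have C2 := ds_ge s y' (x k).
  have C3 : `|x k - iN (cd y s) * q4 s| <= 3 / 8 * q4 s + hf k.
    rewrite (cd_agree HB Hag) -/(mp xbit s) ler_norml.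
    by move: A1 A2 Q Hk; glra.
  have C4 := ler_distD (x k) (iN (cd y' s) * q4 s) (iN (cd y s) * q4 s).
  rewrite [`|_ - x k|]distrC in C4.
  have C5 : q4 s / 8 - hf k <= ds s y' (x k).
    by move: C1 C2 C3 C4; glra.
  have C6 : lip s * (q4 s / 8 - hf k) <= lip s * ds s y' (x k) by rewrite ler_pM2l.
  rewrite mulrBr mulrA LQ in C6; have C7 := wt_le n s y'.
  by move: C6 C7 Wp; glra.
rewrite /phi; case: (leP (Dm s (x k)) (Wm n s (x k))) => Hmax; rewrite ler_norml;
  move: Hjl Hk Hlds B1 B2 B3 Hmax Eds Wp;
  glra.
Qed.

End On.
End Point.

(** The complement is Sigma_1 as well: the integer part is then even, or the shifted value is
    negative. *)
Lemma QF_xbit_dset X x : dset M X -> isRealM X -> realSeq X x -> dset M (xbit x).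
Proof.
move=> HX HR Hx; have Hq := realSeq_QF HX HR Hx.
have QX (m : nat) (f : (nat -> N) -> N) : RF m f -> QF m (fun v => x (f v)) by exact: QF_comp1.
pose val q := lip (q + 1)%M * x (q + 1 + (q + 1) + 1 + 1)%M + 1 / 3.
have Qv (m : nat) (f : (nat -> N) -> N) : RF m f -> QF m (fun v => val (f v)).
  move=> Hf; apply: QF_add; last exact: QF_const.
  by apply: QF_mul; [apply: QF_lip|apply: QX]; def.
have Qo (m : nat) (f : (nat -> N) -> N) : RF m f -> QF m (fun v => iN (f v + f v + 1)%M).
  by move=> Hf; apply: QF_iN; def.
have Qe (m : nat) (f : (nat -> N) -> N) : RF m f -> QF m (fun v => iN (f v + f v)%M).
  by move=> Hf; apply: QF_iN; def.
apply: setD1; split.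
- apply: S1_ex; apply: S1_and; apply: D1_S1.
    by apply: D1_qle; [apply: Qo|apply: Qv]; def.
  by apply: D1_qlt; [apply: Qv; def|apply: QF_add; [apply: Qo; def|exact: QF_const]].
- apply: S1_ext (_ : S1 1 (fun v => val (v 0%N) < 0 \/ exists t,
     iN (t + t)%M <= val (v 0%N) /\ val (v 0%N) < iN (t + t)%M + 1)) _.
    apply: S1_or; first by apply: D1_S1; apply: D1_qlt; [apply: Qv; def|exact: QF_const].
    apply: S1_ex; apply: S1_and; apply: D1_S1.
      by apply: D1_qle; [apply: Qe|apply: Qv]; def.
    by apply: D1_qlt; [apply: Qv; def|apply: QF_add; [apply: Qe; def|exact: QF_const]].
  move=> v; rewrite /xbit -/(val (v 0%N)); move: (val (v 0%N)) => z; split.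
  + move=> [Hz [t [H1 _]]|[t [H1 H2]] [t' [H3 H4]]]; first by have := iN_ge0 (t + t + 1)%M; glra.
    have E : (t + t)%M = (t' + t' + 1)%M.
      case: (lt_eq_gt (t + t)%M (t' + t' + 1)%M) => [/iN_ltS H|[//|/iN_ltS H]]; exfalso;
        by move: H1 H2 H3 H4 H; glra.
    by apply: (@oddN_even _ t); exists t'.
  + move=> H; case: (lerP 0 z) => Hz; last by left.
    right; have [m Hm] := archimedes z.
    have HP : S1 1 (fun v => z < iN (v 0%N)).
      by apply: D1_S1; apply: D1_qlt; [exact: QF_const|apply: QF_iN; exact: RF_var].
    have [p [Hp Hl]] := least (P := fun m => z < iN m) HP Hm.
    case: (mcases p) => [E|[q E]]; first by move: Hp; rewrite E iN0; glra.
    have Hq' : iN q <= z by rewrite leNgt; apply/negP; apply: Hl; nlra.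
    rewrite E iND iN1 in Hp.
    case: (oddN_or q) => [[t Et]|[t Et]]; last by exists t; rewrite -Et.
    by exfalso; apply: H; exists t; rewrite -Et.
Qed.

Lemma conv_on X x : dset M X -> isRealM X -> realSeq X x -> onC x ->
  (forall n, exists d s0, forall s, (s0 <= s)%M -> VB phi n s x (q4 d / 64) 0) /\
  (forall d, LimC (xbit x) d -> LVB phi x (q4 d / 64) 0).
Proof.
move=> HX HR Hx Hon; have HB := QF_xbit_dset HX HR Hx.
have Hf : fast x by case: Hx.
split=> [n|d [n0 H]].
- have [d [s0 H]] := lim1 HB n; exists d, s0 => s /H Hs; exact: on_VB.
- by exists n0 => n /H [s0 Hs0]; exists s0 => s /Hs0 Hs; exact: on_VB.
Qed.

Lemma VB_weak n s x z (e e' : F) : e <= e' -> VB phi n s x z e -> VB phi n s x z e'.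
Proof.
by move=> He H k; apply: le_trans (H k) _; glra.
Qed.

Lemma off_small x (eps : F) : fast x -> ~ onC x -> 0 < eps -> exists g u k0,
  [/\ 0 < g, g <= Dm u (x k0) + hf k0, q4 u + hf k0 <= eps & exists s0, forall n s, (s0 <= s)%M ->
    VB phi n s x (Dm u (x k0)) (q4 u + hf k0)].
Proof.
move=> Hf Hoff He; have [g [u0 [Hg H]]] := off_VB Hf Hoff.
have [k Hk] : exists k, hf k < eps / 2 by apply: hf_small; glra.
have [k1 Hk1] : exists k, hf k < eps / 2 by apply: hf_small; glra.
have [H1 H2] := H (u0 + 1 + k1)%M k ltac:(nlra).
exists g, (u0 + 1 + k1)%M, k; split=> //.
have : q4 (u0 + 1 + k1)%M <= hf k1 by apply: le_trans (q4_le_hf _) _; apply: hf_mono; nlra.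
by move: Hk Hk1; glra.
Qed.

(** A point [p i] off the Cantor set has a radius at most its distance to that set, so its interval
    misses every [Y]. For [p i] on it, strings that differ at or before place [d] are too far apart
    for a radius of at most [q4 d / 64]; and [d] is below [kap] because the radii are bounded
    below. *)
Lemma master : exists l kap Xs, dset M Xs /\ forall Y, dset M Y ->
  exists i, (i < l)%M /\ exists d, (d < kap)%M /\ (LimC (sliceM Xs i) d /\
    forall q, (q < d + 1)%M -> (sliceM Xs i q <-> Y q)).
Proof.
have C1 X x : dset M X -> inUnitM X -> realSeq X x -> forall n (eps : F), 0 < eps ->
    exists (y : F) s0, forall s, (s0 <= s)%M -> VB phi n s x y eps.
  move=> HX HU Hx n eps He; have Hf : fast x by case: Hx.
  case: (pselect (onC x)) => Hon.
    have [H _] := conv_on HX (proj1 HU) Hx Hon; have [d [s0 Hd]] := H n.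
    by exists (q4 d / 64), s0 => s /Hd; apply: VB_weak; exact: ltW.
  have [g [u [k0 [_ _ Hs [s0 H]]]]] := off_small Hf Hon He.
  by exists (Dm u (x k0)), s0 => s /(H n); exact: VB_weak.
have C2 X x : dset M X -> inUnitM X -> realSeq X x -> forall eps : F, 0 < eps ->
    exists y : F, LVB phi x y eps.
  move=> HX HU Hx eps He; have Hf : fast x by case: Hx.
  case: (pselect (onC x)) => Hon.
    have [_ H] := conv_on HX (proj1 HU) Hx Hon.
    have [d Hd] := lim2 (QF_xbit_dset HX (proj1 HU) Hx); have [n0 Hn0] := H d Hd.
    exists (q4 d / 64), n0 => n /Hn0 [s0 Hs0]; exists s0 => s /Hs0.
    by apply: VB_weak; exact: ltW.
  have [g [u [k0 [_ _ Hs [s0 H]]]]] := off_small Hf Hon He.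
  by exists (Dm u (x k0)), 0%M => n _; exists s0 => s /(H n); exact: VB_weak.
have C3 X x : dset M X -> inUnitM X -> realSeq X x -> exists y e : F, e < y /\ LVB phi x y e.
  move=> HX HU Hx; have Hf : fast x by case: Hx.
  case: (pselect (onC x)) => Hon.
    have [_ H] := conv_on HX (proj1 HU) Hx Hon.
    have [d Hd] := lim2 (QF_xbit_dset HX (proj1 HU) Hx).
    by exists (q4 d / 64), 0; split; [have := q4_gt0 d; glra|exact: H].
  have [g [u0 [Hg H]]] := off_VB Hf Hon.
  have [k Hk] : exists k, hf k < g / 4 by apply: hf_small; glra.
  have [H1 [s0 H2]] := H (u0 + 1 + k)%M k ltac:(nlra).
  exists (Dm (u0 + 1 + k)%M (x k)), (q4 (u0 + 1 + k)%M + hf k); split; last first.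
    by exists 0%M => n _; exists s0 => s; exact: H2.
  have : q4 (u0 + 1 + k)%M <= hf k by apply: le_trans (q4_le_hf _) _; apply: hf_mono; nlra.
  by move: Hk H1; glra.
have [l [kap [P [HP [p [Hp Hcov]]]]]] := gauge_cover cousin phi_lip phi_QF C1 C2 C3.
(* The sequences [p i] come from choice, so a set uniform in [i] has to be read off the codes in [P]
   themselves. *)
have [Xs [HXs HXsE]] : exists Xs, dset M Xs /\
    forall i, (i < l)%M -> forall q, sliceM Xs i q <-> xbit (p i) q.
  pose lq q := (q + 1 + (q + 1) + 1 + 1)%M.
  pose rd (a b d q i : N) := P (pairM (pairM (lq q) (pairM (pairM a b) d)) i).
  pose vl (a b d q : N) := lip (q + 1)%M * qv (MRat a b d) + 1 / 3.
  pose R q i := (i < l)%M /\ xbit (p i) q.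
  have rdE a b d q i : (i < l)%M -> rd a b d q i -> vl a b d q = lip (q + 1)%M * p i (lq q) + 1 / 3.
    move=> Hi H; have [_ [_ H2 _]] := Hp i Hi.
    by rewrite /vl (H2 (lq q) (MRat a b d) H).
  have rdX q i : (i < l)%M -> exists a b d, rd a b d q i.
    move=> Hi; have [_ [H1 _ _]] := Hp i Hi; have [[a b d] [H _]] := H1 (lq q).
    by exists a, b, d.
  have Qvl (m : nat) (f1 f2 f3 f4 : (nat -> N) -> N) : RF m f1 -> RF m f2 -> RF m f3 -> RF m f4 ->
      QF m (fun v => vl (f1 v) (f2 v) (f3 v) (f4 v)).
    move=> *; apply: QF_add; last exact: QF_const.
    by apply: QF_mul; [apply: QF_lip; def|apply: QF_qv].
  exists (setp R); split; last first.
    by move=> i Hi q; rewrite /sliceM setpE /R; tauto.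
  apply: setp_dset; split.
  - apply: S1_ext (_ : S1 2 (fun v => (v 1%N < l)%M /\ exists a b d t, rd a b d (v 0%N) (v 1%N) /\
      (iN (t + t + 1)%M <= vl a b d (v 0%N) /\ vl a b d (v 0%N) < iN (t + t + 1)%M + 1))) _.
      apply: S1_and; first by def.
      do 4 apply: S1_ex; apply: S1_and; first by rewrite /rd /lq; def.
      apply: S1_and; apply: D1_S1; [apply: D1_qle; last by apply: Qvl; def|apply: D1_qlt; first by apply: Qvl; def].
        by def.
      by def.
    move=> v; split=> [[Hi [a [b [d [t [H1 H2]]]]]]|[Hi [t Ht]]].
      by split=> //; exists t; rewrite -(rdE _ _ _ _ _ Hi H1).
    split=> //; have [a [b [d H]]] := rdX (v 0%N) _ Hi.
    by exists a, b, d, t; rewrite (rdE _ _ _ _ _ Hi H).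
  - apply: S1_ext (_ : S1 2 (fun v => (l <= v 1%N)%M \/ ((v 1%N < l)%M /\ exists a b d, rd a b d (v 0%N) (v 1%N) /\
      (vl a b d (v 0%N) < 0 \/ exists t, iN (t + t)%M <= vl a b d (v 0%N) /\ vl a b d (v 0%N) < iN (t + t)%M + 1)))) _.
      apply: S1_or; first by def.
      apply: S1_and; first by def.
      do 3 apply: S1_ex; apply: S1_and; first by rewrite /rd /lq; def.
      apply: S1_or; first by apply: D1_S1; apply: D1_qlt; [apply: Qvl; def|exact: QF_const].
      apply: S1_ex; apply: S1_and; apply: D1_S1;
        [apply: D1_qle; last by apply: Qvl; def|apply: D1_qlt; first by apply: Qvl; def].
        by def.
      by def.
    move=> v; rewrite /R; set i := v 1%N; set q := v 0%N.
    case: (le_lt l i) => Hi; first by split; [move=> _ [H _]; nlra|left].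
    have [a0 [b0 [d0 H0]]] := rdX q i Hi.
    have HRi : isRealM (sliceM P i) by case: (Hp i Hi) => -[].
    have [_ HS] := Hp i Hi.
    split=> [[H|[_ [a [b [d [H]]]]]]|H].
    + by exfalso; nlra.
    + rewrite (rdE _ _ _ _ _ Hi H) => H' [_ [t]]; rewrite -/(lq q) => -[].
      move: (_ + 1 / 3) H' => z [Hz|[t' [A1 A2]]] A3 A4.
        by have := iN_ge0 (t + t + 1)%M; glra.
      apply: (@oddN_even _ t'); exists t.
      case: (lt_eq_gt (t' + t')%M (t + t + 1)%M) => [/iN_ltS HH|[//|/iN_ltS HH]]; exfalso;
        by move: A1 A2 A3 A4 HH; glra.
    + right; split=> //; exists a0, b0, d0; split=> //; rewrite (rdE _ _ _ _ _ Hi H0).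
      have Hn : ~ xbit (p i) q by tauto.
      move: Hn; rewrite /xbit -/(lq q); move: (_ + 1 / 3) => z Hn.
      case: (lerP 0 z) => Hz; last by left.
      right; have [m Hm] := archimedes z.
      have HPz : S1 1 (fun v => z < iN (v 0%N)).
        by apply: D1_S1; apply: D1_qlt; [exact: QF_const|apply: QF_iN; exact: RF_var].
      have [r [Hr Hl]] := least (P := fun m => z < iN m) HPz Hm.
      case: (mcases r) => [E|[r' E]]; first by move: Hr; rewrite E iN0; glra.
      have Hq' : iN r' <= z by rewrite leNgt; apply/negP; apply: Hl; nlra.
      rewrite E iND iN1 in Hr.
      case: (oddN_or r') => [[t Et]|[t Et]]; last by exists t; rewrite -Et.
      by exfalso; apply: Hn; exists t; rewrite -Et.
exists l, kap, Xs; split=> // Y HY.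
have [Yr [HYr HYU HYs]] := mp_real HY.
have [i [Hi [rho [Hrho [g [Hg Hb]]]]]] := Hcov _ _ HYr HYU HYs.
have [HUi Hpi] := Hp i Hi; have HPi := dset_slice i HP; have Hf : fast (p i) by case: Hpi.
case: (pselect (onC (p i))) => Hon; last first.
  exfalso; have [k Hk] := @hf_small M (g / 32) ltac:(glra).
  have [g0 [u0 [Hg0 Hoff]]] := off_VB Hf Hon.
  pose u := (u0 + 1 + k)%M.
  have Hqu : q4 u <= hf k by apply: le_trans (q4_le_hf _) _; apply: hf_mono; rewrite /u; nlra.
  have [_ [s0 Hs0]] := Hoff u k ltac:(rewrite /u; nlra).
  have HL : LVB phi (p i) (Dm u (p i k)) (q4 u + hf k).
    by exists 0%M => n _; exists s0 => s; exact: Hs0.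
  have [B1 _] := Hb _ _ HL (q4 u + hf k + g / 32) ltac:(glra).
  pose K := (u + k)%M.
  have HhK : hf K <= hf k by apply: hf_mono; rewrite /K; nlra.
  have B2 := Hrho K; have B3 := Dm_near Hf u k K.
  (* [Y] gives a point of the Cantor set, so the distance from [Y] to [p i] bounds that of [p i] to
     level [u], up to [q4 u]. *)
  have [y0 [Hy0 Hag]] := agree_ex u HY.
  have B4 : Dm u (p i K) <= `|mp Y K - p i K| + q4 u.
    apply: le_trans (Dm_le _ Hy0) _; apply: ds_le.
      by have := normr_ge0 (mp Y K - p i K); have := q4_gt0 u; glra.
    rewrite (cd_agree HY Hag) -/(mp Y u).
    have [A1 A2] := mp_tail u k HY; rewrite -/K in A1 A2.
    have A3 : `|mp Y K - mp Y u| <= q4 u / 3.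
      rewrite ger0_norm; have := q4_gt0 K; move: A1 A2; glra.
    have := ler_distD (mp Y K) (p i K) (mp Y u); rewrite [`|p i K - mp Y K|]distrC.
    have := q4_gt0 u.
    by move: A3; glra.
  have Hh := hf_gt0 k.
  move: Hk Hqu B1 HhK B2 B3 B4 Hh Hg; glra.
have HB : dset M (xbit (p i)) := QF_xbit_dset HPi (proj1 HUi) Hpi.
have [d Hd] := lim2 HB.
have [_ HL] := conv_on HPi (proj1 HUi) Hpi Hon.
have Hqd := q4_gt0 d.
(* Slack equal to the value bounds the distance by [q4 d / 32], still well below the separation,
   which is at least [q4 d / 6]. *)
have [B1 B2] := Hb _ _ (HL d Hd) (q4 d / 64) ltac:(glra).
exists i; split=> //; exists d; split.
  case: (le_lt kap d) => // Hle; exfalso.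
  have A1 : hf d <= hf kap by exact: hf_mono.
  have A2 := q4_le_hf d.
  by move: A1 A2 B2 Hqd; glra.
split.
  by rewrite (_ : sliceM Xs i = xbit (p i)) //; apply: funext => q; apply: propext; exact: HXsE.
move=> q Hq; rewrite HXsE //; apply: contrapT => Hne.
have HP0 : S1 1 (fun v => ~ (xbit (p i) (v 0%N) <-> Y (v 0%N))) by def.
have [r [Hr Hl]] := least (P := fun k => ~ (xbit (p i) k <-> Y k)) HP0 Hne.
have Hrq : (r <= q)%M by move=> /Hl.
have Hag j : (j < r)%M -> (xbit (p i) j <-> Y j) by move=> /Hl; rewrite not_notP.
have [k Hk] := @hf_small M (q4 d / 256) ltac:(glra).
pose K := (r + 1 + k)%M.
have HhK : hf K <= hf k by apply: hf_mono; rewrite /K; nlra.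
have A1 := Hrho K.
have [A2 A3] := xbit_closeTo Hf Hon K HB K.
have A4 := q4_le_hf K; have A5 := q4_gt0 K; have A6 := hf_gt0 K.
have A7 : q4 d / 4 <= q4 (r + 1)%M by rewrite -q4_S; apply: q4_mono; nlra.
have A8 : 2 / 3 * q4 (r + 1)%M <= `|mp (xbit (p i)) K - mp Y K|.
  case: (pselect (xbit (p i) r)) => H1; case: (pselect (Y r)) => H2; try by exfalso; tauto.
  - by apply: le_trans (mp_sep k HB HY Hag H1 H2) _; exact: ler_norm.
  - have Hag' j : (j < r)%M -> (Y j <-> xbit (p i) j) by move=> /Hag ->.
    by rewrite distrC; apply: le_trans (mp_sep k HY HB Hag' H2 H1) _; exact: ler_norm.
have A9 := ler_distD (p i K) (mp (xbit (p i)) K) (mp Y K).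
rewrite [`|p i K - mp Y K|]distrC in A9.
have A10 : `|mp (xbit (p i)) K - p i K| <= 2 * hf K.
  rewrite distrC ler_norml; move: A2 A3 A4 A5 A6; glra.
move: Hk HhK A1 A7 A8 A9 A10 B1 Hg; glra.
Qed.

End Master.

(** * Arithmetical comprehension *)

Section Pick.
Variable M : rcaModel.
Local Notation N := (dom M).

Definition pk (R : N -> Prop) : N :=
  match pselect (exists q, R q) with
  | left H => projT1 (cid H)
  | right _ => 0%M
  end.

Lemma pk_eq (R : N -> Prop) q : R q -> (forall q', R q' -> q' = q) -> pk R = q.
Proof.
move=> Hq Hu; rewrite /pk; case: pselect => [H|[]]; last by exists q.
by case: (cid H) => q' /= /Hu.
Qed.

(** Solvability has to be Delta_1 because the cases that fall back on the default 0 must be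
    recognized. *)
Lemma RF_pick (n : nat) (R : N -> (nat -> N) -> Prop) :
  D1 n.+1 (fun v => R (v 0%N) (tl v)) -> D1 n (fun v => exists q, R q v) ->
  (forall v q q', R q v -> R q' v -> q = q') -> RF n (fun v => pk (fun q => R q v)).
Proof.
move=> HR [HE HE'] Hu.
have K := @S1_ren M n n.+1 S _ (fun i Hi => Hi).
have H0 : S1 n.+1 (fun v : nat -> N => v 0%N = 0%M).
  by apply: D1_S1; apply: D1_eq; [exact: RF_var|exact: RF_const].
apply: S1_ext (S1_or (D1_S1 HR) (S1_and H0 (K _ HE'))) _ => v /=.
rewrite /pk; case: pselect => [H|H].
- case: (cid H) => q /= Hq; split=> [[H1|[_ []]]|->]; [exact: Hu H1 Hq|exact: H|by left].
- split=> [[H1|[-> _]]|->] //; first by exfalso; apply: H; exists (v 0%N).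
  by right.
Qed.
End Pick.

Section ACA.
Variable M : rcaModel.
Hypothesis cousin : cousinM M.
Local Notation N := (dom M).
Implicit Types (X Y : N -> Prop) (q p s y b d n : N).

Lemma cod_le X Y u : dset M X -> dset M Y -> (forall k, X k -> Y k) ->
  iN (cod X u) <= iN (cod Y u).
Proof.
move=> HX HY H.
have RX := @RF_cod M X 1 _ HX (RF_var M (isT : (0 < 1)%N)).
have RY := @RF_cod M Y 1 _ HY (RF_var M (isT : (0 < 1)%N)).
move: u; apply: (@induct M (fun u => iN (cod X u) <= iN (cod Y u) : Prop)) => [||u IH].
- by apply: D1_S1; apply: D1_qle; apply: QF_iN.
- by rewrite (cod_0 HX) (cod_0 HY).
- rewrite (cod_S _ HX) (cod_S _ HY) /dg; move: (H u).
  by case: pselect => /= h1; case: pselect => /= h2 h; try lra; exfalso; tauto.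
Qed.

Lemma cod_bound X u : dset M X -> (cod X u <= e2 (u + u))%M.
Proof.
move=> HX; apply/iN_le; have [_] := mp_tail 0%M u HX; rewrite madd0l.
have -> : mp X 0%M = 0 by rewrite /mp (cod_0 HX) iN0 mul0r.
rewrite q4_0 => H; have H1 := lip_q4 u; have H2 := q4_gt0 u; have H3 := lip_gt0 u.
have H4 : mp X u <= 1 by lra.
have H5 : lip u * mp X u <= lip u * 1 by rewrite ler_pM2l.
by move: H5; rewrite /mp mulrCA H1 !mulr1.
Qed.

Section Sigma.
Variable A : N -> N -> Prop.
Hypothesis HA : D1 2 (fun v => A (v 0%N) (v 1%N)).

Definition Hst s q := exists p, (p < s)%M /\ A q p.
Definition Hlim q := exists p, A q p.

Lemma D1_Hst (n : nat) f g : RF n f -> RF n g -> D1 n (fun v => Hst (f v) (g v)).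
Proof.
by move=> Hf Hg; apply: (@comp2D1 M n Hst f g) => //; rewrite /Hst; def.
Qed.
#[local] Hint Extern 1 (D1 _ (fun v => Hst _ _)) => apply: D1_Hst; def : defdb.

Lemma Hst_dset s : dset M (Hst s).
Proof. by apply: setD1; def. Qed.

Lemma Hst_mono s s' q : (s <= s')%M -> Hst s q -> Hst s' q.
Proof. by move=> H [p [Hp Ap]]; exists p; split=> //; nlra. Qed.

(* Strong bounding: the codes of the stages of [Hlim] below [b] increase and are
   bounded, so they are eventually constant. *)
Lemma stabilize b : exists s0, forall s, (s0 <= s)%M -> forall q, (q < b)%M -> (Hst s q <-> Hlim q).
Proof.
pose P v := exists s y, (y < e2 b)%M /\ ((forall q, (q < b)%M -> (bit y q <-> Hst s q)) /\ v = cd y b).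
have HP : S1 1 (fun v => P (v 0%N)) by rewrite /P; def.
have PE s : P (cod (Hst s) b).
  have [y [Hy Hag]] := agree_ex b (Hst_dset s).
  exists s, y; split=> //; split=> //; symmetry; apply: cod_agree => //; [exact: bit_dset|exact: Hst_dset].
have [|m [[s0 [y [Hy [Hag Em]]]] Hmax]] := @greatest M P (cod (Hst 0%M) b) (e2 (b + b)%M) HP (PE _).
  by move=> x [s [y [_ [_ ->]]]]; apply: cod_bound; exact: bit_dset.
have Em' : m = cod (Hst s0) b.
  by rewrite Em; apply: cod_agree => //; [exact: bit_dset|exact: Hst_dset].
exists s0.
have K s : (s0 <= s)%M -> forall q, (q < b)%M -> (Hst s q <-> Hst s0 q).
  move=> Hs; apply: cod_inj; [exact: Hst_dset|exact: Hst_dset|].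
  have H1 := Hmax _ (PE s); rewrite Em' in H1.
  have H2 := @cod_le _ _ b (Hst_dset s0) (Hst_dset s) (fun q => Hst_mono Hs).
  by apply/iN_eq; move/iN_le: H1 => H1; apply/eqP; rewrite eq_le H1 H2.
move=> s Hs q Hq; rewrite (K s Hs q Hq); split=> [[p [_ Hp]]|[p Hp]]; first by exists p.
have Hsp : (s0 <= s0 + p + 1)%M by nlra.
by apply/(K _ Hsp q Hq); exists p; split=> //; nlra.
Qed.

Definition lf s y q := (q < s)%M /\ (~ (bit y q <-> Hst s q) /\
  forall r, (r < q)%M -> (bit y r <-> Hst s r)).

Lemma lf_uniq s y q q' : lf s y q -> lf s y q' -> q = q'.
Proof.
move=> [_ [H1 H2]] [_ [H1' H2']]; case: (lt_eq_gt q q') => [/H2'|[//|/H2]]; tauto.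
Qed.

Definition cA (n s y : N) : N := pk (lf s y).

Lemma RF_cA : RF 3 (fun v => cA (v 0%N) (v 1%N) (v 2%N)).
Proof.
apply: (@RF_pick M 3 (fun q v => lf (v 1%N) (v 2%N) q)).
- by rewrite /lf; def.
- by rewrite /lf; def.
- by move=> v q q'; exact: lf_uniq.
Qed.

(** Were [Hlim] not a set, every set would differ from it and [cA] would converge on all of them to
    a place of difference. But a stage that is correct below [kap] is a set, and a member of the
    cover that agrees with it up to [d < kap] does not differ from [Hlim] at [d]. *)
Lemma sigma_comp : dset M Hlim.
Proof.
apply: contrapT => Hn.
have L X : dset M X -> exists q, ~ (X q <-> Hlim q) /\ exists s0, forall n s, (s0 <= s)%M ->
    forall y, agree s y X -> cA n s y = q.
  move=> HX; have [q Hq] : exists q, ~ (X q <-> Hlim q).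
    apply: contrapT => H; apply: Hn; suff <- : X = Hlim by [].
    apply: funext => q; apply: propext; apply: contrapT => Hq; apply: H; by exists q.
  have [s0 Hs0] := stabilize (q + 1)%M.
  have HP : S1 1 (fun v => ~ (X (v 0%N) <-> Hst s0 (v 0%N))) by def.
  have Hq0 : ~ (X q <-> Hst s0 q) by rewrite (Hs0 s0 (nle_refl s0)) //; nlra.
  have [r [Hr Hl]] := least (P := fun q => ~ (X q <-> Hst s0 q)) HP Hq0.
  have Hrq : (r <= q)%M by move=> /Hl.
  have E s j : (s0 <= s)%M -> (j <= q)%M -> (Hst s j <-> Hst s0 j).
    by move=> Hs Hj; rewrite !Hs0 //; nlra.
  exists r; split; first by rewrite -(Hs0 s0 (nle_refl s0)) //; nlra.
  exists (s0 + q + 1)%M => n s Hs y Hag; apply: pk_eq; last first.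
    move=> q' Hq'; apply: lf_uniq Hq' _; split; first by nlra.
    have Hs' : (s0 <= s)%M by nlra.
    split=> [|j Hj]; first by rewrite Hag ?(E s r Hs' Hrq) //; nlra.
    rewrite Hag ?(E s j) //; [|nlra|nlra].
    by move: (Hl j Hj); rewrite not_notP.
  split; first by nlra.
  have Hs' : (s0 <= s)%M by nlra.
  split=> [|j Hj]; first by rewrite Hag ?(E s r Hs' Hrq) //; nlra.
  rewrite Hag ?(E s j) //; [|nlra|nlra].
  by move: (Hl j Hj); rewrite not_notP.
have [l [kap [Xs [HXs Hcov]]]] : exists l kap Xs, dset M Xs /\ forall Y, dset M Y ->
    exists i, (i < l)%M /\ exists d, (d < kap)%M /\ (LimC cA (sliceM Xs i) d /\
    forall q, (q < d + 1)%M -> (sliceM Xs i q <-> Y q)).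
  apply: (master cousin RF_cA) => X HX.
    by move=> n; have [q [_ [s0 H]]] := L X HX; exists q, s0 => s Hs; exact: H.
  have [q [_ [s0 H]]] := L X HX; exists q, 0%M => n _; exists s0 => s Hs; exact: H.
have [s1 Hs1] := stabilize kap.
have [i [_ [d [Hd [[n0 HL] Hag]]]]] := Hcov (Hst s1) (Hst_dset s1).
have HXi := dset_slice i HXs.
have [q [Hq [s0 Hs0]]] := L _ HXi; have [s2 Hs2] := HL n0 (nle_refl n0).
have [y [_ Hy]] := agree_ex (s0 + s2)%M HXi.
have E1 := Hs0 n0 (s0 + s2)%M ltac:(nlra) y Hy; have E2 := Hs2 (s0 + s2)%M ltac:(nlra) y Hy.
rewrite E1 in E2; apply: Hq; rewrite E2 Hag; last by nlra.
by apply: Hs1 => //; exact: nle_refl.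
Qed.

End Sigma.

(** * Delta_1 definitions become closed under number quantifiers *)

Lemma D0_local (k : nat) P (v w : nat -> N) : D0 k P -> (forall i, (i < k)%N -> v i = w i) -> P v <-> P w.
Proof.
move=> [p [_ Hp]] H; rewrite !Hp (_ : mix k v = mix k w) //.
by apply: funext => i; rewrite /mix; case: ifP => // /H.
Qed.

Lemma S1_local (k : nat) P (v w : nat -> N) : S1 k P -> (forall i, (i < k)%N -> v i = w i) -> P v <-> P w.
Proof.
move=> [Q [HQ HP]] H; rewrite !HP.
have E a : Q (scons a v) <-> Q (scons a w) by apply: D0_local HQ _ => -[//|i]; exact: H.
by split=> -[a Ha]; exists a; apply/E.
Qed.

Fixpoint tup (k : nat) (v : nat -> N) : N :=
  if k is j.+1 then pairM (tup j (tl v)) (v 0%N) else 0%M.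

Lemma tup_inj k v w : tup k v = tup k w -> forall i, (i < k)%N -> v i = w i.
Proof.
elim: k v w => [//|k IH] v w /= /pair_inj [E E0] [//|i] Hi.
exact: (IH _ _ E).
Qed.

Lemma RF_tup k : RF k (tup k).
Proof.
elim: k => [|k IH] /=; first exact: RF_const.
by apply: RF_pair; [exact: RF_tl|exact: RF_var].
Qed.

(** Quantifies away the first [k] arguments; the remaining one will be the code of their tuple. *)
Lemma S1_exs (k : nat) P : S1 k.+1 P ->
  S1 1 (fun v : nat -> N => exists w, (forall i, w (k + i)%N = v i) /\ P w).
Proof.
elim: k P => [|k IH] P HP.
  apply: S1_ext HP _ => v; split=> [H|[w [E H]]]; first by exists v.
  by rewrite (_ : v = w) //; apply: funext => i; rewrite -E.
have HP' : S1 k.+1 (fun v => exists a, P (scons a v)).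
  apply: (S1_ex (P := fun a v => P (scons a v))); apply: S1_ext HP _ => v.
  by rewrite (_ : scons _ _ = v) //; apply: funext => -[].
apply: S1_ext (IH _ HP') _ => v; split=> [[w [E [a H]]]|[w [E H]]].
  by exists (scons a w); split=> // i; rewrite addSn /=; exact: E.
exists (tl w); split=> [i|]; first by rewrite -E addSn.
by exists (w 0%N); rewrite (_ : scons _ _ = w) //; apply: funext => -[].
Qed.

(** A Sigma_1 class of coded tuples is now a set and may serve as a parameter, so membership in it
    is Delta_1. From here on, Delta_1 with set parameters includes everything arithmetical. *)
Theorem S1_D1 (k : nat) (P : (nat -> N) -> Prop) : S1 k P -> D1 k P.
Proof.
move=> HP; split=> //.
have HQ : S1 k.+1 (fun w => w k = tup k w /\ P w).
  apply: S1_and; last by apply: (@S1_ren M k k.+1 id _ _ HP) => i Hi; exact: ltnW.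
  apply: D1_S1; apply: D1_eq; first exact: RF_var.
  apply: (@S1_ren M k.+1 k.+2 (fun i => i) _ _ (RF_tup k)) => i Hi; exact: ltnW.
have [R [HR ER]] := S1_exs HQ.
have HA : dset M (fun z => exists a, R (scons a (fun=> z))).
  apply: (@sigma_comp (fun z a => R (scons a (fun=> z)))).
  have := @D0_ren M 2 2 (fun i : nat => match i with O => 1 | _ => O end)%N R.
  move=> H; apply: D1_D0; apply: D0_ext (H _ HR) _; first by case=> [|[]].
  by move=> v; apply: D0_local HR _ => -[|[]].
apply: S1_ext (D1_S1 (D1_not (D1_mem HA (RF_tup k)))) _ => v /=.
have -> : (exists a, R (scons a (fun=> tup k v))) <-> P v; last by [].
rewrite -(ER (fun=> tup k v)); split=> [[w [E [Ew Hw]]]|H].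
  have := E 0%N; rewrite addn0 Ew => Et.
  by apply/(S1_local HP (tup_inj (esym Et))).
exists (fun i => if (i < k)%N then v i else tup k v); split=> [i|]; first by rewrite ltnNge leq_addr.
rewrite ltnn.
have Ev i : (i < k)%N -> v i = (fun i => if (i < k)%N then v i else tup k v) i by move=> /= ->.
split; last exact: (proj1 (S1_local HP Ev) H).
have K (j : nat) (u u' : nat -> N) : (forall i, (i < j)%N -> u i = u' i) -> tup j u = tup j u'.
  elim: j u u' => [//|j IH] u u' Hu /=; rewrite Hu // (IH (tl u) (tl u')) // => i Hi.
  exact: Hu.
by apply: K => i ->.
Qed.

Lemma D1_ex (k : nat) (P : N -> (nat -> N) -> Prop) :
  D1 k.+1 (fun v => P (v 0%N) (tl v)) -> D1 k (fun v => exists a, P a v).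
Proof. by move=> H; apply: S1_D1; apply: S1_ex; exact: D1_S1. Qed.

Lemma D1_all (k : nat) (P : N -> (nat -> N) -> Prop) :
  D1 k.+1 (fun v => P (v 0%N) (tl v)) -> D1 k (fun v => forall a, P a v).
Proof.
move=> H; apply: D1_ext (D1_not (@D1_ex k (fun a v => ~ P a v) (D1_not H))) _ => v.
split=> [Hn a|Ha [a]]; last exact.
by apply: contrapT => Ha; apply: Hn; exists a.
Qed.

Definition ext (k : nat) (v rho : nat -> N) (i : nat) := if (i < k)%N then v i else rho (i - k)%N.

Lemma RF_eval (k : nat) rho t : RF k (fun v => eval M (ext k v rho) t).
Proof.
elim: t => [i|||s IHs t IHt|s IHs t IHt] /=.
- by rewrite /ext; case Hi: (i < k)%N; [exact: RF_var|exact: RF_const].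
- exact: RF_const.
- exact: RF_const.
- exact: RF_add.
- exact: RF_mul.
Qed.

Theorem arith_D1 (p : form) : arithmetical p -> forall (k : nat) (rho : nat -> N) (tau : nat -> N -> Prop),
  (forall Z, dset M (tau Z)) -> D1 k (fun v => sat M (ext k v rho) tau p).
Proof.
elim=> {p} [s t|s t|t X||p q _ IHp _ IHq|p _ IH] k rho tau Ht /=.
- by apply: D1_eq; exact: RF_eval.
- by apply: D1_lt; exact: RF_eval.
- by apply: D1_mem => //; exact: RF_eval.
- by apply: D1_D0; exact: D0_bot.
- by apply: D1_imp; [exact: IHp|exact: IHq].
- apply: (@D1_all k (fun a v => sat M (scons a (ext k v rho)) tau p)).
  apply: D1_ext (IH k.+1 rho tau Ht) _ => v.
  by rewrite (_ : ext k.+1 v rho = scons (v 0%N) (ext k (tl v) rho)) //; apply: funext => -[].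
Qed.

End ACA.

(** * Fixed points of operators along a well-founded order *)

Ltac adef :=
  cbv beta;
  lazymatch goal with
  | |- S1 _ _ => apply: D1_S1; adef
  | H : cousinM _ |- D1 _ (fun v => exists a : dom _, _) => apply: (D1_ex H); adef
  | H : cousinM _ |- D1 _ (fun v => forall a : dom _, _) => apply: (D1_all H); adef
  | |- D1 _ (fun v => ~ _) => apply: D1_not; adef
  | |- D1 _ (fun v => _ /\ _) => apply: D1_and; adef
  | |- D1 _ (fun v => _ \/ _) => apply: D1_or; adef
  | |- D1 _ (fun v => _ <-> _) => apply: D1_iff; adef
  | |- D1 _ (fun v => _ -> _) => apply: D1_imp; adef
  | |- _ => def
  end.

Section Kernel.
Variable M : rcaModel.
Hypothesis cousin : cousinM M.
Local Notation N := (dom M).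
Variable lo : N -> N -> Prop.
Hypothesis Hlo : D1 2 (fun v => lo (v 0%N) (v 1%N)).
Hypothesis lo_irr : forall x, ~ lo x x.
Hypothesis lo_trans : forall x y z, lo x y -> lo y z -> lo x z.
Hypothesis lo_total : forall x y, x <> y -> lo x y \/ lo y x.
Hypothesis lo_wf : forall A, dset M A -> (exists x, A x) -> exists x, A x /\ forall y, A y -> ~ lo y x.
Variable G : N -> N -> N -> Prop.
Hypothesis HG : D1 3 (fun v => G (v 0%N) (v 1%N) (v 2%N)).
Variable E : N -> Prop.
Hypothesis HE : D1 1 (fun v => E (v 0%N)).
Hypothesis G_lo : forall q a b, G q a b -> (a = 0%M \/ lo a q) /\ lo b q.
Implicit Types (X Y A : N -> Prop) (q p s y b d n i l : N).

(** The operator in clause form: [G q a b] contributes the condition that [a] implies [b], where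
    [a = 0] stands for an empty premise, and [E] collects the places that are false outright. *)
Definition Top X q := ~ E q /\ forall a b, G q a b -> (a = 0%M \/ X a) -> X b.

Lemma D1_Top X (n : nat) f : dset M X -> RF n f -> D1 n (fun v => Top X (f v)).
Proof. by move=> HX Hf; apply: (@comp1D1 M n (Top X) f) => //; rewrite /Top; adef. Qed.

Lemma lo_least A : dset M A -> (exists x, A x) -> exists x, A x /\ forall y, A y -> y <> x -> lo x y.
Proof.
move=> HA Hx; have [x [Ax Hm]] := lo_wf HA Hx; exists x; split=> // y Ay Hne.
by case: (lo_total Hne) => // H; exfalso; exact: Hm H.
Qed.

Lemma Top_ext X Y p : (forall z, lo z p -> (X z <-> Y z)) -> Top X p <-> Top Y p.
Proof.
move=> H; split=> -[HEp HT]; split=> // a b Hab Ha; have [Ha0 Hb] := G_lo Hab.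
- apply/(H b Hb); apply: HT Hab _; case: Ha => [|Ya]; first by left.
  by case: Ha0 => [|Hap]; [left|right; apply/(H a Hap)].
- apply/(H b Hb); apply: HT Hab _; case: Ha => [|Ya]; first by left.
  by case: Ha0 => [|Hap]; [left|right; apply/(H a Hap)].
Qed.

Definition fails X q := ~ (X q <-> Top X q).
Definition lfail X q := fails X q /\ forall q', fails X q' -> q' <> q -> lo q q'.

Lemma fails_dset X : dset M X -> dset M (fails X).
Proof.
move=> HX; apply: setD1; rewrite /fails; apply: D1_not; apply: D1_iff; first by def.
by apply: D1_Top => //; def.
Qed.

Lemma lfail_uniq X q q' : lfail X q -> lfail X q' -> q = q'.
Proof.
move=> [F1 H1] [F2 H2]; apply: contrapT => Hne.
by apply: (@lo_irr q); apply: lo_trans (H1 _ F2 _) (H2 _ F1 _) => // /esym.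
Qed.

Lemma lfail_below X q p : lfail X q -> lo p q -> X p <-> Top X p.
Proof.
move=> [_ H] Hp; apply: contrapT => Hn; apply: (@lo_irr q); apply: (lo_trans _ Hp).
by apply: H => // Ep; rewrite Ep in Hp; exact: lo_irr Hp.
Qed.

(** Below [q] both sets satisfy the same recursion, so a lo-minimal difference is impossible.
    Agreement along the well-order is obtained in this way, as a cover speaks only about the order
    of numbers. *)
Lemma lfail_agree X Y q : dset M X -> dset M Y -> lfail X q ->
  (forall p, lo p q -> Y p <-> Top Y p) -> forall p, lo p q -> X p <-> Y p.
Proof.
move=> HX HY HqX HqY p Hp; apply: contrapT => Hn.
have HA : dset M (fun z => lo z q /\ ~ (X z <-> Y z)) by apply: setD1; def.
have [z [[Hz Hd] Hm]] := lo_wf HA (ex_intro _ p (conj Hp Hn)).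
apply: Hd; rewrite (lfail_below HqX Hz) (HqY z Hz); apply: Top_ext => w Hw.
apply: contrapT => Hn'; apply: (Hm w _ Hw); split=> //; exact: lo_trans Hw Hz.
Qed.

(** Only clauses with [a, b < s] are tested, so the initial segment of length [s] decides the
    outcome. As [s] grows it can only turn from true to false. *)
Definition TX X s q := ~ E q /\ forall a, (a < s)%M -> forall b, (b < s)%M ->
  G q a b -> (a = 0%M \/ X a) -> X b.

Lemma TX_agree X s y q : agree s y X -> TX (bit y) s q <-> TX X s q.
Proof.
move=> H; split=> -[HEq HT]; split=> // a Ha b Hb Hab Hor.
  by apply/(H b Hb); apply: HT Hab _ => //; case: Hor => [|/(H a Ha)]; [left|right].
by apply/(H b Hb); apply: HT Hab _ => //; case: Hor => [|/(H a Ha)]; [left|right].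
Qed.

Definition ft s y q := ~ (bit y q <-> TX (bit y) s q).
(** Confining the search to [q < n] makes the limit in [s] exist for each fixed [n]; letting [n]
    grow then brings in the lo-least failure. *)
Definition cand n s y q := (q < n)%M /\ ((q < s)%M /\ (ft s y q /\
  forall q', (q' < s)%M -> (q' < n)%M -> ft s y q' -> q' <> q -> lo q q')).
Definition cK n s y : N := pk (cand n s y).

Lemma RF_cK : RF 3 (fun v => cK (v 0%N) (v 1%N) (v 2%N)).
Proof.
apply: (@RF_pick M 3 (fun q v => cand (v 0%N) (v 1%N) (v 2%N) q)).
- by rewrite /cand /ft /TX; adef.
- by rewrite /cand /ft /TX; adef.
- move=> v q q' [H1 [H2 [H3 H4]]] [H1' [H2' [H3' H4']]]; apply: contrapT => Hne.
  by apply: (@lo_irr q); apply: lo_trans (H4 _ _ _ _ _) (H4' _ _ _ _ _) => // /esym.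
Qed.

Definition lcand X n q := (q < n)%M /\ (fails X q /\
  forall q', (q' < n)%M -> fails X q' -> q' <> q -> lo q q').

Lemma cK_lim X n : dset M X ->
  exists s0, forall s, (s0 <= s)%M -> forall y, agree s y X -> cK n s y = pk (lcand X n).
Proof.
move=> HX.
have HP : S1 2 (fun v => Top X (v 1%N) \/ ~ TX X (v 0%N) (v 1%N)).
  by rewrite /Top /TX; adef.
(* By bounding, one [s0] serves all [q < n]: whenever [Top X q] is false, some finite part of the
   clauses below [s0] already shows it. *)
have [q Hq|s0 Hs0] := @S1_collect M (fun s q => Top X q \/ ~ TX X s q) n HP.
  case: (pselect (Top X q)) => HT; first by exists 0%M; left.
  case: (pselect (E q)) => HEq; first by exists 0%M; right=> -[].
  have [a [b [Hab [Ha Hb]]]] : exists a b, G q a b /\ (a = 0%M \/ X a) /\ ~ X b.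
    apply: contrapT => H; apply: HT; split=> // a b Hab Ha; apply: contrapT => Hb.
    by apply: H; exists a, b.
  exists (a + b + 1)%M; right=> -[_ H]; apply: Hb; apply: (H a _ b _ Hab Ha); nlra.
exists (s0 + n)%M => s Hs y Hag.
have K q : (q < n)%M -> ft s y q <-> fails X q.
  move=> Hq; have Hqs : (q < s)%M by nlra.
  suff KT : TX (bit y) s q <-> Top X q by rewrite /ft /fails KT (Hag q Hqs).
  rewrite (TX_agree q Hag); split=> [[HEq HT]|[HEq HT]]; last first.
    by split=> // a _ b _; exact: HT.
  have [s' [Hs' [//|Hn]]] := Hs0 q Hq; exfalso; apply: Hn; split=> // a Ha b Hb.
  by apply: HT; nlra.
rewrite /cK (_ : cand n s y = lcand X n) //; apply: funext => q; apply: propext.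
split=> [[H1 [H2 [/(K q H1) H3 H4]]]|[H1 [H3 H4]]].
  split=> //; split=> // q' H5 H6; have H7 : (q' < s)%M by nlra.
  by apply: H4 => //; apply/K.
split=> //; split; first by nlra.
split; first by apply/K.
by move=> q' H5 H6 /(K q' H6); exact: H4.
Qed.

Lemma lcand_lfail X n q : lfail X q -> (q < n)%M -> pk (lcand X n) = q.
Proof.
move=> [F1 H1] Hn; apply: pk_eq; first by split=> //; split=> // q' _; exact: H1.
move=> q' [Hn' [F2 H2]]; apply: contrapT => Hne.
by apply: (@lo_irr q); apply: lo_trans (H1 _ F2 _) (H2 _ _ F1 _) => // /esym.
Qed.

Lemma LimC_lfail X q d : dset M X -> lfail X q -> LimC cK X d -> d = q.
Proof.
move=> HX Hq [n0 Hn0].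
have [s1 Hs1] := Hn0 (n0 + q + 1)%M ltac:(nlra).
have [s2 Hs2] := cK_lim (n0 + q + 1)%M HX.
have [y [_ Hag]] := agree_ex (s1 + s2)%M HX.
rewrite -(Hs1 (s1 + s2)%M ltac:(nlra) y Hag) (Hs2 (s1 + s2)%M ltac:(nlra) y Hag).
by apply: lcand_lfail => //; nlra.
Qed.

(* Otherwise send a set [X] to the lo-least point where it fails to be a fixed
   point; among the finitely many sets of a cover one, [X*], fails last, and
   correcting it at that point gives a set that the cover misses. *)
Theorem kernel : exists K, dset M K /\ forall q, K q <-> Top K q.
Proof.
apply: contrapT => Hno.
have LF X : dset M X -> exists q, lfail X q.
  move=> HX; apply: lo_least; first exact: fails_dset.
  apply: contrapT => H; apply: Hno; exists X; split=> // q; apply: contrapT => Hq.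
  by apply: H; exists q.
have [l [kap [Xs [HXs Hcov]]]] : exists l kap Xs, dset M Xs /\ forall Y, dset M Y ->
    exists i, (i < l)%M /\ exists d, (d < kap)%M /\ (LimC cK (sliceM Xs i) d /\
    forall q, (q < d + 1)%M -> (sliceM Xs i q <-> Y q)).
  apply: (master cousin RF_cK) => X HX.
    by move=> n; have [s0 H] := cK_lim n HX; exists (pk (lcand X n)), s0.
  have [q Hq] := LF X HX; exists q, (q + 1)%M => n Hn.
  have [s0 H] := cK_lim n HX; exists s0 => s Hs y Hag; rewrite (H s Hs y Hag).
  by apply: lcand_lfail => //; nlra.
have HS i := dset_slice i HXs.
have HL : D1 2 (fun v => lfail (sliceM Xs (v 0%N)) (v 1%N)).
  by rewrite /lfail /fails /Top /sliceM; adef.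
(* The cover is finite only in the sense of the model, so the lo-last failure is found by induction
   on the number of sets considered; the claim is arithmetical, which suffices now. *)
have Hmax m : m = 0%M \/ exists i q, (i < m)%M /\ (lfail (sliceM Xs i) q /\
    forall i' q', (i' < m)%M -> lfail (sliceM Xs i') q' -> q' = q \/ lo q' q).
  elim/induct: m => [||m IH].
  - have HL' (n : nat) f g : RF n f -> RF n g -> D1 n (fun v => lfail (sliceM Xs (f v)) (g v)).
      exact: (comp2D1 (P := fun i q => lfail (sliceM Xs i) q) HL).
    apply: D1_S1; apply: D1_or; first by def.
    apply: (D1_ex cousin); apply: (D1_ex cousin); apply: D1_and; first by def.
    apply: D1_and; first by apply: HL'; def.
    apply: (D1_all cousin); apply: (D1_all cousin); apply: D1_imp; first by def.
    by apply: D1_imp; [apply: HL'; def|def].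
  - by left.
  - right; have [qm Hqm] := LF _ (HS m).
    case: IH => [E0|[i [q [Hi [Hq Hall]]]]].
      exists m, qm; split; [nlra|split=> // i' q' Hi'].
      have -> : i' = m by nlra.
      by move=> H; left; exact: lfail_uniq H Hqm.
    case: (pselect (lo q qm)) => Hlq.
      exists m, qm; split; [nlra|split=> // i' q' /mltS [Hi' H|-> H]].
        by right; case: (Hall i' q' Hi' H) => [->//|H']; exact: lo_trans H' Hlq.
      by left; exact: lfail_uniq H Hqm.
    exists i, q; split; [nlra|split=> // i' q' /mltS [Hi' H|-> H]]; first exact: Hall Hi' H.
    rewrite (lfail_uniq H Hqm); case: (pselect (qm = q)) => [->|Hne]; first by left.
    by case: (lo_total Hne) => // ?; right.
have Hl : l <> 0%M.
  move=> El; have H0 : dset M (fun _ => False) by apply: setD1; apply: D1_D0; exact: D0_bot.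
  by have [i [Hi _]] := Hcov _ H0; rewrite El in Hi; exact: mlt0 Hi.
case: (Hmax l) => // -[i0 [q0 [_ [Hq0 Hall]]]].
pose X0 := sliceM Xs i0; have HX0 : dset M X0 := HS i0.
pose b0 := Top X0 q0.
(* Correct up to and including [q0]; beyond [q0] every value is set to false. *)
pose Y p := (lo p q0 /\ X0 p) \/ (p = q0 /\ b0).
have HY : dset M Y.
  apply: setD1; rewrite /Y; apply: D1_or; first by def.
  by apply: D1_and; [def|apply: (@D1_Top X0 1 (fun=> q0)) => //; exact: RF_const].
have YX z : lo z q0 -> (Y z <-> X0 z).
  move=> Hz; rewrite /Y; split=> [[[]//|[Ez]]|]; last by left.
  by rewrite Ez in Hz; case: (lo_irr Hz).
have YT p : lo p q0 \/ p = q0 -> (Y p <-> Top Y p).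
  move=> Hp; have -> : Top Y p <-> Top X0 p.
    by apply: Top_ext => z Hz; apply: YX; case: Hp => [|<-//]; exact: lo_trans Hz.
  case: Hp => [Hp|->]; first by rewrite YX //; exact: lfail_below Hq0 Hp.
  by rewrite /Y /b0; split=> [[[/lo_irr]|[]]//|]; right.
have [i [Hi [d [_ [HLim Hag]]]]] := Hcov Y HY.
have [q Hq] := LF _ (HS i).
have Ed := LimC_lfail (HS i) Hq HLim.
have Hqq : lo q q0 \/ q = q0 by case: (Hall i q Hi Hq); [right|left].
have HYb p : lo p q -> Y p <-> Top Y p.
  by move=> Hp; apply: YT; left; case: Hqq => [|<-//]; exact: lo_trans Hp.
case: (Hq) => Hf _; apply: Hf.
have Hqd : (q < d + 1)%M by nlra.
(* The agreement up to [d = q] is used at [q] alone. There [Y] is correct, and [Top] looks only at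
   places below [q], where the two sets coincide. *)
rewrite (Hag q Hqd) (YT q Hqq); apply: iff_sym.
by apply: Top_ext => p; exact: lfail_agree Hq HYb p.
Qed.

End Kernel.

(** * Arithmetical transfinite recursion *)

Section Projections.
Variable M : rcaModel.
Hypothesis cousin : cousinM M.
Local Notation N := (dom M).
Implicit Types x y a b : N.

Definition pfst x : N := pk (fun a => exists b, x = pairM a b).
Definition psnd x : N := pk (fun b => exists a, x = pairM a b).

Lemma pfstE a b : pfst (pairM a b) = a.
Proof. by apply: pk_eq => [|a' [b' /pair_inj []]]; first by exists b. Qed.

Lemma psndE a b : psnd (pairM a b) = b.
Proof. by apply: pk_eq => [|b' [a' /pair_inj []]]; first by exists a. Qed.

Lemma RF_pfst : RF 1 (fun v : nat -> N => pfst (v 0%N)).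
Proof.
apply: (@RF_pick M 1 (fun a v => exists b, v 0%N = pairM a b)); [by adef|by adef|].
by move=> v a a' [b ->] [b' /pair_inj []].
Qed.

Lemma RF_psnd : RF 1 (fun v : nat -> N => psnd (v 0%N)).
Proof.
apply: (@RF_pick M 1 (fun b v => exists a, v 0%N = pairM a b)); [by adef|by adef|].
by move=> v b b' [a ->] [a' /pair_inj []].
Qed.

(** Tuples nest to the left, so entries are counted from the right, in keeping with de Bruijn
    indices. *)
Definition pr (i : nat) x : N := psnd (iter i pfst x).

Lemma RF_pr (i n : nat) (f : (nat -> N) -> N) : RF n f -> RF n (fun v => pr i (f v)).
Proof.
move=> Hf; apply: (RF_comp1 RF_psnd (f := fun v => iter i pfst (f v))).
by elim: i => [//|i IH] /=; apply: (RF_comp1 RF_pfst (f := fun v => iter i pfst (f v))).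
Qed.

Lemma comp5D1 (k : nat) (P : N -> N -> N -> N -> N -> Prop) f1 f2 f3 f4 f5 :
  D1 5 (fun v => P (v 0%N) (v 1%N) (v 2%N) (v 3%N) (v 4%N)) ->
  RF k f1 -> RF k f2 -> RF k f3 -> RF k f4 -> RF k f5 ->
  D1 k (fun v => P (f1 v) (f2 v) (f3 v) (f4 v) (f5 v)).
Proof.
move=> HP H1 H2 H3 H4 H5.
apply: (D1_subst (P := fun a v => P a (f2 v) (f3 v) (f4 v) (f5 v)) H1).
apply: (D1_subst (P := fun a v => P (v 0%N) a (f3 (tl v)) (f4 (tl v)) (f5 (tl v))) (RF_tl H2)).
apply: (D1_subst (P := fun a v => P (v 1%N) (v 0%N) a (f4 (tl (tl v))) (f5 (tl (tl v))))
  (RF_tl (RF_tl H3))).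
apply: (D1_subst (P := fun a v => P (v 2%N) (v 1%N) (v 0%N) a (f5 (tl (tl (tl v)))))
  (RF_tl (RF_tl (RF_tl H4)))).
apply: (D1_subst (P := fun a v => P (v 3%N) (v 2%N) (v 1%N) (v 0%N) a)
  (RF_tl (RF_tl (RF_tl (RF_tl H5))))).
by apply: (@D1_ren M 5 k.+1.+4 (fun i => (4 - i)%N) _ _ HP) => i Hi; lia.
Qed.

Fixpoint num (n : nat) : N := if n is m.+1 then (num m + 1)%M else 0%M.

Lemma num_lt m n : (m < n)%N -> (num m < num n)%M.
Proof.
elim: n => [//|n IH]; rewrite ltnS leq_eqVlt => /orP [/eqP ->|/IH H] /=; nlra.
Qed.

Lemma num_inj m n : num m = num n -> m = n.
Proof.
move=> E; case: (ltngtP m n) => // /num_lt; rewrite E => H; exfalso; nlra.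
Qed.

Lemma num_gt0 m : (0 < m)%N -> num m <> 0%M.
Proof. by case: m => // m _ /=; exact: succ_neq0. Qed.

End Projections.

(** * The well-order of evaluation nodes *)

Section WellOrder.
Variable M : rcaModel.
Hypothesis cousin : cousinM M.
Local Notation N := (dom M).
Variable X : N -> Prop.
Hypothesis HX : dset M X.
Hypothesis HWO : isWOM X.
Implicit Types (A B : N -> Prop) (x y z q u b j : N).

Lemma below_irr x : ~ belowM X x x. Proof. by case. Qed.

Lemma below_trans x y z : belowM X x y -> belowM X y z -> belowM X x z.
Proof.
case: HWO => -[_ [_ [T _]]] _ [H1 H2] [H3 H4]; split; first exact: T H1 H3.
by move=> H5; apply: H4; exact: T H5 H1.
Qed.

Lemma below_total x y : fieldM X x -> fieldM X y -> x = y \/ belowM X x y \/ belowM X y x.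
Proof.
case: HWO => -[_ [_ [_ [A T]]]] _ Fx Fy.
case: (pselect (X (pairM x y))) => H1; case: (pselect (X (pairM y x))) => H2.
- by left; exact: A.
- by right; left.
- by right; right.
- by case: (T _ _ Fx Fy).
Qed.

Lemma below_field x y : belowM X x y -> fieldM X x /\ fieldM X y.
Proof. by move=> [H _]; split; [exists y; left|exists x; right]. Qed.

(** [isWOM] speaks of descending sequences. Without a minimal element one is built by recursion,
    each step going to the numerically least element below the current one so that it is
    definable. *)
Lemma wo_min B : dset M B -> (exists x, B x) -> exists x, B x /\ forall y, B y -> ~ belowM X y x.
Proof.
move=> HB [b0 Hb0]; apply: contrapT => Hn; case: HWO => _; apply.
have K u : B u -> exists b, B b /\ belowM X b u.
  move=> Hu; apply: contrapT => H; apply: Hn; exists u; split=> // y Hy Hyu; apply: H.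
  by exists y.
pose R b u := (B b /\ belowM X b u) /\ forall b', (b' < b)%M -> ~ (B b' /\ belowM X b' u).
have RU u b b' : R b u -> R b' u -> b = b'.
  move=> [H1 H2] [H1' H2']; case: (lt_eq_gt b b') => [/H2'|[//|/H2]]; tauto.
have RFn : RF 2 (fun v : nat -> N => pk (fun b => R b (v 1%N))).
  apply: (@RF_pick M 2 (fun b v => R b (v 1%N))).
  - by rewrite /R /belowM; adef.
  - by rewrite /R /belowM; adef.
  - by move=> v; exact: RU.
have HBb : D1 2 (fun v => B (v 0%N) /\ belowM X (v 0%N) (v 1%N)) by rewrite /belowM; adef.
have Nx u : B u -> R (pk (fun b => R b u)) u.
  move=> /K [b Hb]; have HP : S1 1 (fun v => B (v 0%N) /\ belowM X (v 0%N) u).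
    by rewrite /belowM; adef.
  have [b' Hb'] := least (P := fun b => B b /\ belowM X b u) HP Hb.
  have Rb : R b' u by [].
  by rewrite (pk_eq (R := fun b => R b u) Rb) // => b'' Rb''; exact: RU Rb'' Rb.
have [f [f0 fS RFf]] := @primrec M b0 (fun _ u => pk (fun b => R b u)) RFn.
have Bf n : B (f n).
  move: n; apply: (@induct M (fun n => B (f n))) => [||n IH]; [by adef|by rewrite f0|].
  by rewrite fS; case: (Nx _ IH) => -[].
exists (setp (fun n u => u = f n)); split; first by apply: setp_dset; def.
split; first split.
- exact: setp_rel.
- split=> [n|n u u']; first by exists (f n); apply/setpE.
  by move=> /setpE -> /setpE ->.
- move=> n u u' /setpE -> /setpE ->; rewrite fS.
  by case: (Nx _ (Bf n)) => -[].
Qed.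

(* Nodes are triples [pos v i j]: a code [v] of values for the bound variables, the
   index [i] of a subformula, a stage [j] in the field of [X]. *)
Definition pos v i j : N := pairM (pairM v i) j.
Definition gV q := pfst (pfst q).
Definition gI q := psnd (pfst q).
Definition gJ q := psnd q.
Definition Nd q := fieldM X (gJ q).
Definition lx q q' := belowM X (gJ q) (gJ q') \/ (gJ q = gJ q' /\
  ((gI q < gI q')%M \/ (gI q = gI q' /\ (q < q')%M))).
(** [kernel] asks for a total order of all numbers: non-nodes come first in their natural order,
    then the nodes by stage, subformula and number. *)
Definition lo q q' := (~ Nd q /\ (Nd q' \/ (q < q')%M)) \/ (Nd q /\ (Nd q' /\ lx q q')).

Lemma D1_lo : D1 2 (fun v => lo (v 0%N) (v 1%N)).
Proof.
have H1 := RF_pfst cousin; have H2 := RF_psnd cousin.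
by rewrite /lo /lx /Nd /gI /gJ /belowM /fieldM; adef.
Qed.

Lemma lo_irr q : ~ lo q q.
Proof.
move=> [[H [//|H1]]|[_ [_ [/below_irr//|[_ [H|[_ H]]]]]]]; nlra.
Qed.

Lemma lx_trans q q' q'' : lx q q' -> lx q' q'' -> lx q q''.
Proof.
move=> [H|[E [H|[E' H]]]] [K|[F [K|[F' K]]]].
- by left; exact: below_trans H K.
- by left; rewrite -F.
- by left; rewrite -F.
- by left; rewrite E.
- by right; split; [rewrite E|left; nlra].
- by right; split; [rewrite E|left; rewrite -F'].
- by left; rewrite E.
- by right; split; [rewrite E|left; rewrite E'].
- by right; split; [rewrite E|right; split; [rewrite E'|nlra]].
Qed.

Lemma lo_trans q q' q'' : lo q q' -> lo q' q'' -> lo q q''.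
Proof.
move=> [[H [H1|H1]]|[H [H1 H2]]] [[K [K1|K1]]|[K [K1 K2]]] //.
- by left; split=> //; left.
- by left; split=> //; left.
- by left; split=> //; right; nlra.
- by left; split=> //; left.
- by right; split=> //; split=> //; exact: lx_trans H2 K2.
Qed.

Lemma lo_total q q' : q <> q' -> lo q q' \/ lo q' q.
Proof.
move=> Hne; rewrite /lo.
case: (pselect (Nd q)) => H; case: (pselect (Nd q')) => H'; last first.
- by case: (lt_eq_gt q q') => [?|[//|?]]; [left|right]; left; split=> //; right.
- by left; left; split=> //; left.
- by right; left; split=> //; left.
rewrite /lx; case: (below_total H H') => [EJ|[?|?]]; last first.
- by right; right; split=> //; split=> //; left.
- by left; right; split=> //; split=> //; left.
case: (lt_eq_gt (gI q) (gI q')) => [?|[EI|?]].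
- by left; right; split=> //; split=> //; right; split=> //; left.
- case: (lt_eq_gt q q') => [?|[//|?]].
  + by left; right; split=> //; split=> //; right; split=> //; right.
  + by right; right; split=> //; split=> //; right; split=> //; right.
- by right; right; split=> //; split=> //; right; split=> //; left.
Qed.

Lemma lo_wf A : dset M A -> (exists x, A x) -> exists x, A x /\ forall y, A y -> ~ lo y x.
Proof.
move=> HA [q0 Hq0]; have R1 := RF_pfst cousin; have R2 := RF_psnd cousin.
case: (pselect (exists q, A q /\ ~ Nd q)) => [[q Hq]|Hn].
  have HP : S1 1 (fun v => A (v 0%N) /\ ~ Nd (v 0%N)) by rewrite /Nd /gJ /fieldM; adef.
  have [x [[Ax Nx] Hx]] := least (P := fun q => A q /\ ~ Nd q) HP Hq.
  exists x; split=> // y Ay [[Hy [//|Hyx]]|[_ [//]]].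
  by apply: (Hx y).
have HNd q : A q -> Nd q by move=> Aq; apply: contrapT => Hq; apply: Hn; exists q.
have HB : dset M (fun j => exists q, A q /\ gJ q = j).
  by apply: setD1; rewrite /gJ; adef.
have [j [[q1 [A1 J1]] Hj]] := wo_min HB (ex_intro _ _ (ex_intro _ q0 (conj Hq0 erefl))).
have HI : S1 1 (fun v => exists q, A q /\ (gJ q = j /\ gI q = v 0%N)).
  by rewrite /gJ /gI; adef.
have [i [[q2 [A2 [J2 I2]]] Hi]] := least (P := fun i => exists q, A q /\ (gJ q = j /\ gI q = i))
  HI (ex_intro _ q1 (conj A1 (conj J1 erefl))).
have HQ : S1 1 (fun v => A (v 0%N) /\ (gJ (v 0%N) = j /\ gI (v 0%N) = i)).
  by rewrite /gJ /gI; adef.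
have [q [[A3 [J3 I3]] Hq]] := least (P := fun q => A q /\ (gJ q = j /\ gI q = i))
  HQ (conj A2 (conj J2 I2)).
exists q; split=> // y Ay [[Hy _]|[_ [_ [Hb|[EJ [Hlt|[EI Hlt]]]]]]].
- by apply: Hy; exact: HNd.
- by rewrite J3 in Hb; apply: Hj Hb; exists y.
- by rewrite I3 in Hlt; apply: (Hi _ Hlt); exists y; rewrite EJ J3.
- by apply: (Hq y Hlt); rewrite EJ EI.
Qed.

Lemma gV_pos v i j : gV (pos v i j) = v. Proof. by rewrite /gV /pos !pfstE. Qed.
Lemma gI_pos v i j : gI (pos v i j) = i. Proof. by rewrite /gI /pos pfstE psndE. Qed.
Lemma gJ_pos v i j : gJ (pos v i j) = j. Proof. by rewrite /gJ /pos psndE. Qed.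

(** * Evaluation of a formula as a recursion on nodes *)

Variable theta : form.
Hypothesis Hth : arithmetical theta.
Variable rho : nat -> N.
Variable tau : nat -> N -> Prop.
Hypothesis Htau : forall Z, dset M (tau Z).

Definition envk (k : nat) v : nat -> N := ext k (fun i => pr i v) rho.

Lemma envk_pair k v x : envk k.+1 (pairM v x) = scons x (envk k v).
Proof.
apply: funext => -[|i]; first by rewrite /envk /ext /pr /= psndE.
by rewrite /envk /ext ltnS subSS /pr iterSr pfstE.
Qed.

Lemma RF_val (k n : nat) (f : (nat -> N) -> N) t :
  RF n f -> RF n (fun v => eval M (envk k (f v)) t).
Proof.
move=> Hf; elim: t => [i|||s IHs t IHt|s IHs t IHt] /=.
- by rewrite /envk /ext; case Hi: (i < k)%N; [exact: RF_pr|exact: RF_const].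
- exact: RF_const.
- exact: RF_const.
- exact: RF_add.
- exact: RF_mul.
Qed.
#[local] Hint Extern 1 (RF _ (fun v => eval _ _ _)) => apply: RF_val; def : defdb.

(* The subformulas of [p] get the indices [o], ..., [o + height p], the last one
   being that of [p] itself. *)
Fixpoint height (p : form) : nat :=
  match p with
  | fimp p1 p2 => (height p1 + height p2).+2
  | fall0 p1 => (height p1).+1
  | _ => 0%N
  end.

(** Numbering starts at 1 so that no node is 0, the mark of an empty premise. *)
Definition root0 := num M (1 + height theta)%N.

(** An implication is one clause from the node of its premise to that of its conclusion, a universal
    formula one premise-free clause per instance. Membership in set variable 0, the earlier stages,
    refers to the root node of the stage [i'] named by the term. *)
Fixpoint Gf (p : form) (o k : nat) (v i j a b : N) {struct p} : Prop :=
  match p with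
  | fmem t 0%N => i = num M o /\ (a = 0%M /\ exists m i', eval M (envk k v) t = pairM m i' /\
      (belowM X i' j /\ b = pos (pairM 0%M m) root0 i'))
  | fimp p1 p2 => (i = num M (o + (height p1 + height p2).+2)%N /\
      (a = pos v (num M (o + height p1)%N) j /\ b = pos v (num M ((o + height p1).+1 + height p2)%N) j)) \/
      (Gf p1 o k v i j a b \/ Gf p2 (o + height p1).+1 k v i j a b)
  | fall0 p1 => (i = num M (o + (height p1).+1)%N /\
      (a = 0%M /\ exists x, b = pos (pairM v x) (num M (o + height p1)%N) j)) \/
      Gf p1 o k.+1 v i j a b
  | _ => False
  end.

(** A node holds unless one of its clauses fails, so falsity has to be imposed on the atomic
    formulas. *)
Fixpoint Ef (p : form) (o k : nat) (v i j : N) {struct p} : Prop :=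
  match p with
  | feq s t => i = num M o /\ ~ (eval M (envk k v) s = eval M (envk k v) t)
  | flt s t => i = num M o /\ ~ (eval M (envk k v) s < eval M (envk k v) t)%M
  | fmem t 0%N => i = num M o /\ ~ exists m i', eval M (envk k v) t = pairM m i' /\ belowM X i' j
  | fmem t Z.+1 => i = num M o /\ ~ tau Z (eval M (envk k v) t)
  | fbot => i = num M o
  | fimp p1 p2 => Ef p1 o k v i j \/ Ef p2 (o + height p1).+1 k v i j
  | fall0 p1 => Ef p1 o k.+1 v i j
  | _ => False
  end.

Lemma D1_False (n : nat) : D1 n (fun _ : nat -> N => False).
Proof. by apply: D1_D0; exact: D0_bot. Qed.

Lemma D1_Gf (p : form) : forall o k : nat,
  D1 5 (fun v => Gf p o k (v 0%N) (v 1%N) (v 2%N) (v 3%N) (v 4%N)).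
Proof.
elim: p => [s t|s t|t [|Z]||p1 IH1 p2 IH2|p1 IH1|p1 _] o k /=; try exact: D1_False.
- by rewrite /pos /belowM; adef.
- apply: D1_or; first by rewrite /pos; def.
  by apply: D1_or; [exact: IH1|exact: IH2].
- by apply: D1_or; [rewrite /pos; adef|exact: IH1].
Qed.

Lemma D1_Ef (p : form) : forall o k : nat, D1 3 (fun v => Ef p o k (v 0%N) (v 1%N) (v 2%N)).
Proof.
elim: p => [s t|s t|t [|Z]||p1 IH1 p2 IH2|p1 IH1|p1 _] o k /=; try exact: D1_False.
- by def.
- by def.
- by rewrite /belowM; adef.
- by have HZ := Htau Z; def.
- by def.
- by apply: D1_or; [exact: IH1|exact: IH2].
- exact: IH1.
Qed.

Lemma Gf_range (p : form) : forall (o k : nat) v i j a b, Gf p o k v i j a b ->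
  exists m : nat, (o <= m <= o + height p)%N /\ i = num M m.
Proof.
elim: p => [s t|s t|t [|Z]||p1 IH1 p2 IH2|p1 IH1|p1 _] o k v i j a b //=.
- by move=> [-> _]; exists o; split=> //; lia.
- move=> [[-> _]|[/IH1|/IH2] [m [Hm ->]]]; last by exists m; split=> //; lia.
    by eexists; split; [|reflexivity]; lia.
  by exists m; split=> //; lia.
- move=> [[-> _]|/IH1 [m [Hm ->]]]; last by exists m; split=> //; lia.
  by eexists; split; [|reflexivity]; lia.
Qed.

Lemma Ef_range (p : form) : forall (o k : nat) v i j, Ef p o k v i j ->
  exists m : nat, (o <= m <= o + height p)%N /\ i = num M m.
Proof.
elim: p => [s t|s t|t [|Z]||p1 IH1 p2 IH2|p1 IH1|p1 _] o k v i j //=.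
- by move=> [-> _]; exists o; split=> //; lia.
- by move=> [-> _]; exists o; split=> //; lia.
- by move=> [-> _]; exists o; split=> //; lia.
- by move=> [-> _]; exists o; split=> //; lia.
- by move=> ->; exists o; split=> //; lia.
- by move=> [/IH1|/IH2] [m [Hm ->]]; exists m; split=> //; lia.
- by move=> /IH1 [m [Hm ->]]; exists m; split=> //; lia.
Qed.

Definition GT q a b := Nd q /\ Gf theta 1 1 (gV q) (gI q) (gJ q) a b.
Definition ET q := Nd q /\ Ef theta 1 1 (gV q) (gI q) (gJ q).

Lemma D1_GT : D1 3 (fun v => GT (v 0%N) (v 1%N) (v 2%N)).
Proof.
have R1 := RF_pfst cousin; have R2 := RF_psnd cousin.
rewrite /GT /Nd /gV /gI /gJ; apply: D1_and; first by rewrite /fieldM; adef.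
by apply: (comp5D1 (P := Gf theta 1 1) (D1_Gf theta 1 1)); def.
Qed.

Lemma D1_ET : D1 1 (fun v => ET (v 0%N)).
Proof.
have R1 := RF_pfst cousin; have R2 := RF_psnd cousin.
rewrite /ET /Nd /gV /gI /gJ; apply: D1_and; first by rewrite /fieldM; adef.
by apply: (comp3D1 (P := Ef theta 1 1) (D1_Ef theta 1 1)); def.
Qed.

Lemma lo_pos v i q : Nd q -> (i < gI q)%M -> lo (pos v i (gJ q)) q.
Proof.
move=> Hq Hi; right; split; first by rewrite /Nd gJ_pos.
by split=> //; right; rewrite gJ_pos gI_pos; split=> //; left.
Qed.

(** A clause leads to a proper subformula at the same stage, which has a smaller index, or to an
    earlier stage. *)
Lemma Gf_lo (p : form) : forall (o k : nat) q a b, Nd q -> Gf p o k (gV q) (gI q) (gJ q) a b ->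
  (a = 0%M \/ lo a q) /\ lo b q.
Proof.
elim: p => [s t|s t|t [|Z]||p1 IH1 p2 IH2|p1 IH1|p1 _] o k q a b Hq //=.
- move=> [_ [-> [m [i' [_ [Hb ->]]]]]]; split; first by left.
  right; split; first by rewrite /Nd gJ_pos; case: (below_field Hb).
  by split=> //; left; rewrite gJ_pos.
- move=> [[Ei [-> ->]]|[|]]; [|exact: IH1|exact: IH2].
  split; [right|]; apply: lo_pos => //; rewrite Ei; first by apply: num_lt; lia.
  by apply: (@num_lt M (o + height p1 + height p2).+1); lia.
- move=> [[Ei [-> [x ->]]]|]; last exact: IH1.
  by split; [left|apply: lo_pos => //; rewrite Ei; apply: num_lt; lia].
Qed.

Section Truth.
Variable K : N -> Prop.
Hypothesis HK : dset M K.
Hypothesis KE : forall q, K q <-> Top GT ET K q.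

Definition Yk l := exists n j, l = pairM n j /\ (fieldM X j /\ K (pos (pairM 0%M n) root0 j)).
Definition Zk j l := exists m i, l = pairM m i /\ (belowM X i j /\ Yk l).

Lemma Yk_dset : dset M Yk.
Proof. by apply: setD1; rewrite /Yk /fieldM /pos; adef. Qed.

Lemma Zk_dset j : dset M (Zk j).
Proof. by have HY := Yk_dset; apply: setD1; rewrite /Zk /belowM; adef. Qed.

Lemma K_pos v i j : fieldM X j -> K (pos v i j) <-> ~ Ef theta 1 1 v i j /\
  forall a b, Gf theta 1 1 v i j a b -> (a = 0%M \/ K a) -> K b.
Proof.
move=> Hj; rewrite KE /Top /ET /GT /Nd gV_pos gI_pos gJ_pos.
by split=> -[H1 H2]; split=> [H|a b H]; try (apply: H1; tauto); apply: H2; tauto.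
Qed.

Lemma pos_neq0 v (m : nat) j : (0 < m)%N -> pos v (num M m) j <> 0%M.
Proof.
move=> Hm E; apply: (num_gt0 (M := M) Hm).
have H1 := pair_ger v (num M m); have H2 := pair_gel (pairM v (num M m)) j.
by rewrite -/(pos v (num M m) j) E in H2; nlra.
Qed.

(** Induction on subformulas at one stage [j]. The two hypotheses locate [p] inside [theta]: on the
    block of indices of [p], the clauses of [theta] are those of [p]. Earlier stages enter only
    through [Zk], which is itself read off [K], so there is no induction along [X]. *)
Lemma truth (p : form) : arithmetical p -> forall o k : nat, (0 < o)%N ->
  (forall m : nat, (o <= m <= o + height p)%N -> forall v j a b,
     Gf theta 1 1 v (num M m) j a b <-> Gf p o k v (num M m) j a b) ->
  (forall m : nat, (o <= m <= o + height p)%N -> forall v j,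
     Ef theta 1 1 v (num M m) j <-> Ef p o k v (num M m) j) ->
  forall v j, fieldM X j ->
  K (pos v (num M (o + height p)%N) j) <-> sat M (envk k v) (scons (Zk j) tau) p.
Proof.
have NG p' (o m k : nat) v j a b : Gf p' o k v (num M m) j a b -> (o <= m <= o + height p')%N.
  by move=> /Gf_range [m' [Hm /num_inj ->]].
have NE p' (o m k : nat) v j : Ef p' o k v (num M m) j -> (o <= m <= o + height p')%N.
  by move=> /Ef_range [m' [Hm /num_inj ->]].
elim=> {p} [s t|s t|t [|Z]||p1 p2 _ IH1 _ IH2|p1 _ IH1] o k Ho HG HE v j Hj;
  rewrite K_pos // HE; try lia; cbn [height sat]; rewrite ?addn0.
- split=> [[H _]|H]; first by apply: contrapT => H'; apply: H.
  by split=> [[_]//|a b]; rewrite -[o]addn0 HG //=; lia.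
- split=> [[H _]|H]; first by apply: contrapT => H'; apply: H.
  by split=> [[_]//|a b]; rewrite -[o]addn0 HG //=; lia.
- have HG0 a b : Gf theta 1 1 v (num M o) j a b <-> Gf (fmem t 0%N) o k v (num M o) j a b.
    by apply: HG => /=; lia.
  split=> [[H1 H2]|[m [i' [Et [Hb [n' [j' [Et' [Fj Kn]]]]]]]]].
    have [m [i' [Et Hb]]] : exists m i', eval M (envk k v) t = pairM m i' /\ belowM X i' j.
      by apply: contrapT => H; apply: H1.
    exists m, i'; split=> //; split=> //; exists m, i'; split=> //.
    split; first by case: (below_field Hb).
    apply: (H2 0%M); last by left.
    by apply/HG0; split=> //; split=> //; exists m, i'.
  split=> [[_ []]|a b /HG0 [_ [-> [m2 [i2 [Et2 [_ ->]]]]]] _]; first by exists m, i'.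
  move: Et2; rewrite Et' => /pair_inj [<- <-]; exact: Kn.
- split=> [[H _]|H]; first by apply: contrapT => H'; apply: H.
  by split=> [[_]//|a b]; rewrite -[o]addn0 HG //=; lia.
- by split=> // -[[]].
- have HG0 := fun a b => HG (o + (height p1 + height p2).+2)%N ltac:(move=> /=; lia) v j a b.
  have G1 : K (pos v (num M (o + height p1)%N) j) <-> sat M (envk k v) (scons (Zk j) tau) p1.
    apply: IH1 => // m Hm => [w j' a b|w j'].
    - rewrite HG /=; last by lia.
      split=> [[[/num_inj]|[//|/NG]]|]; [lia|lia|by right; left].
    - by rewrite HE /=; [split=> [[//|/NE]|]; [lia|left]|lia].
  have G2 : K (pos v (num M ((o + height p1).+1 + height p2)%N) j) <->
      sat M (envk k v) (scons (Zk j) tau) p2.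
    apply: IH2 => // m Hm => [w j' a b|w j'].
    - rewrite HG /=; last by lia.
      split=> [[[/num_inj]|[/NG|//]]|]; [lia|lia|by right; right].
    - by rewrite HE /=; [split=> [[/NE|//]|]; [lia|right]|lia].
  rewrite -G1 -G2; split=> [[_ H] H1|H].
    by apply: (H (pos v (num M (o + height p1)%N) j)); [apply/HG0; left|right].
  split=> [/= [/NE|/NE]|a b /HG0 /= [[_ [-> ->]] [/pos_neq0 []|]|[/NG|/NG]]]; try lia.
  exact: H.
- have HG0 := fun a b => HG (o + (height p1).+1)%N ltac:(move=> /=; lia) v j a b.
  have G1 x : K (pos (pairM v x) (num M (o + height p1)%N) j) <->
      sat M (scons x (envk k v)) (scons (Zk j) tau) p1.
    rewrite -envk_pair; apply: IH1 => // m Hm => [w j' a b|w j'].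
    - rewrite HG /=; last by lia.
      by split=> [[[/num_inj]|//]|]; [lia|right].
    - by rewrite HE /=; [|lia].
  split=> [[_ H] x|H].
    apply/G1; apply: (H 0%M); last by left.
    by apply/HG0; left; split=> //; split=> //; exists x.
  split=> [/= /NE|a b /HG0 /= [[_ [_ [x ->]]] _|/NG]]; try lia.
  exact/G1.
Qed.

(** The set quantified in [hierarchyM] is determined by its members, hence equal to [Zk j], for
    which [truth] applies to the whole of [theta]. *)
Lemma Yk_hierarchy :
  hierarchyM (fun n Z => sat M (scons n rho) (scons Z tau) theta) X Yk.
Proof.
have T n j : fieldM X j -> K (pos (pairM 0%M n) root0 j) <->
    sat M (scons n rho) (scons (Zk j) tau) theta.
  move=> Hj; rewrite (_ : scons n rho = envk 1 (pairM 0%M n)); first exact: truth.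
  rewrite envk_pair; congr scons; apply: funext => i.
  by rewrite /envk /ext subn0.
move=> l; split=> [[n [j [-> [Hj Kn]]]]|[n [j [-> [Hj [Z [HZ [ZE Hs]]]]]]]].
  exists n, j; split=> //; split=> //; exists (Zk j); split; first exact: Zk_dset.
  by split=> //; apply/T.
exists n, j; split=> //; split=> //; apply/T => //.
by rewrite (_ : Zk j = Z) //; apply: funext => l'; apply: propext; exact: iff_sym (ZE l').
Qed.

End Truth.

Theorem recursion : exists Y, dset M Y /\
  hierarchyM (fun n Z => sat M (scons n rho) (scons Z tau) theta) X Y.
Proof.
have [K [HK KE]] : exists K, dset M K /\ forall q, K q <-> Top GT ET K q.
  apply: (kernel cousin D1_lo lo_irr lo_trans lo_total lo_wf D1_GT D1_ET) => q a b [Hq].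
  exact: Gf_lo.
by exists (Yk K); split; [exact: Yk_dset|exact: Yk_hierarchy].
Qed.

End WellOrder.

Lemma sat_ATR0 (M : rcaModel) (phi : form) (rho : nat -> dom M) (tau : nat -> dom M -> Prop) :
  cousinM M -> ATR0 phi -> (forall Z, dset M (tau Z)) -> sat M rho tau phi.
Proof.
move=> cousin H Ht; case: H => {phi} [_ [p Hp||p Hp]|theta Hth].
- exact: (rax rho (@RCA0_basic _ Hp) Ht).
- suff H : fR 0 0 rho tau (all1 (fun X => induction (cl X))) (forall A : dom M -> Prop, dset M A ->
      (A 0%M /\ (forall n, A n -> A (n + 1)%M) -> forall n, A n)).
    apply: (proj2 H) => A HA [H0 HS]; apply: (@induct M A) => //.
    by apply: D1_S1; def.
  apply: fR_all1 => A HA; rewrite /induction.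
  have HC : cR 0 1 rho (scons A tau) (cl (bound1 0)) A by apply: cR_cl; exact: sR_bound.
  have HC' n : cR 1 1 (scons n rho) (scons A tau) (cl (bound1 0)) A by exact: cR_up0.
  apply: fR_imp; first apply: fR_and.
  + by apply: fR_cls HC _; exact: tR_zero.
  + apply: fR_all0 => n; apply: fR_imp; first by apply: fR_cls (HC' n) _; exact: tR_bound.
    by apply: fR_cls (HC' n) _; apply: tR_add; [exact: tR_bound|exact: tR_one].
  + by apply: fR_all0 => n; apply: fR_cls (HC' n) _; exact: tR_bound.
- suff H : fR 0 0 rho tau (ex1 (fun X => all0 (fun n => iff_ (cl X n) (schema0 p n))))
      (exists A : dom M -> Prop, dset M A /\ forall n, A n <-> sat M (scons n rho) tau p).
    apply: (proj2 H); exists (fun n => sat M (scons n rho) tau p); split=> //; apply: setD1.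
    apply: D1_ext (arith_D1 cousin Hp 1 rho Ht) _ => v.
    rewrite (_ : ext 1 v rho = scons (v 0%N) rho) //; apply: funext => -[|i] //.
    by rewrite /ext subSS subn0.
  apply: fR_ex1 => A HA; apply: fR_all0 => n; apply: fR_iff.
    by apply: fR_cls; [apply: cR_up0; apply: cR_cl; exact: sR_bound|exact: tR_bound].
  rewrite /fR sat_schema0.
  rewrite (_ : (fun i => scons n rho _) = rho); last by apply: funext => i; rewrite addn1.
  by rewrite (_ : (fun X => scons A tau _) = tau); last by apply: funext => X; rewrite addn1.
- suff H : fR 0 0 rho tau (all1 (fun X => imp (isWO (cl X))
        (ex1 (fun Y => hierarchy theta (cl X) (cl Y)))))
      (forall A : dom M -> Prop, dset M A -> (isWOM A -> exists Y, dset M Y /\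
        hierarchyM (fun n Z => sat M (scons n rho) (scons Z tau) theta) A Y)).
    by apply: (proj2 H) => A HA HWO; exact: (recursion cousin HA HWO Hth rho Ht).
  apply: fR_all1 => A HA.
  have HC : cR 0 1 rho (scons A tau) (cl (bound1 0)) A by apply: cR_cl; exact: sR_bound.
  apply: fR_imp; first exact: fR_isWO.
  apply: fR_ex1 => Y HY.
  have HY' : cR 0 2 rho (scons Y (scons A tau)) (cl (bound1 1)) Y by apply: cR_cl; exact: sR_bound.
  have := fR_hierarchy theta (cR_up1 Y HC) HY'.
  rewrite (_ : (fun i => rho (addn i 0%N)) = rho); last by apply: funext => i; rewrite addn0.
  by rewrite (_ : (fun X => scons Y (scons A tau) (addn X 2%N)) = tau);
    last by apply: funext => X; rewrite addn2.
Qed.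

Theorem theorem6p5 (phi : form) (Hphi : ATR0 phi) :
  prv RCA0 nil (fimp CousinBaire2 phi).
Proof.
apply: completeness => [p sg ta|M HM rho0 tau0 Ht0 Hs He]; first exact: RCA0_subst.
move=> /sat_cousin Hc.
exact: (@sat_ATR0 (RcaModel HM Ht0 Hs He) phi rho0 tau0 Hc Hphi Ht0).
Qed.
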